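(* Fix $\Phi,\Psi\in H^4_{sr}$ and $T_0>0$. For each $\epsilon$ let $r,p$ be the solution of $$\dot r=\delta^+p,\qquad \dot p=\frac1m\,\delta^-(kr)$$ with initial data $$r(j,0)=\Phi(\epsilon j)/k(j),\qquad p(j,0)=\Psi(\epsilon j)\qquad(j\in\mathbb{Z}).$$ Put $$A(X):=\tfrac12\Phi(X)-\tfrac{\sqrt{\tilde k\bar m}}{2}\Psi(X),\qquad B(X):=\tfrac12\Phi(X)+\tfrac{\sqrt{\tilde k\bar m}}{2}\Psi(X).$$ There exists a positive constant $C=C(\tilde k,\bar m,a_k,b_k,a_m,b_m,T_0,\|A\|_{H^4_{sr}},\|B\|_{H^4_{sr}})$ such that for every $\epsilon\in(0,1/2)$ $$\mathbb{E}\left[\sup_{|t|\le T_0/\epsilon}\left\|r(\cdot,t)-\frac1{k(\cdot)}\bigl(A(\epsilon(\cdot-ct))+B(\epsilon(\cdot+ct))\bigr)\right\|_{\ell^2}\right]\le C\left(\epsilon^{1/2}+\max\{\sigma_m,\sigma_k\}\right)$$ and $$\mathbb{E}\left[\sup_{|t|\le T_0/\epsilon}\left\|p(\cdot,t)-\frac1{\sqrt{\tilde k\bar m}}\bigl(-A(\epsilon(\cdot-ct))+B(\epsilon(\cdot+ct))\bigr)\right\|_{\ell^2}\right]\le C\left(\epsilon^{1/2}+\max\{\sigma_m,\sigma_k\}\right).$$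
   Context: Random coefficients: $\{m(j)\}_{j\in\mathbb{Z}}$ are i.i.d. random variables contained almost surely in an interval $[a_m,b_m]\subset(0,\infty)$, with mean $\bar m:=\mathbb{E}[m]$ and standard deviation $\sigma_m$. $\{1/k(j)\}_{j\in\mathbb{Z}}$ are i.i.d. random variables contained almost surely in an interval $[a_k,b_k]\subset(0,\infty)$, with standard deviation $\sigma_k$, and $\tilde k$ is defined by $1/\tilde k:=\mathbb{E}[1/k]$. The wave speed is $c:=\sqrt{\tilde k/\bar m}$. Difference operators on sequences: $(\delta^+f)(j)=f(j+1)-f(j)$ and $(\delta^-f)(j)=f(j)-f(j-1)$. Products and quotients of sequences are taken componentwise. The dot denotes $d/dt$, and $r=r(j,t)$, $p=p(j,t)$ are real valued, $j\in\mathbb{Z}$, $t\in\mathbb{R}$; the solution of the (linear, bounded) system is the one with $r(\cdot,t),p(\cdot,t)\in\ell^2(\mathbb{Z})$. The $\ell^2$ norms are over $j\in\mathbb{Z}$. Function space: for integers $s\ge0$, $\|F\|_{H^s_{sr}}:=\sum_{i=0}^s\bigl\|(1+|\cdot|)^{1/2}F^{(i)}\bigr\|_{L^2(\mathbb{R})}$, and $H^s_{sr}$ is the space of functions $F:\mathbb{R}\to\mathbb{R}$ in $L^2$ with weak derivatives up to order $s$ for which this norm is finite (continuous representatives are used for point evaluation). *)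

(* Defs.v *)
From HB Require Import structures.
From mathcomp Require Import all_boot all_order all_algebra.
From mathcomp Require Import finmap.
From mathcomp Require Import all_classical all_reals all_analysis.

Set Implicit Arguments.
Unset Strict Implicit.
Unset Printing Implicit Defensive.
Import Order.TTheory GRing.Theory Num.Theory.
Import numFieldNormedType.Exports.

Local Open Scope classical_set_scope.
Local Open Scope ring_scope.

Definition test_function (R : realType) (phi : R -> R) : Prop :=
  (forall (n : nat) (x : R), derivable (derive1n n phi) x 1) /\
  (exists M : R, forall x : R, M < `|x| -> phi x = 0).

Definition is_weak_derivative (R : realType) (i : nat) (F G : R -> R) : Prop :=
  locally_integrable setT G /\
  forall phi : R -> R, test_function phi ->
    (\int[lebesgue_measure]_x (F x * derive1n i phi x))%R =
    (-1) ^+ i * (\int[lebesgue_measure]_x (G x * phi x))%R.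

(** A weak derivative is unique up to a null set.  [weak_derivative i F] is a
    chosen version of it, hence meaningful only if [F] has a weak derivative of
    order [i]; [Hsr] below requires this. *)
Definition weak_derivative (R : realType) (i : nat) (F : R -> R) : R -> R :=
  xget (cst 0) [set G : R -> R | is_weak_derivative i F G].

Definition Hsr_norm (R : realType) (s : nat) (F : R -> R) : \bar R :=
  (\sum_(0 <= i < s.+1)
     'N[lebesgue_measure]_2%:E
       [(fun x => (Num.sqrt (1 + `|x|) * weak_derivative i F x)%R%:E)])%E.

Definition Hsr (R : realType) (s : nat) (F : R -> R) : Prop :=
  [/\ F \in Lfun lebesgue_measure 2%:E,
      forall i : nat, (i <= s)%N -> exists G : R -> R, is_weak_derivative i F G
    & (Hsr_norm s F < +oo)%E].

Definition mutually_independent (R : realType) (d : measure_display)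
    (T : measurableType d) (P : probability T R) (X : int -> T -> R) : Prop :=
  forall (J : {fset int}) (B : int -> set R),
    (forall j, measurable (B j)) ->
    P (\bigcap_(j in [set` J]) (X j @^-1` B j)) =
    (\prod_(j <- J) P (X j @^-1` B j))%E.

Definition identically_distributed (R : realType) (d : measure_display)
    (T : measurableType d) (P : probability T R) (X : int -> T -> R) : Prop :=
  forall (i j : int) (B : set R), measurable B ->
    P (X i @^-1` B) = P (X j @^-1` B).

Definition iid (R : realType) (d : measure_display)
    (T : measurableType d) (P : probability T R) (X : int -> T -> R) : Prop :=
  [/\ forall j, measurable_fun setT (X j),
      mutually_independent P X
    & identically_distributed P X].

Definition std_dev (R : realType) (d : measure_display)
    (T : measurableType d) (P : probability T R) (X : T -> R) : R :=
  Num.sqrt (fine ('V_P[X])%E).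

Definition dplus (R : realType) (f : int -> R) (j : int) : R := f (j + 1) - f j.

Definition dminus (R : realType) (f : int -> R) (j : int) : R := f j - f (j - 1).

Definition ell2_norm (R : realType) (f : int -> R) : \bar R :=
  ((\esum_(j in [set: int]) ((f j) ^+ 2)%R%:E) `^ 2^-1%R)%E.

Definition ell2 (R : realType) (f : int -> R) : Prop := (ell2_norm f < +oo)%E.

(** Functions of the lattice site and of time are written [r j t]. *)
Definition lattice_solution (R : realType) (m k : int -> R)
    (r0 p0 : int -> R) (r p : int -> R -> R) : Prop :=
  [/\ forall (j : int) (t : R),
        is_derive t 1 (r j) (dplus (p ^~ t) j),
      forall (j : int) (t : R),
        is_derive t 1 (p j)
          ((m j)^-1 * dminus (fun i => k i * r i t) j),
      forall j : int, r j 0 = r0 j /\ p j 0 = p0 j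
    & forall t : R, ell2 (r ^~ t) /\ ell2 (p ^~ t)].

Definition profileA (R : realType) (kt mb : R) (Phi Psi : R -> R) (X : R) : R :=
  2^-1 * Phi X - Num.sqrt (kt * mb) / 2 * Psi X.

Definition profileB (R : realType) (kt mb : R) (Phi Psi : R -> R) (X : R) : R :=
  2^-1 * Phi X + Num.sqrt (kt * mb) / 2 * Psi X.

Definition wave_speed (R : realType) (kt mb : R) : R := Num.sqrt (kt / mb).

Definition approx_r (R : realType) (kt mb eps : R) (A B : R -> R)
    (k : int -> R) (j : int) (t : R) : R :=
  let c := wave_speed kt mb in
  (k j)^-1 * (A (eps * (j%:~R - c * t)) + B (eps * (j%:~R + c * t))).

Definition approx_p (R : realType) (kt mb eps : R) (A B : R -> R)
    (j : int) (t : R) : R :=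
  let c := wave_speed kt mb in
  (Num.sqrt (kt * mb))^-1 *
    (- A (eps * (j%:~R - c * t)) + B (eps * (j%:~R + c * t))).

(** [ell2_norm] may be [+oo], so the supremum is extended-real valued and the
    expectation is written as an integral.  For the solution of
    [lattice_solution] the integrand agrees off a null set with a measurable
    function (continuity in [t] reduces the supremum to rational times). *)
Definition expected_sup_error (R : realType) (d : measure_display)
    (T : measurableType d) (P : probability T R) (tau : R)
    (f g : T -> int -> R -> R) : \bar R :=
  (\int[P]_w ereal_sup
     [set ell2_norm (fun j => (f w j t - g w j t)%R)
       | t in [set t : R | (`|t| <= tau)%R]])%E.

(* Main.v *)
(** The d'Alembert waves [U = A(eps (j - c t)) + B(eps (j + c t))] and
    [V = (- A + B) / sqrt (kt mb)] solve the lattice equations up to a residual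
    whose random part is [eps (1 / k - 1 / kt) V'] and [eps (m - mb) U'].  With the
    random walks [chi] and [psi] of increments [1 / k - 1 / kt] and [m - mb], the
    correctors [eps kt chi V'] and [eps psi U' / mb] turn this residual into terms
    [eps^2 chi V''], [eps^2 psi U''] and a Taylor remainder [eps^2 V''].  As
    [E chi_j^2 = |j| sigma_k^2], the weight [1 + |x|] of the norm makes the
    correctors of size [sigma] and the residual of size [eps sigma + eps^(3/2)] in
    [ell2]; conservation of energy loses a factor [1 / eps] over the time [T0 / eps].
    The suprema over time are absorbed in deterministic envelopes of the first two
    derivatives of [A] and [B], which are classical by the du Bois-Reymond lemma. *)

Require Import Defs.
From HB Require Import structures.
From mathcomp Require Import all_boot all_order all_algebra.
From mathcomp Require Import all_classical all_reals all_analysis.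
From mathcomp Require Import measurable_realfun.
From mathcomp Require Import finmap.
From mathcomp Require Import ring lra zify.
Set Implicit Arguments.
Unset Strict Implicit.
Unset Printing Implicit Defensive.
Import Order.TTheory GRing.Theory Num.Theory.
Import numFieldNormedType.Exports.
Local Open Scope classical_set_scope.
Local Open Scope ring_scope.

(** * Sums over windows of the lattice *)

(** A solution is only known to lie in [ell2] at each time, with no bound locally uniform in time,
    so its energy series cannot be differentiated term by term. This is why energies are cut off
    before differentiation and why conservation needs a separate rigidity argument. The estimate for
    one realization is deterministic: the squared error is at most a constant times [eps ^+ 2 * Q],
    where [Q] bounds the sums of [walk_weight]. Chance enters only through the expectation of these
    sums, which is linear in the squared walks. The squared envelopes, weighted by [1 + |eps j|],
    sum to at most [L / eps], so this expectation is at most [L / eps * (1 + 4 sig ^+ 2 / eps)], and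
    the factor [eps ^+ 2] turns it into a multiple of [eps + 4 sig ^+ 2]. Four weak derivatives are
    consumed as follows: an envelope of the second derivative needs the third, and the third must be
    continuous for its weighted primitive to be differentiable everywhere; it is continuous as a
    primitive of the fourth, up to a constant. *)

Definition wsum {V : nmodType} (N : nat) (f : int -> V) : V :=
  \sum_(n < N) (f n%:Z + f (- n.+1%:Z)).

Section wsum.
Context {R : realType}.
Implicit Types (f g : int -> R) (N : nat).

Lemma wsumS {V : nmodType} N (f : int -> V) :
  wsum N.+1 f = wsum N f + (f N%:Z + f (- N.+1%:Z)).
Proof. by rewrite /wsum big_ord_recr. Qed.

Lemma wsum0 {V : nmodType} (f : int -> V) : wsum 0 f = 0.
Proof. by rewrite /wsum big_ord0. Qed.

Lemma eq_wsum {V : nmodType} N (f g : int -> V) : f =1 g -> wsum N f = wsum N g.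
Proof. by move=> fg; apply: eq_bigr => n _; rewrite !fg. Qed.

Lemma wsumD N f g : wsum N (fun j => f j + g j) = wsum N f + wsum N g.
Proof. by rewrite /wsum -big_split; apply: eq_bigr => n _ /=; ring. Qed.

Lemma wsumZ N a f : wsum N (fun j => a * f j) = a * wsum N f.
Proof. by rewrite /wsum mulr_sumr; apply: eq_bigr => n _; ring. Qed.

Lemma ler_wsum N f g : (forall j, f j <= g j) -> wsum N f <= wsum N g.
Proof. by move=> fg; apply: ler_sum => n _; apply: lerD. Qed.

Lemma wsum_homo f : (forall j, 0 <= f j) ->
  {homo (fun N => wsum N f) : M N / (M <= N)%N >-> M <= N}.
Proof.
move=> f0; apply: homo_leq => [x|y x z|N]; [exact: lexx|exact: le_trans|].
by rewrite wsumS lerDl addr_ge0.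
Qed.

(** The window is [- N <= j < N]; being half-open, it leaves boundary terms at the symmetric sites
    [N] and [- N], where the tent used later vanishes. *)
Lemma wsum_telescope N f :
  wsum N (fun j => f (j + 1) - f j) = f N%:Z - f (- N%:Z).
Proof.
elim: N => [|N IH]; first by rewrite wsum0 subrr.
rewrite wsumS IH.
have -> : (N%:Z + 1 = N.+1%:Z)%R by lia.
have -> : (- N.+1%:Z + 1 = - N%:Z)%R by lia.
ring.
Qed.

Lemma wsum_addS N f : wsum N (fun j => f (j + 1)) = wsum N f + f N%:Z - f (- N%:Z).
Proof.
rewrite -addrA -(wsum_telescope N f) -wsumD; apply: eq_wsum => j; ring.
Qed.

Lemma wsum_addS_le N f : (forall j, 0 <= f j) ->
  wsum N (fun j => f (j + 1)) <= wsum N.+1 f.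
Proof.
move=> f0; rewrite wsum_addS wsumS.
by have := f0 (- N%:Z); have := f0 (- N.+1%:Z); lra.
Qed.

Definition winseq N : seq int :=
  [seq n%:Z | n <- iota 0 N] ++ [seq - n.+1%:Z | n <- iota 0 N].

Lemma winseq_uniq N : uniq (winseq N).
Proof.
rewrite cat_uniq !map_inj_uniq ?iota_uniq//=; [|by move=> x y; lia..].
rewrite andbT; apply/hasPn => x /mapP[n _ ->]; apply/mapP => -[m _]; lia.
Qed.

Lemma mem_winseq N (j : int) : (`|j| < N)%N -> j \in winseq N.
Proof.
move=> jN; rewrite mem_cat; apply/orP; case: (lerP 0 j) => j0.
  by left; apply/mapP; exists `|j|%N; rewrite ?mem_iota; lia.
by right; apply/mapP; exists (`|j|.-1)%N; rewrite ?mem_iota; lia.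
Qed.

Lemma wsum_winseq {V : nmodType} N (f : int -> V) : wsum N f = \sum_(j <- winseq N) f j.
Proof.
rewrite big_cat !big_map /wsum big_split /=; congr (_ + _);
by rewrite -[in RHS](subn0 N) -/(index_iota _ _) big_mkord.
Qed.

(** Every finite set of sites lies in some window, so for nonnegative terms the supremum over finite
    sets is controlled by windows alone. *)
Lemma esum_int_le (f : int -> R) (c : R) : (forall j, 0 <= f j) ->
  (forall N, wsum N f <= c) -> (\esum_(j in [set: int]) (f j)%:E <= c%:E)%E.
Proof.
move=> f0 fc; apply: ge_ereal_sup => _ [A [finA _] <-].
have [N AN] : exists N, forall j, A j -> j \in winseq N.
  have /finite_seqP[s ->] := finA.
  exists (\sum_(j <- s) `|j|).+1 => j /= js; apply: mem_winseq.
  by rewrite ltnS (big_rem j js)/= leq_addr.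
apply: (@le_trans _ _ (\sum_(j \in [set` winseq N]) (f j)%:E)%E).
  apply: lee_fsum_nneg_subset => //.
    exact: finite_seq.
  by apply/subsetP => j /AN.
  by move=> t _; rewrite lee_fin.
by rewrite -fsbig_seq ?winseq_uniq// sumEFin -wsum_winseq lee_fin.
Qed.

Lemma esum_int_ge (f : int -> R) N : (forall j, 0 <= f j) ->
  ((wsum N f)%:E <= \esum_(j in [set: int]) (f j)%:E)%E.
Proof.
move=> f0; apply: esum_ge; exists [set` winseq N].
  by split => //; exact: finite_seq.
by rewrite -fsbig_seq ?winseq_uniq// sumEFin -wsum_winseq.
Qed.

Lemma ell2_norm_le f (c : R) : 0 <= c ->
  (forall N, wsum N (fun j => f j ^+ 2) <= c ^+ 2) -> (ell2_norm f <= c%:E)%E.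
Proof.
move=> c0 fc; rewrite /ell2_norm.
have F0 : (0 <= \esum_(j in [set: int]) ((f j) ^+ 2)%:E)%E.
  by apply: esum_ge0 => j _; rewrite lee_fin sqr_ge0.
have -> : c%:E = sqrte (c ^+ 2)%:E by rewrite /= sqrtr_sqr ger0_norm.
rewrite poweR12_sqrt// lee_sqrt ?lee_fin ?sqr_ge0//.
by apply: esum_int_le => // j; exact: sqr_ge0.
Qed.

Lemma ell2_wsum f : ell2 f -> exists M, forall N, wsum N (fun j => f j ^+ 2) <= M.
Proof.
move=> /lty_poweRy; rewrite invr_eq0 pnatr_eq0 => /(_ isT) Foo.
have F0 : (0 <= \esum_(j in [set: int]) ((f j) ^+ 2)%:E)%E.
  by apply: esum_ge0 => j _; rewrite lee_fin sqr_ge0.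
exists (fine (\esum_(j in [set: int]) ((f j) ^+ 2)%:E)) => N.
rewrite -lee_fin fineK; last by rewrite ge0_fin_numE.
by apply: esum_int_ge => j; exact: sqr_ge0.
Qed.

End wsum.

(** * Derivatives on the real line and Gronwall's inequality *)

Section derivatives.
Context {R : realType}.
Implicit Types (f g : R -> R) (x a b c : R).

Lemma is_derive_addf f g x a b : is_derive x 1 f a -> is_derive x 1 g b ->
  is_derive x 1 (fun y => f y + g y) (a + b).
Proof. exact: is_deriveD. Qed.

Lemma is_derive_subf f g x a b : is_derive x 1 f a -> is_derive x 1 g b ->
  is_derive x 1 (fun y => f y - g y) (a - b).
Proof. exact: is_deriveB. Qed.

Lemma is_derive_mulf f g x a b : is_derive x 1 f a -> is_derive x 1 g b ->
  is_derive x 1 (fun y => f y * g y) (f x * b + g x * a).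
Proof. exact: is_deriveM. Qed.

Lemma is_derive_cstf c x : is_derive x 1 (fun _ : R => c) 0.
Proof. exact: is_derive_cst. Qed.

Lemma is_derive_ext f g x a : f =1 g -> is_derive x 1 f a -> is_derive x 1 g a.
Proof. by move=> /funext ->. Qed.

Lemma is_derive_scalef c f x a : is_derive x 1 f a ->
  is_derive x 1 (fun y => c * f y) (c * a).
Proof.
by move=> fa; have := is_derive_mulf (is_derive_cstf c x) fa; rewrite mulr0 addr0.
Qed.

Lemma is_derive_sqrf f x a : is_derive x 1 f a ->
  is_derive x 1 (fun y => f y ^+ 2) (2 * f x * a).
Proof.
move=> fa; have -> : 2 * f x * a = f x * a + f x * a by ring.
by apply: is_derive_ext (is_derive_mulf fa fa) => y; rewrite expr2.
Qed.

Lemma is_derive_affine a b x : is_derive x 1 (fun y => a * y + b) a.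
Proof.
have := is_derive_addf (is_derive_scalef a (is_derive_id x 1)) (is_derive_cstf b x).
by rewrite mulr1 addr0.
Qed.

Lemma is_derive_comp_affine f a b x d : is_derive (a * x + b) 1 f d ->
  is_derive x 1 (fun y => f (a * y + b)) (a * d).
Proof.
move=> fd; have ? := is_derive_affine a b x.
by rewrite mulrC; exact: is_derive1_comp.
Qed.

Lemma is_derive_wsum N (F : int -> R -> R) (dF : int -> R) x :
  (forall j, is_derive x 1 (F j) (dF j)) ->
  is_derive x 1 (fun y => wsum N (F ^~ y)) (wsum N dF).
Proof.
move=> FdF; elim: N => [|N IH].
  rewrite wsum0; apply: is_derive_ext (is_derive_cstf 0 x) => y.
  by rewrite wsum0.
rewrite wsumS.
apply: (@is_derive_ext (fun y => wsum N (F ^~ y) + (F N%:Z y + F (- N.+1%:Z) y))).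
by move=> y; rewrite wsumS.
Qed.

Lemma is_derive_continuous f (df : R -> R) :
  (forall x, is_derive x 1 f (df x)) -> continuous f.
Proof.
move=> fdf x; apply: differentiable_continuous.
by apply/derivable1_diffP; have [] := fdf x.
Qed.

Lemma derive_ge0_le f (df : R -> R) a b : a <= b ->
  (forall x, is_derive x 1 f (df x)) -> (forall x, a <= x <= b -> 0 <= df x) ->
  f a <= f b.
Proof.
move=> ab fdf df0.
have [|c cab] := @MVT_segment R f df a b ab (fun x _ => fdf x).
  exact/continuous_subspaceT/(is_derive_continuous fdf).
move=> fE; rewrite -subr_ge0 fE mulr_ge0 ?subr_ge0 ?df0//.
Qed.

Lemma derive_le f g (df dg : R -> R) a b : a <= b ->
  (forall x, is_derive x 1 f (df x)) -> (forall x, is_derive x 1 g (dg x)) ->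
  (forall x, a <= x <= b -> df x <= dg x) ->
  f b - f a <= g b - g a.
Proof.
move=> ab fdf gdg dfg; rewrite -subr_ge0.
have -> : g b - g a - (f b - f a) = (g b - f b) - (g a - f a) by ring.
rewrite subr_ge0.
apply: (derive_ge0_le ab (fun x => is_derive_subf (gdg x) (fdf x))).
by move=> x /dfg; rewrite subr_ge0.
Qed.

(** The integrating factor [E x = expR (- l * (x - a))] is at most 1 on the interval, so [E * f] has
    derivative at most [c] and is compared with a line of slope [c]. *)
Lemma gronwall_forward f (df : R -> R) (l c a b : R) : a <= b -> 0 <= l -> 0 <= c ->
  (forall x, is_derive x 1 f (df x)) ->
  (forall x, a <= x <= b -> df x <= l * f x + c) ->
  f b <= expR (l * (b - a)) * (f a + c * (b - a)).
Proof.
move=> ab l0 c0 fdf dfl.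
pose E x := expR (- l * x + l * a).
have dE x : is_derive x 1 E (- l * E x) by exact: is_derive_comp_affine.
have Ea : E a = 1 by rewrite /E mulNr addNr expR0.
have EK : expR (l * (b - a)) * E b = 1.
  have -> : 1 = expR 0 :> R by rewrite expR0.
  by rewrite -expRD; congr expR; ring.
have H : E b * f b - E a * f a <= c * b + 0 - (c * a + 0).
  apply: (derive_le ab (fun x => is_derive_mulf (dE x) (fdf x)) (is_derive_affine c 0)).
  move=> x /andP[ax xb].
  have E1 : E x <= 1.
    by rewrite -expR0 ler_expR mulNr addrC -mulrBr mulr_ge0_le0 ?subr_le0.
  have -> : E x * df x + f x * (- l * E x) = E x * (df x - l * f x) by ring.
  apply: (@le_trans _ _ (E x * c)).
    by rewrite ler_pM2l ?expR_gt0// lerBlDl dfl ?ax.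
  by rewrite ler_piMl.
have -> : f b = expR (l * (b - a)) * (E b * f b) by rewrite mulrA EK mul1r.
by rewrite ler_pM2l ?expR_gt0//; move: H; rewrite Ea; lra.
Qed.

Lemma gronwall f (df : R -> R) (l c a b s t : R) : 0 <= l -> 0 <= c ->
  (forall x, is_derive x 1 f (df x)) ->
  (forall x, a <= x <= b -> `|df x| <= l * f x + c) ->
  a <= s <= b -> a <= t <= b ->
  f t <= expR (l * `|t - s|) * (f s + c * `|t - s|).
Proof.
move=> l0 c0 fdf dfl /andP[as_ sb] /andP[at_ tb].
case: (lerP s t) => st.
  apply: (gronwall_forward st) => // x /andP[sx xt].
  by apply: le_trans (ler_norm _) _; apply: dfl; lra.
(* Backwards in time, the forward inequality is applied to the reflected function; this is why the
   hypothesis bounds [|df x|]. *)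
have := @gronwall_forward _ _ l c (- s) (- t) _ l0 c0
  (fun x => is_derive_comp_affine (fdf (-1 * x + 0))).
have -> : -1 * - t + 0 = t by ring.
have -> : -1 * - s + 0 = s by ring.
rewrite opprK (addrC (-t)); apply => //; first lra.
move=> x xst; rewrite (mulN1r (df _)); apply: le_trans (ler_norm _) _; rewrite normrN.
apply: dfl; lra.
Qed.

Lemma le_of_le_addn (x y c : R) M :
  (forall N, (M <= N)%N -> x <= y + c / N.+1%:R) -> x <= y.
Proof.
move=> H; apply/ler_addgt0Pl => e e0; rewrite addrC.
have [N Nc] : exists N, `|c| / e < N%:R by exists (Num.bound (`|c| / e)); apply: archi_boundP; exact: divr_ge0 (normr_ge0 _) (ltW e0).
have := H (maxn M N) (leq_maxl _ _) => /le_trans; apply.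
rewrite lerD2l; apply: le_trans (ler_norm _) _.
rewrite normrM normfV normr_nat ler_pdivrMr// -ler_pdivrMl// mulrC.
apply: le_trans (ltW Nc) _; rewrite ler_nat; lia.
Qed.

End derivatives.

(** * Energy of the lattice *)

Section tent.
Context {R : realType}.
Implicit Types (N : nat) (j : int).

(* Cutting off by a tent of slope [1 / N] makes the boundary flux [O(1 / N)], so
   that only finite sums of energies are ever differentiated. *)
Definition tent N j : R := Num.max 0 (1 - (`|j|)%:~R / N%:R).

Lemma tent_ge0 N j : 0 <= tent N j.
Proof. by rewrite le_max lexx. Qed.

Lemma tent_le1 N j : tent N j <= 1.
Proof. by rewrite ge_max ler01 lerBlDr lerDl divr_ge0// ler0z. Qed.

Lemma tent_end N : (0 < N)%N -> tent N N%:Z = 0 /\ tent N (- N%:Z) = 0.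
Proof.
move=> N0; rewrite /tent normrN /= divff ?subrr ?maxxx//.
by rewrite pnatr_eq0 -lt0n.
Qed.

Lemma tent_lipschitz N j : (0 < N)%N -> `|tent N j - tent N (j + 1)| <= N%:R^-1.
Proof.
move=> N0; have N0' : (0 : R) < N%:R by rewrite ltr0n.
have Ni : (0 : R) < N%:R^-1 by rewrite invr_gt0.
have : `|(`|j|)%:~R - (`|j + 1|)%:~R| <= 1 :> R.
  by rewrite -rmorphB /= -intr_norm -[leRHS]/(1%:~R) ler_int; lia.
rewrite /tent; set x := (`|j|)%:~R; set y := (`|j + 1|)%:~R.
rewrite ler_norml => /andP[h1 h2].
have H1 : - N%:R^-1 <= (x - y) / N%:R by rewrite -mulN1r ler_pM2r.
have H2 : (x - y) / N%:R <= N%:R^-1 by rewrite -[leRHS]mul1r ler_pM2r.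
rewrite mulrBl in H1 H2.
rewrite /Num.max ler_norml; case: ifPn; case: ifPn; rewrite -?leNgt; lra.
Qed.

Lemma tent_ge N M j : (`|j| <= M)%N -> 1 - M%:R / N%:R <= tent N j.
Proof.
move=> jM; rewrite le_max; apply/orP; right.
rewrite lerD2l lerN2 ler_wpM2r ?invr_ge0// -[leRHS]/(M%:Z%:~R) ler_int; lia.
Qed.

Lemma wsum_summation_by_parts N (w b : int -> R) : w N%:Z = 0 -> w (- N%:Z) = 0 ->
  wsum N (fun j => w j * (b (j + 1) - b j)) =
  wsum N (fun j => (w j - w (j + 1)) * b (j + 1)).
Proof.
move=> wN wN'; have := wsum_telescope N (fun j => w j * b j).
rewrite wN wN' !mul0r subrr => T.
rewrite -[LHS]addr0 -oppr0 -T -mulN1r -wsumZ -wsumD.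
by apply: eq_wsum => j; ring.
Qed.

(** The tent is at least [1 - M / N] on the smaller window; the defect goes to the right-hand side,
    where it vanishes as [N] grows. *)
Lemma wsum_le_tent M N (f : int -> R) (c : R) : (M <= N)%N -> (forall j, 0 <= f j) ->
  wsum N (fun j => tent N j * f j) <= c ->
  wsum M f <= c + M%:R / N%:R * wsum M f.
Proof.
move=> MN f0 fc; rewrite -lerBlDr; apply: le_trans fc.
apply: le_trans (wsum_homo _ MN); last by move=> j; rewrite mulr_ge0 ?tent_ge0.
rewrite -[X in X - _]mul1r -mulrBl -wsumZ.
rewrite /wsum; apply: ler_sum => -[n nM] _ /=.
by apply: lerD; apply: ler_wpM2r; rewrite ?f0// tent_ge//; lia.
Qed.

End tent.

Section energy.
Context {R : realType}.
Implicit Types (N : nat) (j : int) (t : R).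
Variables (m k : int -> R) (K mlo : R).
Hypothesis k_gt0 : forall j, 0 < k j.
Hypothesis k_le : forall j, k j <= K.
Hypothesis mlo_gt0 : 0 < mlo.
Hypothesis m_ge : forall j, mlo <= m j.
Variables (r p f g : int -> R -> R).
Hypothesis dr : forall j t, is_derive t 1 (r j) (dplus (p ^~ t) j + f j t).
Hypothesis dp : forall j t, is_derive t 1 (p j)
  ((m j)^-1 * (dminus (fun i => k i * r i t) j + g j t)).

Definition energy (j : int) (t : R) : R := k j * r j t ^+ 2 + m j * p j t ^+ 2.

Let m_gt0 j : 0 < m j. Proof. exact: lt_le_trans (m_ge j). Qed.

Lemma energy_ge0 j t : 0 <= energy j t.
Proof. by rewrite addr_ge0// mulr_ge0 ?sqr_ge0// ltW. Qed.

Let work j t := 2 * (k j * r j t * f j t + p j t * g j t).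

Let flux j t := k (j - 1) * r (j - 1) t * p j t.

(** This is the local balance law: a discrete divergence of the flux plus the work of the forcing.
    The weights [k] and [m] in the energy are those for which the cross terms assemble into a
    difference. *)
Lemma is_derive_energy j t :
  is_derive t 1 (energy j) (2 * (flux (j + 1) t - flux j t) + work j t).
Proof.
have D := is_derive_addf (is_derive_scalef (k j) (is_derive_sqrf (dr j t)))
  (is_derive_scalef (m j) (is_derive_sqrf (dp j t))).
apply: is_derive_eq D _; rewrite /flux /work /dplus /dminus addrK.
have mE : m j * (m j)^-1 = 1 by rewrite divff// gt_eqF.
set x := k j * r j t; set y := (p (j + 1) t); set z := k (j - 1) * r (j - 1) t.
transitivity (2 * x * (y - p j t + f j t) + 2 * p j t * (x - z + g j t) * (m j * (m j)^-1)).
  by rewrite /x; ring.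
rewrite mE /x; ring.
Qed.

Let tent_energy N t : R := wsum N (fun j => tent N j * energy j t).

Lemma is_derive_tent_energy N t : (0 < N)%N ->
  is_derive t 1 (tent_energy N)
    (wsum N (fun j => 2 * ((tent N j - tent N (j + 1)) * flux (j + 1) t)) +
     wsum N (fun j => tent N j * work j t)).
Proof.
move=> N0; have [tN tN'] := @tent_end R N N0.
rewrite (wsumZ N 2) -(wsum_summation_by_parts (fun j => flux j t)) // -wsumZ -wsumD.
have E : (fun j => tent N j * (2 * (flux (j + 1) t - flux j t) + work j t)) =1
  (fun j => 2 * (tent N j * (flux (j + 1) t - flux j t)) + tent N j * work j t).
  by move=> j; ring.
rewrite -(eq_wsum N E).
exact: is_derive_wsum (fun j => is_derive_scalef (tent N j) (is_derive_energy j t)).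
Qed.

Variables (a b l Q M : R) (q : int -> R).
Hypothesis l_ge0 : 0 <= l.
Hypothesis q_ge0 : forall j, 0 <= q j.
Hypothesis q_le : forall N, wsum N q <= Q.
Hypothesis r_le : forall t, a <= t <= b -> forall N, wsum N (fun j => r j t ^+ 2) <= M.
Hypothesis p_le : forall t, a <= t <= b -> forall N, wsum N (fun j => p j t ^+ 2) <= M.
Hypothesis work_le : forall j t, a <= t <= b ->
  `|2 * (k j * r j t * f j t + p j t * g j t)| <= l * energy j t + q j.

Lemma wsum_norm_le N (h : int -> R) : `|wsum N h| <= wsum N (fun j => `|h j|).
Proof.
rewrite /wsum; apply: le_trans (ler_norm_sum _ _ _) _.
by apply: ler_sum => n _; exact: ler_normD.
Qed.

(** After summation by parts the flux meets only the slope of the tent, at most [1 / N], and twice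
    the flux is at most [K ^+ 2 * r ^+ 2 + p ^+ 2], whose window sums are bounded by hypothesis. *)
Lemma tent_energy_derive_le N t : (0 < N)%N -> a <= t <= b ->
  `|wsum N (fun j => 2 * ((tent N j - tent N (j + 1)) * flux (j + 1) t)) +
     wsum N (fun j => tent N j * work j t)|
  <= l * tent_energy N t + (Q + (K ^+ 2 + 1) * M / N%:R).
Proof.
move=> N0 tab.
have -> : l * tent_energy N t + (Q + (K ^+ 2 + 1) * M / N%:R) =
  (K ^+ 2 + 1) * M / N%:R + (l * tent_energy N t + Q) by ring.
apply: le_trans (ler_normD _ _) _; apply: lerD.
  apply: le_trans (wsum_norm_le _ _) _.
  have Ni : (0 : R) < N%:R^-1 by rewrite invr_gt0 ltr0n.
  apply: (@le_trans _ _ (N%:R^-1 * (K ^+ 2 * wsum N (fun j => r j t ^+ 2) + wsum N (fun j => p (j + 1) t ^+ 2)))).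
    rewrite -wsumZ -wsumD -wsumZ; apply: ler_wsum => j.
    rewrite mulrCA normrM ler_pM ?tent_lipschitz//.
    rewrite /flux addrK.
    have h1 : (k j * r j t) ^+ 2 <= K ^+ 2 * r j t ^+ 2.
      by rewrite exprMn ler_wpM2r ?sqr_ge0// lerXn2r ?nnegrE ?(ltW (k_gt0 _))// (le_trans (ltW (k_gt0 j))).
    move: h1; move: (k j * r j t) (p _ _) (K ^+ 2 * _) => x y z h1.
    rewrite ler_norml; have := sqr_ge0 (x + y); have := sqr_ge0 (x - y); nra.
  have M0 : 0 <= M.
    by have := r_le tab 0; rewrite wsum0.
  rewrite [leRHS]mulrC ler_pM2l// mulrDl mul1r lerD//.
    by rewrite ler_wpM2l ?sqr_ge0// r_le.
  apply: le_trans (p_le tab N.+1).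
  by apply: (@wsum_addS_le _ N (fun j => p j t ^+ 2)) => j; exact: sqr_ge0.
apply: le_trans (wsum_norm_le _ _) _.
apply: (@le_trans _ _ (wsum N (fun j => l * (tent N j * energy j t) + q j))).
  apply: ler_wsum => j; have t0 := @tent_ge0 R N j; have t1 := @tent_le1 R N j.
  rewrite normrM ger0_norm//.
  apply: le_trans (ler_wpM2l t0 (work_le j tab)) _.
  by rewrite mulrDr mulrCA lerD2l ler_piMl.
by rewrite wsumD wsumZ lerD2l.
Qed.

Lemma energy_bound (s t E0 : R) : a <= s <= b -> a <= t <= b ->
  (forall N, wsum N (energy ^~ s) <= E0) ->
  forall N, wsum N (energy ^~ t) <= expR (l * `|t - s|) * (E0 + Q * `|t - s|).
Proof.
move=> sab tab E0s N.
(* [C] collects all that comes with a factor [1 / n.+1]: the flux through the tent and the defect of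
   the tent on the window [N]. *)
pose C := expR (l * `|t - s|) * ((K ^+ 2 + 1) * M) * `|t - s| + N%:R * wsum N (energy ^~ t).
apply: (@le_of_le_addn R _ _ C N) => n Nn.
have M0 : 0 <= M by have := r_le sab 0; rewrite wsum0.
have Q0 : 0 <= Q by have := q_le 0; rewrite wsum0.
have c0 : 0 <= Q + (K ^+ 2 + 1) * M / n.+1%:R.
  by rewrite addr_ge0// divr_ge0// mulr_ge0// addr_ge0// sqr_ge0.
have G := gronwall l_ge0 c0 (fun x => is_derive_tent_energy x (ltn0Sn n))
  (fun x => @tent_energy_derive_le n.+1 x (ltn0Sn n)) sab tab.
apply: le_trans (wsum_le_tent (leqW Nn) (energy_ge0 ^~ t) G) _.
have T0 : tent_energy n.+1 s <= E0.
  apply: le_trans (E0s n.+1); apply: ler_wsum => j.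
  by rewrite ler_piMl ?energy_ge0 ?tent_le1.
rewrite /C; move: (expR_ge0 (l * `|t - s|)) (normr_ge0 (t - s)).
move: (expR (l * `|t - s|)) => x; move: `|t - s| => y x0 y0.
set W := wsum N _.
have -> : x * (E0 + Q * y) + (x * ((K ^+ 2 + 1) * M) * y + N%:R * W) / n.+1%:R =
  x * (E0 + (Q + (K ^+ 2 + 1) * M / n.+1%:R) * y) + N%:R / n.+1%:R * W by ring.
rewrite lerD2r; apply: ler_wpM2l => //; rewrite lerD2r//.
Qed.

End energy.

(* A solution is in [ell2] at each time, but nothing bounds its norm locally in
   time.  Its energy is lower semicontinuous in time and constant on intervals
   where it is bounded; this alone forces the energy to be constant. *)
Section rigidity.
Context {R : realType}.

Definition lower_semicontinuous_everywhere (E : R -> R) :=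
  forall x M, M < E x -> exists2 d, 0 < d & forall y, `|y - x| < d -> M < E y.

Definition constant_where_bounded (E : R -> R) :=
  forall a b M, a <= b -> (forall t, a <= t <= b -> E t <= M) -> E a = E b.

(** The interval to the left of [x] on which [E] stays above [M] is maximal down to [al]. There [E]
    is constant, and lower semicontinuity at [al] would extend the interval unless [al = a]. *)
Lemma rigid_left (E : R -> R) (a b M x : R) :
  lower_semicontinuous_everywhere E -> constant_where_bounded E ->
  (forall a' b', a <= a' -> a' <= b' -> b' <= b ->
     (forall t, a' <= t <= b' -> M < E t) -> E a' = E b') ->
  a <= x <= b -> M < E x -> E a = E x.
Proof.
move=> lscE cstE H /andP[ax xb] Mx.
pose S := [set y | a <= y <= x /\ forall z, y <= z <= x -> M < E z].
have Sx : S x.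
  split; first by rewrite ax lexx.
  by move=> z; rewrite -eq_le => /eqP <-.
have Slb : lbound S a by move=> y [/andP[]].
have hiS : has_inf S by split; [exists x|exists a].
set al := inf S.
have a_al : a <= al by apply: lb_le_inf => //; exists x.
have al_x : al <= x by apply: ge_inf => //; exists a.
have above y : al < y -> y <= x -> forall z, y <= z <= x -> M < E z.
  move=> aly yx z /andP[yz zx].
  have [s [_ Ss]] := inf_lt hiS.1 aly; move=> sy; apply: Ss.
  by rewrite zx (le_trans (ltW sy)).
have eqx y : al < y -> y <= x -> E y = E x.
  move=> aly yx; apply: H => //; first exact: le_trans (ltW aly).
  exact: above.
(* On []al, x]] the value is [E x], so [E] is bounded on the closed interval and its left end is
   reached as well. *)
have Eal : E al = E x.
  apply: (cstE al x (Num.max (E al) (E x))) => // t /andP[].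
  rewrite le_eqVlt => /predU1P[<- _|alt_ tx]; first by rewrite le_max lexx.
  by rewrite (eqx t)// le_max lexx orbT.
suff : ~ a < al by move/negP; rewrite -leNgt => ala; rewrite (@le_anti _ _ a al) ?a_al.
move=> a_lt; have [d d0 dE] := lscE al M (eq_ind_r (fun z => M < z) Mx Eal).
pose y := Num.max a (al - d / 2).
have yal : y < al by rewrite gt_max a_lt /=; lra.
have Sy : S y.
  split; first by rewrite le_max lexx /= (le_trans (ltW yal)).
  move=> z /andP[yz zx]; case: (ltP al z) => zal; first by apply: (above z) => //; rewrite lexx.
  apply: dE; rewrite ler0_norm; last lra.
  by move: yz; rewrite ge_max => /andP[]; lra.
have : al <= y by apply: ge_inf => //; exists a.
by rewrite leNgt yal.
Qed.

(** Without such a subinterval, either [E <= M] throughout and [E] is constant, or some point lies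
    above [M] and its value propagates to both ends. *)
Lemma rigid_subinterval (E : R -> R) (a b M : R) :
  lower_semicontinuous_everywhere E -> constant_where_bounded E ->
  a <= b -> E a != E b -> exists a' b',
  [/\ a <= a', a' <= b', b' <= b, E a' != E b' & forall t, a' <= t <= b' -> M < E t].
Proof.
move=> lscE cstE ab; apply: contraNP => noab; apply/eqP.
have H a' b' : a <= a' -> a' <= b' -> b' <= b ->
     (forall t, a' <= t <= b' -> M < E t) -> E a' = E b'.
  move=> aa' a'b' b'b Mab; apply/eqP/negPn/negP => nE; apply: noab.
  by exists a', b'.
have [[x xab Mx]|nx] := pselect (exists2 x, a <= x <= b & M < E x); last first.
  apply: (cstE a b M) => // t tab; rewrite leNgt; apply/negP => Mt.
  by apply: nx; exists t.
rewrite (rigid_left lscE cstE H xab Mx).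
(* The right end is reached by reflecting time. *)
have := @rigid_left (fun t => E (- t)) (- b) (- a) M (- x); rewrite !opprK => -> //.
- move=> y N NE; have [d d0 dE] := lscE _ _ NE; exists d => // z zy; apply: dE.
  by rewrite -normrN opprD !opprK.
- move=> a' b' N a'b' HN; apply/esym/(cstE _ _ N); first by rewrite lerN2.
  by move=> t /andP[h1 h2]; rewrite -(opprK t); apply: HN; rewrite lerNr h2 lerNl h1.
- move=> a' b' h1 h2 h3 HM; apply/esym/H; rewrite ?lerN2//; [by rewrite lerNr|by rewrite lerNl|].
  by move=> t /andP[h4 h5]; rewrite -(opprK t); apply: HM; rewrite lerNr h5 lerNl h4.
- by rewrite !lerN2 andbC.
Qed.

(* Otherwise the previous lemma yields nested intervals on which [E] exceeds
   every bound, and [E] would be infinite at a common point. *)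
Lemma rigid (E : R -> R) : lower_semicontinuous_everywhere E ->
  constant_where_bounded E -> forall a b, a <= b -> E a = E b.
Proof.
move=> lscE cstE a b ab; apply/eqP/negPn/negP => nE.
pose good (I : R * R) := I.1 <= I.2 /\ E I.1 != E I.2.
have step (nI : nat * (R * R)) : exists J : R * R, good nI.2 ->
    [/\ good J, nI.2.1 <= J.1, J.2 <= nI.2.2 &
        forall t, J.1 <= t <= J.2 -> nI.1%:R < E t].
  (* The pair [(0, 0)] is a default for intervals that are not good, of which nothing is asked. *)
  case: (pselect (good nI.2)) => [[le12 ne12]|ng]; last by exists (0, 0).
  have [a' [b' [h1 h2 h3 h4 h5]]] := rigid_subinterval nI.1%:R lscE cstE le12 ne12.
  by exists (a', b').
have [F FP] := choice step.
pose I := fix I n := if n is n'.+1 then F (n', I n') else (a, b).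
have Igood n : good (I n).
  by elim: n => [//|n IH]; have [] := FP (n, I n) IH.
have IS n : [/\ (I n).1 <= (I n.+1).1, (I n.+1).2 <= (I n).2 &
    forall t, (I n.+1).1 <= t <= (I n.+1).2 -> n%:R < E t].
  by have [] := FP (n, I n) (Igood n).
have I1 : {homo (fun n => (I n).1) : n k / (n <= k)%N >-> n <= k}.
  by apply: homo_leq => [x|x y z|n]; [exact: lexx|exact: le_trans|have [] := IS n].
have I2 : {homo (fun n => (I n).2) : n k / (n <= k)%N >-> k <= n}.
  apply: homo_leq => [x|x y z h1 h2|n]; [exact: lexx|exact: le_trans h2 h1|].
  by have [] := IS n.
have I12 n k : (I n).1 <= (I k).2.
  apply: (@le_trans _ _ (I (maxn n k)).1); first by apply: I1; rewrite leq_maxl.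
  apply: (@le_trans _ _ (I (maxn n k)).2); first by have [] := Igood (maxn n k).
  by apply: I2; rewrite leq_maxr.
pose x := sup (range (fun n => (I n).1)).
have hs : has_sup (range (fun n => (I n).1)).
  by split; [exists (I 0).1, 0%N|exists (I 0).2 => _ [n _ <-]].
have xI n : (I n).1 <= x <= (I n).2.
  apply/andP; split; first by apply: ub_le_sup; [case: hs|exists n].
  by apply: ge_sup; [case: hs|move=> _ [k _ <-]].
have [n En] : exists n, E x < n%:R.
  exists (Num.bound `|E x|); apply: le_lt_trans (ler_norm _) _.
  exact: archi_boundP.
have [_ _ /(_ x (xI n.+1))] := IS n.
by rewrite ltNge (ltW En).
Qed.

End rigidity.

(** * Conservation of energy for lattice solutions *)

Section conservation.
Context {R : realType}.
Variables (m k : int -> R) (klo K mlo : R).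
Hypothesis klo_gt0 : 0 < klo.
Hypothesis k_ge : forall j, klo <= k j.
Hypothesis k_le : forall j, k j <= K.
Hypothesis mlo_gt0 : 0 < mlo.
Hypothesis m_ge : forall j, mlo <= m j.
Variables (r p : int -> R -> R).
Hypothesis dr : forall (j : int) (t : R), is_derive t 1 (r j) (dplus (p ^~ t) j).
Hypothesis dp : forall (j : int) (t : R), is_derive t 1 (p j)
  ((m j)^-1 * dminus (fun i => k i * r i t) j).

Let k_gt0 j : 0 < k j. Proof. exact: lt_le_trans (k_ge j). Qed.

Lemma energy_lower (j : int) (t : R) :
  klo * r j t ^+ 2 <= energy m k r p j t /\ mlo * p j t ^+ 2 <= energy m k r p j t.
Proof.
have h1 : klo * r j t ^+ 2 <= k j * r j t ^+ 2 by rewrite ler_wpM2r ?sqr_ge0.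
have h2 : mlo * p j t ^+ 2 <= m j * p j t ^+ 2 by rewrite ler_wpM2r ?sqr_ge0.
have h3 : 0 <= klo * r j t ^+ 2 by rewrite mulr_ge0 ?sqr_ge0// ltW.
have h4 : 0 <= mlo * p j t ^+ 2 by rewrite mulr_ge0 ?sqr_ge0// ltW.
by rewrite /energy; split; lra.
Qed.

Hypothesis energy_finite : forall t : R,
  exists M, forall N, wsum N (energy m k r p ^~ t) <= M.

(** The total energy is a supremum of continuous window energies, hence lower semicontinuous; where
    it is bounded, the cut-off estimate without forcing makes it constant. Rigidity then applies. *)
Lemma energy_conserved (s t E0 : R) :
  (forall N, wsum N (energy m k r p ^~ s) <= E0) ->
  forall N, wsum N (energy m k r p ^~ t) <= E0.
Proof.
pose S u := range (fun N => wsum N (energy m k r p ^~ u)).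
pose E u := sup (S u).
have S0 u : S u !=set0 by exists (wsum 0 (energy m k r p ^~ u)), 0%N.
have Sub u : has_ubound (S u).
  by have [M HM] := energy_finite u; exists M => _ [N _ <-].
have ES u N : wsum N (energy m k r p ^~ u) <= E u.
  by apply: ub_le_sup => //; exists N.
have dE (N : nat) (u : R) : is_derive u 1 (fun v => wsum N (energy m k r p ^~ v))
    (wsum N (fun j => 'D_1 (energy m k r p j) u)).
  apply: is_derive_wsum => j; apply: derivableP.
  have D := is_derive_addf (is_derive_scalef (k j) (is_derive_sqrf (dr j u)))
    (is_derive_scalef (m j) (is_derive_sqrf (dp j u))).
  by case: D.
have lscE : lower_semicontinuous_everywhere E.
  move=> x M Mx.
  have [_ [N _ <-] MN] := sup_gt (S0 x) Mx.
  have /(_ x)/cvgrPdist_lt := is_derive_continuous (dE N).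
  move=> /(_ (wsum N (energy m k r p ^~ x) - M)); rewrite subr_gt0 => /(_ MN).
  move=> /nbhs_ballP[d /= d0 dN]; exists d => // y yx.
  have := dN y; rewrite /ball /= distrC => /(_ yx); rewrite ltr_norml => /andP[_].
  have := ES y N; lra.
have cstE : constant_where_bounded E.
  move=> a b M ab EM.
  have M0 : 0 <= M.
    apply: le_trans (EM a _); last by rewrite lexx.
    by apply: le_trans (ES a 0%N); rewrite wsum0.
  have cmp u v : a <= u <= b -> a <= v <= b -> E v <= E u.
    move=> uab vab; apply: ge_sup => // _ [N _ <-].
    (* With zero forcing, rate and source the bound reads [E v <= E u]; exchanging [u] and [v] gives
       equality. An energy bound [M] yields [M / klo] and [M / mlo] for the two components. *)
    have B := @energy_bound R m k K mlo k_gt0 k_le mlo_gt0 m_ge r p (fun _ _ => 0)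
      (fun _ _ => 0) _ _ a b 0 0 (M / klo + M / mlo) (fun=> 0) (lexx _) (fun=> lexx _).
    have := B _ _ _ _ _ _ u v (E u) uab vab (ES u) N.
    rewrite !mul0r expR0 mul1r addr0; apply.
    - by move=> j t'; rewrite addr0.
    - by move=> j t'; rewrite addr0.
    - by move=> n; rewrite /wsum big1// => i _; rewrite addr0.
    - move=> w wab n; apply: (@le_trans _ _ (M / klo)).
        rewrite ler_pdivlMr// mulrC -wsumZ; apply: le_trans (EM w wab).
        by apply: le_trans (ES w n); apply: ler_wsum => j; have [] := energy_lower j w.
      by rewrite lerDl divr_ge0 ?(ltW mlo_gt0).
    - move=> w wab n; apply: (@le_trans _ _ (M / mlo)).
        rewrite ler_pdivlMr// mulrC -wsumZ; apply: le_trans (EM w wab).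
        by apply: le_trans (ES w n); apply: ler_wsum => j; have [] := energy_lower j w.
      by rewrite lerDr divr_ge0 ?(ltW klo_gt0).
    - by move=> j w _; rewrite !mulr0 addr0 mulr0 normr0 mul0r addr0.
  by apply/eqP; rewrite eq_le !cmp ?lexx ?ab.
move=> Es N; apply: le_trans (ES t N) _.
have -> : E t = E s.
  by case: (leP t s) => ts; [apply: rigid|apply/esym/rigid => //; exact: ltW].
by apply: ge_sup => // _ [n _ <-].
Qed.

End conservation.

(** * Residual of the corrected approximation *)

Section taylor.
Context {R : realType}.

Lemma sqr_normE (x : R) : `|x| ^+ 2 = x ^+ 2.
Proof. by rewrite real_normK ?num_real. Qed.

Lemma lipschitz_ball (F dF : R -> R) (y e s h : R) :
  (forall x : R, is_derive x 1 F (dF x)) ->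
  (forall x, `|x - y| <= e -> `|dF x| <= s) -> `|h| <= e ->
  `|F (y + h) - F y| <= s * `|h|.
Proof.
move=> FdF dFs he.
have mvt a b : a <= b -> exists2 c, a <= c <= b & F b - F a = dF c * (b - a).
  move=> ab; have [|c cab ->] := @MVT_segment R F dF a b ab (fun x _ => FdF x).
    exact/continuous_subspaceT/(is_derive_continuous FdF).
  by exists c.
case: (lerP 0 h) => h0.
  have [|c /andP[c1 c2] ->] := mvt y (y + h); first by rewrite lerDl.
  rewrite addrAC subrr add0r normrM (ger0_norm h0) ler_wpM2r// dFs//.
  by rewrite ger0_norm ?subr_ge0//; move: he; rewrite ger0_norm//; lra.
have [|c /andP[c1 c2] E] := mvt (y + h) y; first by rewrite gerDl ltW.
rewrite distrC E opprD addrA subrr add0r normrM normrN (ltr0_norm h0).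
rewrite ler_wpM2r ?oppr_ge0 ?(ltW h0)// dFs//.
by rewrite ler0_norm ?subr_le0//; move: he; rewrite ltr0_norm//; lra.
Qed.

(** The Lipschitz bound is used twice: on [F1], then on [F x - F1 y * x], whose derivative is
    [F1 x - F1 y]. This loses the factor 1/2 of Taylor's formula. *)
Lemma taylor_ball (F F1 F2 : R -> R) (y e s h : R) :
  (forall x : R, is_derive x 1 F (F1 x)) -> (forall x : R, is_derive x 1 F1 (F2 x)) ->
  (forall x, `|x - y| <= e -> `|F2 x| <= s) -> `|h| <= e ->
  `|F (y + h) - F y - h * F1 y| <= s * h ^+ 2.
Proof.
move=> dF dF1 F2s he.
have dG (x : R) : is_derive x 1 (fun x => F x - F1 y * x) (F1 x - F1 y * 1).
  exact: is_derive_subf (dF x) (is_derive_scalef (F1 y) (is_derive_id x 1)).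
have s0 : 0 <= s.
  apply: le_trans (normr_ge0 (F2 y)) (F2s y _).
  by rewrite subrr normr0 (le_trans _ he).
have := @lipschitz_ball _ _ y `|h| (s * `|h|) h dG.
have -> : F (y + h) - F1 y * (y + h) - (F y - F1 y * y) = F (y + h) - F y - h * F1 y by ring.
rewrite -mulrA -expr2 sqr_normE; apply => // x xh.
have := lipschitz_ball dF1 F2s (le_trans xh he).
by rewrite mulr1 [y + _]addrC subrK => /le_trans; apply; rewrite ler_wpM2l.
Qed.

(** The shape is that of the residuals: a Taylor remainder and one term for each of the two walks
    [u] and [v]. *)
Lemma sqr_add3_le (x y w a b c h u v : R) : 0 <= h ->
  `|x| <= a * h -> `|y| <= b * h * `|v| -> `|w| <= c * h * `|u| ->
  (x + y + w) ^+ 2 <= 3 * (a ^+ 2 + b ^+ 2 + c ^+ 2) * (h ^+ 2 * (1 + u ^+ 2 + v ^+ 2)).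
Proof.
move=> h0 xa yb wc.
have sq (p q : R) : `|p| <= q -> p ^+ 2 <= q ^+ 2.
  by move=> pq; rewrite -(sqr_normE p) lerXn2r ?nnegrE// (le_trans _ pq).
have := sq _ _ xa; have := sq _ _ yb; have := sq _ _ wc.
rewrite !exprMn !sqr_normE.
have := sqr_ge0 (x - y); have := sqr_ge0 (x - w); have := sqr_ge0 (y - w).
move=> i1 i2 i3 j1 j2 j3.
apply: (@le_trans _ _ (3 * (x ^+ 2 + y ^+ 2 + w ^+ 2))).
  by move: i1 i2 i3; nra.
rewrite -mulrA ler_pM2l//.
have := sqr_ge0 a; have := sqr_ge0 b; have := sqr_ge0 c; have := sqr_ge0 u.
have := sqr_ge0 v; have := sqr_ge0 h; move: j1 j2 j3.
move: (x ^+ 2) (y ^+ 2) (w ^+ 2) (a ^+ 2) (b ^+ 2) (c ^+ 2) (h ^+ 2) (u ^+ 2) (v ^+ 2).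
move=> X Y W a2 b2 c2 h2 u2 v2 j1 j2 j3 h20 v20 u20 c20 b20 a20.
have := mulr_ge0 a20 h20; have := mulr_ge0 b20 h20; have := mulr_ge0 c20 h20.
move: j1 j2 j3; rewrite !mulrDl !mulrDr !mulr1.
set ah := a2 * h2; set bh := b2 * h2; set ch := c2 * h2.
rewrite ![_ * (h2 * _)]mulrA -/ah -/bh -/ch => j1 j2 j3 c0 b0 a0.
have := mulr_ge0 a0 u20; have := mulr_ge0 a0 v20; have := mulr_ge0 b0 u20.
have := mulr_ge0 c0 v20; lra.
Qed.

End taylor.

Section bounded_families.
Context {R : realType}.
Implicit Types (I : set R) (F G : R -> int -> R).

Definition ell2_bounded I F := exists M, forall t N, I t ->
  wsum N (fun j => F t j ^+ 2) <= M.

Lemma ell2_boundedD I F G : ell2_bounded I F -> ell2_bounded I G ->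
  ell2_bounded I (fun t j => F t j + G t j).
Proof.
move=> [M HM] [N HN]; exists (2 * M + 2 * N) => t n It.
apply: (@le_trans _ _ (wsum n (fun j => 2 * F t j ^+ 2 + 2 * G t j ^+ 2))).
  by apply: ler_wsum => j; have := sqr_ge0 (F t j - G t j); nra.
by rewrite wsumD !wsumZ lerD// ler_pM2l// ?HM ?HN.
Qed.

Lemma ell2_bounded_le I F G a : ell2_bounded I F ->
  (forall t j, I t -> `|G t j| <= a * `|F t j|) -> ell2_bounded I G.
Proof.
move=> [M HM] GF; exists (a ^+ 2 * M) => t n It.
apply: le_trans (ler_wpM2l (sqr_ge0 a) (HM t n It)); rewrite -wsumZ.
apply: ler_wsum => j; rewrite -(sqr_normE (G t j)) -(sqr_normE (F t j)) -exprMn.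
by rewrite lerXn2r ?nnegrE// ?GF// (le_trans _ (GF t j It)).
Qed.

End bounded_families.

Section waves.
Context {R : realType}.
Variables (eps c T0 : R).
Hypothesis eps_gt0 : 0 < eps.
Hypothesis eps_le1 : eps <= 1.
Hypothesis c_gt0 : 0 < c.
Implicit Types (F G : R -> R) (j : int) (t : R).

Definition waves (F G : R -> R) (j : int) (t : R) : R :=
  F (eps * (j%:~R - c * t)) + G (eps * (j%:~R + c * t)).

(** A time derivative flips the sign of the right-moving part. The sums [S0, S1, S2] and differences
    [D0, D1, D2] below therefore alternate. *)
Lemma is_derive_waves F G (F1 G1 : R -> R) j t :
  (forall x : R, is_derive x 1 F (F1 x)) -> (forall x : R, is_derive x 1 G (G1 x)) ->
  is_derive t 1 (waves F G j) (eps * c * waves (fun x => - F1 x) G1 j t).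
Proof.
move=> dF dG.
have D := is_derive_addf
  (is_derive_comp_affine (dF (- (eps * c) * t + eps * j%:~R)))
  (is_derive_comp_affine (dG (eps * c * t + eps * j%:~R))).
have E1 u : eps * (j%:~R - c * u) = - (eps * c) * u + eps * j%:~R by ring.
have E2 u : eps * (j%:~R + c * u) = eps * c * u + eps * j%:~R by ring.
have -> : eps * c * waves (fun x => - F1 x) G1 j t =
  - (eps * c) * F1 (- (eps * c) * t + eps * j%:~R) +
  eps * c * G1 (eps * c * t + eps * j%:~R) by rewrite /waves E1 E2; ring.
by apply: is_derive_ext D => u; rewrite /waves E1 E2.
Qed.

(** Up to time [T0 / eps] the characteristics through site [j] move by at most [c * T0] in the slow
    variable; the extra 1 leaves room for increments of size [eps]. *)
Definition near_site j x := `|x - eps * j%:~R| <= c * T0 + 1.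

Lemma near_site_minus j t x : `|t| <= T0 / eps ->
  `|x - eps * (j%:~R - c * t)| <= 1 -> near_site j x.
Proof.
move=> tT x1; rewrite /near_site.
have -> : x - eps * j%:~R = (x - eps * (j%:~R - c * t)) - c * (t * eps) by ring.
apply: le_trans (ler_normB _ _) _; rewrite addrC lerD// normrM gtr0_norm// ler_pM2l//.
by rewrite normrM (gtr0_norm eps_gt0) -ler_pdivlMr.
Qed.

Lemma near_site_plus j t x : `|t| <= T0 / eps ->
  `|x - eps * (j%:~R + c * t)| <= 1 -> near_site j x.
Proof.
move=> tT x1; apply: (@near_site_minus j (- t)); rewrite ?normrN//.
by rewrite mulrN opprK.
Qed.

Lemma near_site_center j t : `|t| <= T0 / eps -> near_site j (eps * (j%:~R - c * t)).
Proof. by move=> tT; apply: near_site_minus tT _; rewrite subrr normr0. Qed.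

Lemma waves_le F G j t s : `|t| <= T0 / eps ->
  (forall x, near_site j x -> `|F x| <= s) -> (forall x, near_site j x -> `|G x| <= s) ->
  `|waves F G j t| <= 2 * s.
Proof.
move=> tT Fs Gs; apply: le_trans (ler_normD _ _) _.
have -> : 2 * s = s + s by ring.
apply: lerD; [apply/Fs/(near_site_minus tT)|apply/Gs/(near_site_plus tT)];
by rewrite subrr normr0.
Qed.

Lemma waves_lipschitz F G (F1 G1 : R -> R) j (h : int) t s : `|h| <= 1 -> `|t| <= T0 / eps ->
  (forall x : R, is_derive x 1 F (F1 x)) -> (forall x : R, is_derive x 1 G (G1 x)) ->
  (forall x, near_site j x -> `|F1 x| <= s) -> (forall x, near_site j x -> `|G1 x| <= s) ->
  `|waves F G (j + h) t - waves F G j t| <= 2 * eps * s.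
Proof.
move=> h1 tT dF dG Fs Gs.
have s0 : 0 <= s.
  exact: le_trans (normr_ge0 _) (Fs _ (near_site_center j tT)).
have heps : `|eps * h%:~R| <= eps.
  by rewrite normrM gtr0_norm// ler_piMr ?(ltW eps_gt0)// -intr_norm -[leRHS]/(1%:~R) ler_int.
have E1 : eps * ((j + h)%:~R - c * t) = eps * (j%:~R - c * t) + eps * h%:~R.
  by rewrite rmorphD /=; ring.
have E2 : eps * ((j + h)%:~R + c * t) = eps * (j%:~R + c * t) + eps * h%:~R.
  by rewrite rmorphD /=; ring.
rewrite /waves E1 E2 opprD addrACA; apply: le_trans (ler_normD _ _) _.
have -> : 2 * eps * s = s * eps + s * eps by ring.
apply: lerD; apply: le_trans (ler_wpM2l s0 heps).
- apply: lipschitz_ball dF _ heps => x xe.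
  by apply: Fs; apply: near_site_minus tT (le_trans xe eps_le1).
- apply: lipschitz_ball dG _ heps => x xe.
  by apply: Gs; apply: near_site_plus tT (le_trans xe eps_le1).
Qed.

Lemma waves_taylor F G (F1 G1 F2 G2 : R -> R) j (h : int) t s : `|h| <= 1 -> `|t| <= T0 / eps ->
  (forall x : R, is_derive x 1 F (F1 x)) -> (forall x : R, is_derive x 1 G (G1 x)) ->
  (forall x : R, is_derive x 1 F1 (F2 x)) -> (forall x : R, is_derive x 1 G1 (G2 x)) ->
  (forall x, near_site j x -> `|F2 x| <= s) -> (forall x, near_site j x -> `|G2 x| <= s) ->
  `|waves F G (j + h) t - waves F G j t - eps * h%:~R * waves F1 G1 j t| <=
  2 * eps ^+ 2 * s.
Proof.
move=> h1 tT dF dG dF1 dG1 Fs Gs.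
have s0 : 0 <= s.
  exact: le_trans (normr_ge0 _) (Fs _ (near_site_center j tT)).
have heps : `|eps * h%:~R| <= eps.
  by rewrite normrM gtr0_norm// ler_piMr ?(ltW eps_gt0)// -intr_norm -[leRHS]/(1%:~R) ler_int.
have heps2 : (eps * h%:~R) ^+ 2 <= eps ^+ 2.
  by rewrite -(sqr_normE (_ * _)) lerXn2r ?nnegrE// ltW.
have E1 : eps * ((j + h)%:~R - c * t) = eps * (j%:~R - c * t) + eps * h%:~R.
  by rewrite rmorphD /=; ring.
have E2 : eps * ((j + h)%:~R + c * t) = eps * (j%:~R + c * t) + eps * h%:~R.
  by rewrite rmorphD /=; ring.
rewrite /waves E1 E2.
set x1 := eps * (_ - _); set x2 := eps * (_ + c * t).
have -> : F (x1 + eps * h%:~R) + G (x2 + eps * h%:~R) - (F x1 + G x2) -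
   eps * h%:~R * (F1 x1 + G1 x2) =
  (F (x1 + eps * h%:~R) - F x1 - eps * h%:~R * F1 x1) +
  (G (x2 + eps * h%:~R) - G x2 - eps * h%:~R * G1 x2) by ring.
apply: le_trans (ler_normD _ _) _.
have -> : 2 * eps ^+ 2 * s = s * eps ^+ 2 + s * eps ^+ 2 by ring.
apply: lerD; apply: le_trans (ler_wpM2l s0 heps2).
- apply: taylor_ball dF dF1 _ heps => x xe.
  by apply: Fs; apply: near_site_minus tT (le_trans xe eps_le1).
- apply: taylor_ball dG dG1 _ heps => x xe.
  by apply: Gs; apply: near_site_plus tT (le_trans xe eps_le1).
Qed.

(** The envelope bounds only derivatives of the profiles, so the waves are compared with their own
    initial values instead of being bounded directly. *)
Lemma waves_drift F G (F1 G1 : R -> R) j t s : 0 <= T0 -> `|t| <= T0 / eps ->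
  (forall x : R, is_derive x 1 F (F1 x)) -> (forall x : R, is_derive x 1 G (G1 x)) ->
  (forall x, near_site j x -> `|F1 x| <= s) -> (forall x, near_site j x -> `|G1 x| <= s) ->
  `|waves F G j t - waves F G j 0| <= 2 * (c * T0) * s.
Proof.
move=> T00 tT dF dG Fs Gs.
have cT0 : 0 <= c * T0 by rewrite mulr_ge0// ltW.
have s0 : 0 <= s.
  exact: le_trans (normr_ge0 _) (Fs _ (near_site_center j tT)).
have ect : `|eps * c * t| <= c * T0.
  rewrite -mulrA mulrCA normrM gtr0_norm// ler_pM2l// normrM (gtr0_norm eps_gt0).
  by rewrite mulrC -ler_pdivlMr.
have near0 x : `|x - eps * j%:~R| <= c * T0 -> near_site j x.
  by move=> h; apply: le_trans h _; rewrite lerDl.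
rewrite /waves mulr0 subr0 addr0.
have -> : eps * (j%:~R - c * t) = eps * j%:~R + - (eps * c * t) by ring.
have -> : eps * (j%:~R + c * t) = eps * j%:~R + eps * c * t by ring.
rewrite opprD addrACA; apply: le_trans (ler_normD _ _) _.
have -> : 2 * (c * T0) * s = s * (c * T0) + s * (c * T0) by ring.
apply: lerD; apply: le_trans (ler_wpM2l s0 ect).
- rewrite -(normrN (eps * c * t)); apply: lipschitz_ball dF _ _; last by rewrite normrN; exact: ect.
  by move=> x /near0 /Fs.
- by apply: lipschitz_ball dG _ ect => x /near0 /Gs.
Qed.

End waves.

Lemma young_ineq {R : realFieldType} (l x y : R) : 0 < l ->
  `|2 * (x * y)| <= l * x ^+ 2 + l^-1 * y ^+ 2.
Proof.
move=> l0.
have ll : l * l^-1 = 1 by rewrite divff ?gt_eqF.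
have li : 0 < l^-1 by rewrite invr_gt0.
have h1 : 0 <= l^-1 * (l * x + y) ^+ 2 by rewrite mulr_ge0 ?sqr_ge0// ltW.
have h2 : 0 <= l^-1 * (l * x - y) ^+ 2 by rewrite mulr_ge0 ?sqr_ge0// ltW.
have e1 : l^-1 * (l * x + y) ^+ 2 = (l * l^-1) * l * x ^+ 2 + 2 * (l * l^-1) * (x * y) + l^-1 * y ^+ 2 by ring.
have e2 : l^-1 * (l * x - y) ^+ 2 = (l * l^-1) * l * x ^+ 2 - 2 * (l * l^-1) * (x * y) + l^-1 * y ^+ 2 by ring.
rewrite e1 ll mul1r mulr1 in h1; rewrite e2 ll mul1r mulr1 in h2.
by rewrite ler_norml; apply/andP; split; lra.
Qed.

Section constants.
Context {R : realType}.
Variables (T0 c zi klo K am bm : R).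

(** The first two summands bound the initial energy, which is that of the correctors; the third
    bounds the accumulated work of the residuals; [expR 1] is Gronwall's factor up to the final
    time. *)
Definition energy_const : R := expR 1 *
  (K * (klo^-1 * (2 * c * zi)) ^+ 2 + bm * (2 * c) ^+ 2 + T0 ^+ 2 *
   (K * (3 * ((2 * zi) ^+ 2 + (2 * c) ^+ 2 + (2 * klo^-1 * c ^+ 2 * zi) ^+ 2)) +
    am^-1 * (3 * (2 ^+ 2 + (2 * c * zi) ^+ 2 + (2 * bm * c ^+ 2) ^+ 2)))).

(** The factors 2 come from [(x + y) ^+ 2 <= 2 * x ^+ 2 + 2 * y ^+ 2], with [x] the distance to the
    corrected wave and [y] the corrector. *)
Definition error_const_r : R :=
  2 * klo^-1 * energy_const + 2 * (klo^-1 * (2 * c * zi)) ^+ 2.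

Definition error_const_p : R := 2 * am^-1 * energy_const + 2 * (2 * c) ^+ 2.

End constants.

(** * Error estimate for one realization of the coefficients *)

Section pathwise.
Context {R : realType}.
Implicit Types (j : int) (t : R).
Variables (eps T0 c zi kt mb klo K am bm : R).
Hypothesis eps_gt0 : 0 < eps.
Hypothesis eps_le1 : eps <= 1.
Hypothesis T0_gt0 : 0 < T0.
Hypothesis c_gt0 : 0 < c.
Hypothesis zi_gt0 : 0 < zi.
Hypothesis c_kt : c * kt^-1 = zi.
Hypothesis c_mb : c * zi * mb = 1.
Variables (m k : int -> R).
Hypothesis klo_gt0 : 0 < klo.
Hypothesis k_ge : forall j, klo <= k j.
Hypothesis k_le : forall j, k j <= K.
Hypothesis am_gt0 : 0 < am.
Hypothesis m_ge : forall j, am <= m j.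
Hypothesis m_le : forall j, m j <= bm.
Variables (A A1 A2 B B1 B2 : R -> R) (s : int -> R).
Hypothesis dA : forall x : R, is_derive x 1 A (A1 x).
Hypothesis dA1 : forall x : R, is_derive x 1 A1 (A2 x).
Hypothesis dB : forall x : R, is_derive x 1 B (B1 x).
Hypothesis dB1 : forall x : R, is_derive x 1 B1 (B2 x).
Hypothesis A1s : forall j x, near_site eps c T0 j x -> `|A1 x| <= s j.
Hypothesis A2s : forall j x, near_site eps c T0 j x -> `|A2 x| <= s j.
Hypothesis B1s : forall j x, near_site eps c T0 j x -> `|B1 x| <= s j.
Hypothesis B2s : forall j x, near_site eps c T0 j x -> `|B2 x| <= s j.
Variables (chi psi : int -> R).
Hypothesis chiS : forall j, chi (j + 1) = chi j + ((k j)^-1 - kt^-1).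
Hypothesis psiS : forall j, psi (j + 1) = psi j + (m j - mb).

(** All the random quantities of the estimate are absorbed here; both [j] and [j + 1] occur because
    [rt] and the residual [ff] involve walks at [j + 1], [pt] and [gg] at [j]. *)
Definition walk_weight (j : int) : R := s j ^+ 2 *
  (1 + chi j ^+ 2 + chi (j + 1) ^+ 2 + psi j ^+ 2 + psi (j + 1) ^+ 2).

Variable Q : R.
Hypothesis Q_ge : forall N, wsum N walk_weight <= Q.
Variables (r p : int -> R -> R).

Let W := waves eps c.
Let S0 := W A B.
Let S1 := W A1 B1.
Let S2 := W A2 B2.
Let D0 := W (fun x => - A x) B.
Let D1 := W (fun x => - A1 x) B1.
Let D2 := W (fun x => - A2 x) B2.

Hypothesis rp_sol : lattice_solution m k (fun j => waves eps c A B j 0 / k j)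
  (fun j => zi * waves eps c (fun x => - A x) B j 0) r p.

Let rp_init j : r j 0 = S0 j 0 / k j /\ p j 0 = zi * D0 j 0.
Proof. by have [_ _ /(_ j)] := rp_sol. Qed.

(* The difference of the corrector [eps * c * chi j * D1 j] contains
   [eps * c * ((k j)^-1 - kt^-1) * D1 j], which cancels the leading random part
   of the residual of the waves; similarly for [psi].  The residuals left,
   [ff] and [gg], are of order [eps ^+ 2]. *)
Let rt (j : int) (t : R) := (k j)^-1 * (S0 j t + eps * c * zi * psi (j + 1) * S1 j t).
Let pt (j : int) (t : R) := zi * D0 j t + eps * c * chi j * D1 j t.
Let rho (j : int) (t : R) := r j t - rt j t.
Let pi_ (j : int) (t : R) := p j t - pt j t.

Let ff (j : int) (t : R) := zi * (D0 (j + 1) t - D0 j t - eps * D1 j t)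
  + eps * c * chi (j + 1) * (D1 (j + 1) t - D1 j t)
  - (k j)^-1 * eps ^+ 2 * c ^+ 2 * zi * psi (j + 1) * D2 j t.

Let gg (j : int) (t : R) := (S0 j t - S0 (j - 1) t - eps * S1 j t)
  + eps * c * zi * psi j * (S1 j t - S1 (j - 1) t)
  - m j * eps ^+ 2 * c ^+ 2 * chi j * S2 j t.

Let k_gt0 j : 0 < k j. Proof. exact: lt_le_trans (k_ge j). Qed.
Let m_gt0 j : 0 < m j. Proof. exact: lt_le_trans (m_ge j). Qed.

Let dneg (F F1 : R -> R) : (forall x : R, is_derive x 1 F (F1 x)) ->
  forall x : R, is_derive x 1 (fun y => - F y) (- F1 x).
Proof. by move=> dF x; exact: is_deriveN. Qed.

Let negneg (F G : R -> R) : W (fun x => - - F x) G = W F G.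
Proof. by congr (W _ _); apply/funext => x; rewrite opprK. Qed.

Let dS0 j t : is_derive t 1 (S0 j) (eps * c * D1 j t).
Proof. exact: is_derive_waves. Qed.

Let dS1 j t : is_derive t 1 (S1 j) (eps * c * D2 j t).
Proof. exact: is_derive_waves. Qed.

Let dD0 j t : is_derive t 1 (D0 j) (eps * c * S1 j t).
Proof. by rewrite /S1 -negneg; apply: is_derive_waves => //; exact: dneg. Qed.

Let dD1 j t : is_derive t 1 (D1 j) (eps * c * S2 j t).
Proof. by rewrite /S2 -negneg; apply: is_derive_waves => //; exact: dneg. Qed.

Let drho (j : int) (t : R) : is_derive t 1 (rho j) (dplus (pi_ ^~ t) j + ff j t).
Proof.
have [dr _ _ _] := rp_sol.
have D := is_derive_subf (dr j t) (is_derive_scalef (k j)^-1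
  (is_derive_addf (dS0 j t) (is_derive_scalef (eps * c * zi * psi (j + 1)) (dS1 j t)))).
apply: is_derive_eq D _; rewrite /dplus /ff /pi_ /pt chiS.
(* The increment of [chi] trades the effective coefficient [eps * zi] for [eps * c / k j], which is
   what the time derivative of [S0 j / k j] produces. *)
have E : eps * c * (chi j + ((k j)^-1 - kt^-1)) =
  eps * c * chi j + eps * c * (k j)^-1 - eps * zi by rewrite -c_kt; ring.
rewrite E; ring.
Qed.

Let dpi (j : int) (t : R) : is_derive t 1 (pi_ j)
  ((m j)^-1 * (dminus (fun i => k i * rho i t) j + gg j t)).
Proof.
have [_ dp _ _] := rp_sol.
have D := is_derive_subf (dp j t) (is_derive_addf (is_derive_scalef zi (dD0 j t))
  (is_derive_scalef (eps * c * chi j) (dD1 j t))).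
apply: is_derive_eq D _.
have mE : (m j)^-1 * m j = 1 by rewrite mulVf ?gt_eqF.
have kE i u : k i * rho i u = k i * r i u - (S0 i u + eps * c * zi * psi (i + 1) * S1 i u).
  by rewrite /rho /rt mulrBr mulVKf// gt_eqF.
rewrite /dminus !kE subrK psiS.
have E : eps * c * zi * (psi j + (m j - mb)) * S1 j t =
  eps * c * zi * psi j * S1 j t + eps * c * zi * m j * S1 j t - eps * S1 j t.
  transitivity (eps * c * zi * psi j * S1 j t + eps * c * zi * m j * S1 j t - eps * (c * zi * mb) * S1 j t).
    by ring.
  by rewrite c_mb mulr1.
rewrite E /gg.
set x := zi * (eps * c * S1 j t) + eps * c * chi j * (eps * c * S2 j t).
have -> : x = (m j)^-1 * m j * x by rewrite mE mul1r.
rewrite /x; ring.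
Qed.

Let s_ge0 j : 0 <= s j.
Proof.
have t0 : `|0 : R| <= T0 / eps by rewrite normr0 divr_ge0 ?ltW.
exact: le_trans (normr_ge0 _) (A1s (near_site_center eps_gt0 c_gt0 j t0)).
Qed.

Let negs (F : R -> R) j : (forall x, near_site eps c T0 j x -> `|F x| <= s j) ->
  forall x, near_site eps c T0 j x -> `|- F x| <= s j.
Proof. by move=> Fs x /Fs; rewrite normrN. Qed.

Let Cf : R := 3 * ((2 * zi) ^+ 2 + (2 * c) ^+ 2 + (2 * klo^-1 * c ^+ 2 * zi) ^+ 2).
Let Cg : R := 3 * (2 ^+ 2 + (2 * c * zi) ^+ 2 + (2 * bm * c ^+ 2) ^+ 2).

Let s2w j (v u : R) : v ^+ 2 + u ^+ 2 <= chi j ^+ 2 + chi (j + 1) ^+ 2 + psi j ^+ 2 + psi (j + 1) ^+ 2 ->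
  (eps ^+ 2 * s j) ^+ 2 * (1 + u ^+ 2 + v ^+ 2) <= eps ^+ 4 * walk_weight j.
Proof.
move=> uv; rewrite exprMn -exprM -mulrA ler_wpM2l ?exprn_ge0 ?(ltW eps_gt0)//.
by rewrite /walk_weight ler_wpM2l ?sqr_ge0//; lra.
Qed.

Let kinv_le j : (k j)^-1 <= klo^-1.
Proof. by rewrite lef_pV2 ?posrE. Qed.

(** Each piece is of order [eps ^+ 2] by a different mechanism: a Taylor remainder, a difference of
    [D1] carrying a second factor [eps], and the time derivative of a corrector. *)
Let ff_le j t : `|t| <= T0 / eps -> ff j t ^+ 2 <= Cf * (eps ^+ 4 * walk_weight j).
Proof.
move=> tT.
have h0 : 0 <= eps ^+ 2 * s j by rewrite mulr_ge0 ?sqr_ge0.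
apply: (@le_trans _ _ (Cf * ((eps ^+ 2 * s j) ^+ 2 * (1 + psi (j + 1) ^+ 2 + chi (j + 1) ^+ 2)))); last first.
  apply: ler_wpM2l; first by rewrite mulr_ge0// !addr_ge0 ?sqr_ge0.
  by apply: s2w; have := sqr_ge0 (chi j); have := sqr_ge0 (psi j); lra.
rewrite /ff; apply: sqr_add3_le => //.
- rewrite normrM gtr0_norm// -mulrA mulrCA ler_pM2l//.
  have := waves_taylor eps_gt0 eps_le1 c_gt0 (h := 1) _ tT (dneg dA) dB (dneg dA1) dB1 (negs (A2s (j := j))) (B2s (j := j)).
  rewrite mulr1z mulr1; have -> : 2 * (eps ^+ 2 * s j) = 2 * eps ^+ 2 * s j by ring.
  by apply; rewrite normr1.
- have -> : 2 * c * (eps ^+ 2 * s j) * `|chi (j + 1)| = (eps * c * `|chi (j + 1)|) * (2 * eps * s j) by ring.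
  rewrite normrM ler_pM//.
    by rewrite !normrM (gtr0_norm eps_gt0) (gtr0_norm c_gt0).
  by apply: (waves_lipschitz eps_gt0 eps_le1 c_gt0 _ tT (dneg dA1) dB1 (negs (A2s (j := j))) (B2s (j := j))); rewrite normr1.
- rewrite normrN.
  have -> : (k j)^-1 * eps ^+ 2 * c ^+ 2 * zi * psi (j + 1) * D2 j t =
    (k j)^-1 * (eps ^+ 2 * c ^+ 2 * zi) * (psi (j + 1) * D2 j t) by ring.
  have -> : 2 * klo^-1 * c ^+ 2 * zi * (eps ^+ 2 * s j) * `|psi (j + 1)| =
    klo^-1 * (eps ^+ 2 * c ^+ 2 * zi) * (`|psi (j + 1)| * (2 * s j)) by ring.
  have e0 : 0 < eps ^+ 2 * c ^+ 2 * zi by rewrite !mulr_gt0// exprn_gt0.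
  rewrite normrM ler_pM//.
    rewrite normrM (gtr0_norm e0) ler_pM2r// ger0_norm// invr_ge0 ltW//.
  rewrite normrM ler_wpM2l//.
  by apply: (waves_le eps_gt0 c_gt0 tT (negs (A2s (j := j))) (B2s (j := j))).
Qed.

Let gg_le j t : `|t| <= T0 / eps -> gg j t ^+ 2 <= Cg * (eps ^+ 4 * walk_weight j).
Proof.
move=> tT.
have h0 : 0 <= eps ^+ 2 * s j by rewrite mulr_ge0 ?sqr_ge0.
apply: (@le_trans _ _ (Cg * ((eps ^+ 2 * s j) ^+ 2 * (1 + chi j ^+ 2 + psi j ^+ 2)))); last first.
  apply: ler_wpM2l; first by rewrite mulr_ge0// !addr_ge0 ?sqr_ge0.
  by apply: s2w; have := sqr_ge0 (chi (j + 1)); have := sqr_ge0 (psi (j + 1)); lra.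
rewrite /gg; apply: sqr_add3_le => //.
- have := waves_taylor eps_gt0 eps_le1 c_gt0 (h := -1) _ tT dA dB dA1 dB1 (A2s (j := j)) (B2s (j := j)).
  rewrite mulrN1z mulrN1 mulNr opprK -(normrN (S0 j t - _ - _)) => H.
  have -> : 2 * (eps ^+ 2 * s j) = 2 * eps ^+ 2 * s j by ring.
  have -> : - (S0 j t - S0 (j - 1) t - eps * S1 j t) =
    S0 (j - 1) t - S0 j t + eps * S1 j t by ring.
  by apply: H; rewrite normrN1.
- have -> : 2 * c * zi * (eps ^+ 2 * s j) * `|psi j| = (eps * c * zi * `|psi j|) * (2 * eps * s j) by ring.
  rewrite normrM ler_pM//.
    by rewrite !normrM (gtr0_norm eps_gt0) (gtr0_norm c_gt0) (gtr0_norm zi_gt0).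
  rewrite distrC.
  by apply: (waves_lipschitz eps_gt0 eps_le1 c_gt0 _ tT dA1 dB1 (A2s (j := j)) (B2s (j := j))); rewrite normrN1.
- rewrite normrN.
  have -> : m j * eps ^+ 2 * c ^+ 2 * chi j * S2 j t =
    m j * (eps ^+ 2 * c ^+ 2) * (chi j * S2 j t) by ring.
  have -> : 2 * bm * c ^+ 2 * (eps ^+ 2 * s j) * `|chi j| =
    bm * (eps ^+ 2 * c ^+ 2) * (`|chi j| * (2 * s j)) by ring.
  have e0 : 0 < eps ^+ 2 * c ^+ 2 by rewrite !mulr_gt0// exprn_gt0.
  rewrite normrM ler_pM//.
    by rewrite normrM (gtr0_norm e0) ler_pM2r// ger0_norm// ltW.
  rewrite normrM ler_wpM2l//.
  by apply: (waves_le eps_gt0 c_gt0 tT (A2s (j := j)) (B2s (j := j))).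
Qed.

Let tau := T0 / eps.
Let I : set R := [set t | - tau <= t <= tau].
(* Gronwall's rate: [expR (lam * t)] stays bounded up to time [T0 / eps]. *)
Let lam := eps / T0.
Let q j := lam^-1 * (K * Cf + am^-1 * Cg) * eps ^+ 4 * walk_weight j.

Let tau_gt0 : 0 < tau. Proof. exact: divr_gt0. Qed.
Let lam_gt0 : 0 < lam. Proof. exact: divr_gt0. Qed.

Let It t : I t -> `|t| <= tau. Proof. by rewrite /I /= ler_norml. Qed.

Let walk_weight_ge0 j : 0 <= walk_weight j.
Proof. by rewrite mulr_ge0 ?sqr_ge0// !addr_ge0 ?sqr_ge0. Qed.

Let K_ge0 : 0 <= K. Proof. exact: le_trans (ltW (k_gt0 0)) (k_le 0). Qed.
Let bm_ge0 : 0 <= bm. Proof. exact: le_trans (ltW (m_gt0 0)) (m_le 0). Qed.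

Let Cf_ge0 : 0 <= Cf.
Proof. by rewrite mulr_ge0// !addr_ge0 ?sqr_ge0. Qed.
Let Cg_ge0 : 0 <= Cg.
Proof. by rewrite mulr_ge0// !addr_ge0 ?sqr_ge0. Qed.

Let Q_ge0 : 0 <= Q.
Proof. by have := Q_ge 0; rewrite wsum0. Qed.

Let Cw : R := K * Cf + am^-1 * Cg.
Let Cw_ge0 : 0 <= Cw.
Proof. by rewrite addr_ge0// mulr_ge0// invr_ge0 ltW. Qed.

(** Young's inequality is applied with weight [lam] in the first product and [lam * m j] in the
    second, so that the quadratic terms form exactly [lam] times the energy; the squared residuals
    carry [lam^-1]. *)
Let work_le j t : I t ->
  `|2 * (k j * rho j t * ff j t + pi_ j t * gg j t)| <=
  lam * energy m k rho pi_ j t + q j.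
Proof.
move=> /It tI; have F := ff_le j tI; have G := gg_le j tI.
have e4 : 0 <= eps ^+ 4 * walk_weight j by rewrite mulr_ge0// exprn_ge0// ltW.
have li : 0 < lam^-1 by rewrite invr_gt0.
have h1 : `|2 * (rho j t * ff j t)| * k j <= lam * (k j * rho j t ^+ 2) +
    lam^-1 * (K * Cf * (eps ^+ 4 * walk_weight j)).
  apply: le_trans (ler_wpM2r (ltW (k_gt0 j)) (young_ineq _ _ lam_gt0)) _.
  have -> : (lam * rho j t ^+ 2 + lam^-1 * ff j t ^+ 2) * k j =
    lam * (k j * rho j t ^+ 2) + lam^-1 * (k j * ff j t ^+ 2) by ring.
  rewrite lerD2l ler_pM2l// -[leRHS]mulrA.
  by apply: ler_pM => //; rewrite ?sqr_ge0 ?(ltW (k_gt0 j)).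
have h2 : `|2 * (pi_ j t * gg j t)| <= lam * (m j * pi_ j t ^+ 2) +
    lam^-1 * (am^-1 * Cg * (eps ^+ 4 * walk_weight j)).
  have lm : 0 < lam * m j by rewrite mulr_gt0.
  apply: le_trans (young_ineq _ _ lm) _.
  have -> : lam * m j * pi_ j t ^+ 2 + (lam * m j)^-1 * gg j t ^+ 2 =
    lam * (m j * pi_ j t ^+ 2) + lam^-1 * ((m j)^-1 * gg j t ^+ 2) by rewrite invfM; ring.
  rewrite lerD2l ler_pM2l// -[leRHS]mulrA.
  by apply: ler_pM => //; rewrite ?sqr_ge0 ?invr_ge0 ?(ltW (m_gt0 j))// lef_pV2 ?posrE.
rewrite mulrDr; apply: le_trans (ler_normD _ _) _.
have -> : 2 * (k j * rho j t * ff j t) = 2 * (rho j t * ff j t) * k j by ring.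
rewrite normrM (gtr0_norm (k_gt0 j)).
apply: le_trans (lerD h1 h2) _; rewrite /energy /q; lra.
Qed.

Let rp_energy_finite t : exists M, forall N, wsum N (energy m k r p ^~ t) <= M.
Proof.
have [_ _ _ /(_ t)[/ell2_wsum[M1 H1] /ell2_wsum[M2 H2]]] := rp_sol.
exists (K * M1 + bm * M2) => N.
apply: (@le_trans _ _ (wsum N (fun j => K * r j t ^+ 2 + bm * p j t ^+ 2))).
  by apply: ler_wsum => j; rewrite lerD// ler_wpM2r ?sqr_ge0.
by rewrite wsumD !wsumZ lerD// ler_wpM2l.
Qed.

(** Conservation supplies the bound uniform in time that the forced energy estimate presupposes. *)
Let rp_bounded : ell2_bounded setT (fun t j => r j t) /\ ell2_bounded setT (fun t j => p j t).
Proof.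
have [dr dp _ _] := rp_sol.
have [M HM] := rp_energy_finite 0.
have H t := energy_conserved klo_gt0 k_ge k_le am_gt0 m_ge dr dp rp_energy_finite t HM.
split; [exists (klo^-1 * M)|exists (am^-1 * M)] => t N _; rewrite ler_pdivlMl// -wsumZ;
  apply: le_trans (H t N); apply: ler_wsum => j;
  by have [] := energy_lower klo_gt0 k_ge am_gt0 m_ge r p j t.
Qed.

Let s_bounded (J : set R) : ell2_bounded J (fun _ j => s j).
Proof.
exists Q => t N _; apply: le_trans (Q_ge N); apply: ler_wsum => j.
by rewrite /walk_weight ler_peMr ?sqr_ge0// -!addrA lerDl !addr_ge0 ?sqr_ge0.
Qed.

Let chis_bounded (J : set R) : ell2_bounded J (fun _ j => chi j * s j).
Proof.
exists Q => t N _; apply: le_trans (Q_ge N); apply: ler_wsum => j.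
rewrite /walk_weight exprMn mulrC ler_wpM2l ?sqr_ge0//.
by have := sqr_ge0 (chi (j + 1)); have := sqr_ge0 (psi j); have := sqr_ge0 (psi (j + 1)); lra.
Qed.

Let psis_bounded (J : set R) : ell2_bounded J (fun _ j => psi (j + 1) * s j).
Proof.
exists Q => t N _; apply: le_trans (Q_ge N); apply: ler_wsum => j.
rewrite /walk_weight exprMn mulrC ler_wpM2l ?sqr_ge0//.
by have := sqr_ge0 (chi (j + 1)); have := sqr_ge0 (psi j); have := sqr_ge0 (chi j); lra.
Qed.

Let S1_le j t : `|t| <= tau -> `|S1 j t| <= 2 * s j.
Proof. by move=> tT; exact: (waves_le eps_gt0 c_gt0 tT (A1s (j := j)) (B1s (j := j))). Qed.

Let D1_le j t : `|t| <= tau -> `|D1 j t| <= 2 * s j.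
Proof. by move=> tT; exact: (waves_le eps_gt0 c_gt0 tT (negs (A1s (j := j))) (B1s (j := j))). Qed.

Let rho_corr j t : `|t| <= tau ->
  `|(k j)^-1 * (eps * c * zi * psi (j + 1) * S1 j t)| <=
  klo^-1 * (2 * c * zi) * eps * `|psi (j + 1) * s j|.
Proof.
move=> tT; rewrite !normrM (gtr0_norm eps_gt0) (gtr0_norm c_gt0) (gtr0_norm zi_gt0).
rewrite (ger0_norm (s_ge0 j)) gtr0_norm ?invr_gt0//.
have -> : klo^-1 * (2 * c * zi) * eps * (`|psi (j + 1)| * s j) =
  klo^-1 * (eps * c * zi * `|psi (j + 1)| * (2 * s j)) by ring.
have e0 : 0 <= eps * c * zi * `|psi (j + 1)| by rewrite !mulr_ge0// ltW.
by apply: ler_pM => //; [rewrite invr_ge0 ltW|rewrite mulr_ge0|rewrite ler_wpM2l ?S1_le].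
Qed.

Let pi_corr j t : `|t| <= tau -> `|eps * c * chi j * D1 j t| <= 2 * c * eps * `|chi j * s j|.
Proof.
move=> tT; rewrite !normrM (gtr0_norm eps_gt0) (gtr0_norm c_gt0).
rewrite (ger0_norm (s_ge0 j)).
have -> : 2 * c * eps * (`|chi j| * s j) = eps * c * `|chi j| * (2 * s j) by ring.
by rewrite ler_wpM2l ?D1_le// !mulr_ge0// ltW.
Qed.

Let at_time (u : R -> R) (F : int -> R -> R) : ell2_bounded setT (fun t j => F j t) ->
  ell2_bounded I (fun t j => F j (u t)).
Proof. by move=> [M HM]; exists M => t N _; exact: HM. Qed.

(** Since [r j 0] is the initial wave, [rho] splits into [r j t], [- r j 0], the drift of the wave
    and the corrector, each bounded uniformly in time. *)
Let rho_bounded : ell2_bounded I (fun t j => rho j t).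
Proof.
have H1 := at_time id rp_bounded.1.
have H2 := at_time (fun=> 0) rp_bounded.1.
have H3 : ell2_bounded I (fun t j => - r j 0).
  by apply: (ell2_bounded_le (a := 1) H2) => t j _; rewrite normrN mul1r.
have H4 : ell2_bounded I (fun t j => - ((k j)^-1 * (S0 j t - S0 j 0))).
  apply: (ell2_bounded_le (a := klo^-1 * (2 * (c * T0))) (s_bounded I)) => t j /It tT.
  rewrite normrN normrM gtr0_norm ?invr_gt0// (ger0_norm (s_ge0 j)) -mulrA.
  apply: ler_pM => //; first by rewrite invr_ge0 ltW.
  by apply: (waves_drift eps_gt0 c_gt0 (ltW T0_gt0) tT dA dB (A1s (j := j)) (B1s (j := j))).
have H5 : ell2_bounded I (fun t j => - ((k j)^-1 * (eps * c * zi * psi (j + 1) * S1 j t))).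
  apply: (ell2_bounded_le (psis_bounded I)) => t j /It tT.
  by rewrite normrN; exact: rho_corr.
have H := ell2_boundedD (ell2_boundedD H1 H3) (ell2_boundedD H4 H5).
apply: (ell2_bounded_le (a := 1) H) => t j _; rewrite mul1r.
have [r0 _] := rp_init j.
have -> : r j t + - r j 0 + (- ((k j)^-1 * (S0 j t - S0 j 0)) +
   - ((k j)^-1 * (eps * c * zi * psi (j + 1) * S1 j t))) = rho j t => //.
by rewrite r0 /rho /rt; ring.
Qed.

Let pi_bounded : ell2_bounded I (fun t j => pi_ j t).
Proof.
have H1 := at_time id rp_bounded.2.
have H2 := at_time (fun=> 0) rp_bounded.2.
have H3 : ell2_bounded I (fun t j => - p j 0).
  by apply: (ell2_bounded_le (a := 1) H2) => t j _; rewrite normrN mul1r.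
have H4 : ell2_bounded I (fun t j => - (zi * (D0 j t - D0 j 0))).
  apply: (ell2_bounded_le (a := zi * (2 * (c * T0))) (s_bounded I)) => t j /It tT.
  rewrite normrN normrM gtr0_norm// (ger0_norm (s_ge0 j)) -mulrA ler_pM2l//.
  by apply: (waves_drift eps_gt0 c_gt0 (ltW T0_gt0) tT (dneg dA) dB (negs (A1s (j := j))) (B1s (j := j))).
have H5 : ell2_bounded I (fun t j => - (eps * c * chi j * D1 j t)).
  apply: (ell2_bounded_le (chis_bounded I)) => t j /It tT.
  by rewrite normrN; exact: pi_corr.
have H := ell2_boundedD (ell2_boundedD H1 H3) (ell2_boundedD H4 H5).
apply: (ell2_bounded_le (a := 1) H) => t j _; rewrite mul1r.
have [_ p0] := rp_init j.
have -> : p j t + - p j 0 + (- (zi * (D0 j t - D0 j 0)) +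
   - (eps * c * chi j * D1 j t)) = pi_ j t => //.
by rewrite p0 /pi_ /pt; ring.
Qed.

Let psis_le j : (psi (j + 1) * s j) ^+ 2 <= walk_weight j.
Proof.
rewrite /walk_weight exprMn mulrC ler_wpM2l ?sqr_ge0//.
by have := sqr_ge0 (chi (j + 1)); have := sqr_ge0 (psi j); have := sqr_ge0 (chi j); lra.
Qed.

Let chis_le j : (chi j * s j) ^+ 2 <= walk_weight j.
Proof.
rewrite /walk_weight exprMn mulrC ler_wpM2l ?sqr_ge0//.
by have := sqr_ge0 (chi (j + 1)); have := sqr_ge0 (psi j); have := sqr_ge0 (psi (j + 1)); lra.
Qed.

Let sqr_le (x y : R) : `|x| <= y -> x ^+ 2 <= y ^+ 2.
Proof. by move=> xy; rewrite -(sqr_normE x) lerXn2r ?nnegrE// (le_trans _ xy). Qed.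

Let rho_corr2 j t : `|t| <= tau ->
  ((k j)^-1 * (eps * c * zi * psi (j + 1) * S1 j t)) ^+ 2 <=
  (klo^-1 * (2 * c * zi)) ^+ 2 * eps ^+ 2 * walk_weight j.
Proof.
move=> tT; apply: le_trans (sqr_le (rho_corr j tT)) _.
rewrite 2!exprMn sqr_normE ler_wpM2l// mulr_ge0 ?sqr_ge0//.
Qed.

Let pi_corr2 j t : `|t| <= tau ->
  (eps * c * chi j * D1 j t) ^+ 2 <= (2 * c) ^+ 2 * eps ^+ 2 * walk_weight j.
Proof.
move=> tT; apply: le_trans (sqr_le (pi_corr j tT)) _.
rewrite 2!exprMn sqr_normE ler_wpM2l// mulr_ge0 ?sqr_ge0//.
Qed.

Let C1 : R := K * (klo^-1 * (2 * c * zi)) ^+ 2 + bm * (2 * c) ^+ 2.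

Let C1_ge0 : 0 <= C1.
Proof. by rewrite /C1 addr_ge0// mulr_ge0 ?sqr_ge0. Qed.

(** The uncorrected waves match the initial data exactly, so only the correctors remain at time
    0. *)
Let energy_init N : wsum N (energy m k rho pi_ ^~ 0) <= C1 * eps ^+ 2 * Q.
Proof.
have t0 : `|0 : R| <= tau by rewrite normr0 ltW.
apply: le_trans (ler_wpM2l (mulr_ge0 C1_ge0 (sqr_ge0 _)) (Q_ge N)); rewrite -wsumZ.
apply: ler_wsum => j; rewrite /energy.
have [r0 p0] := rp_init j.
have -> : rho j 0 = - ((k j)^-1 * (eps * c * zi * psi (j + 1) * S1 j 0)).
  by rewrite /rho /rt r0; ring.
have -> : pi_ j 0 = - (eps * c * chi j * D1 j 0) by rewrite /pi_ /pt p0; ring.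
rewrite !sqrrN.
have -> : C1 * eps ^+ 2 * walk_weight j =
  K * ((klo^-1 * (2 * c * zi)) ^+ 2 * eps ^+ 2 * walk_weight j) +
  bm * ((2 * c) ^+ 2 * eps ^+ 2 * walk_weight j) by rewrite /C1; ring.
apply: lerD; apply: ler_pM; rewrite ?sqr_ge0 ?(ltW (k_gt0 j)) ?(ltW (m_gt0 j))//.
- exact: rho_corr2.
- exact: pi_corr2.
Qed.

Let CE : R := expR 1 * (C1 + T0 ^+ 2 * Cw).

Let energy_final t N : `|t| <= tau -> wsum N (energy m k rho pi_ ^~ t) <= CE * eps ^+ 2 * Q.
Proof.
move=> tT.
have [M1 H1] := rho_bounded; have [M2 H2] := pi_bounded.
have J0 : - tau <= (0 : R) <= tau by rewrite oppr_le0 ltW.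
have Jt : - tau <= t <= tau by rewrite -ler_norml.
have c0 : 0 <= lam^-1 * Cw * eps ^+ 4.
  by rewrite mulr_ge0 ?exprn_ge0 ?(ltW eps_gt0)// mulr_ge0// invr_ge0 ltW.
have qQ n : wsum n q <= lam^-1 * Cw * eps ^+ 4 * Q.
  by apply: le_trans (ler_wpM2l c0 (Q_ge n)); rewrite -wsumZ.
have q0 j : 0 <= q j by rewrite mulr_ge0.
have M1le : M1 <= Num.max M1 M2 by rewrite le_max lexx.
have M2le : M2 <= Num.max M1 M2 by rewrite le_max lexx orbT.
have := energy_bound k_gt0 k_le am_gt0 m_ge drho dpi (ltW lam_gt0) q0 qQ
  (fun t tJ n => le_trans (H1 t n tJ) M1le) (fun t tJ n => le_trans (H2 t n tJ) M2le)
  (fun j t tJ => work_le j tJ) J0 Jt energy_init N.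
rewrite subr0 => /le_trans; apply.
have lt1 : lam * `|t| <= 1.
  rewrite /lam -ler_pdivlMl ?divr_gt0// mulr1 invf_div; exact: tT.
have -> : CE * eps ^+ 2 * Q = expR 1 * ((C1 + T0 ^+ 2 * Cw) * (eps ^+ 2 * Q)).
  by rewrite /CE; ring.
have C1Q_ge0 : 0 <= C1 * eps ^+ 2 * Q by rewrite mulr_ge0// mulr_ge0 ?sqr_ge0.
apply: ler_pM; [exact: expR_ge0| |by rewrite ler_expR|].
  by rewrite addr_ge0// mulr_ge0// mulr_ge0.
(* Both [lam^-1] and [tau] equal [T0 / eps]; together they reduce [eps ^+ 4] to
   [T0 ^+ 2 * eps ^+ 2]. *)
have E : (C1 + T0 ^+ 2 * Cw) * (eps ^+ 2 * Q) =
    C1 * eps ^+ 2 * Q + lam^-1 * Cw * eps ^+ 4 * Q * tau.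
  rewrite /lam /tau invf_div; field; exact: lt0r_neq0.
by rewrite E lerD2l ler_wpM2l// mulr_ge0.
Qed.

Lemma pathwise_r t N : `|t| <= T0 / eps ->
  wsum N (fun j => (r j t - (k j)^-1 * waves eps c A B j t) ^+ 2) <=
  error_const_r T0 c zi klo K am bm * eps ^+ 2 * Q.
Proof.
move=> tT; rewrite /error_const_r /error_const_p -[energy_const _ _ _ _ _ _ _]/CE.
rewrite (mulrDl (2 * _ * _)) (mulrDl (2 * _ * _ * _)).
have ki : 0 <= klo^-1 by rewrite invr_ge0 ltW.
apply: (@le_trans _ _ (wsum N (fun j => 2 * klo^-1 * energy m k rho pi_ j t +
  2 * (klo^-1 * (2 * c * zi)) ^+ 2 * eps ^+ 2 * walk_weight j))).
  apply: ler_wsum => j.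
  have := rho_corr2 j tT.
  have [+ _] := energy_lower klo_gt0 k_ge am_gt0 m_ge rho pi_ j t.
  rewrite -ler_pdivlMl// => h1.
  have -> : r j t - (k j)^-1 * waves eps c A B j t = rho j t + (k j)^-1 * (eps * c * zi * psi (j + 1) * S1 j t).
    by rewrite -[waves _ _ _ _ _ _]/(S0 j t) /rho /rt; ring.
  move: ((k j)^-1 * _) h1 => x h1 h2.
  have := sqr_ge0 (rho j t - x).
  rewrite -!mulrA; rewrite -!mulrA in h2; move: h1 h2; nra.
rewrite wsumD !wsumZ; apply: lerD.
  have -> : 2 * klo^-1 * CE * eps ^+ 2 * Q = 2 * klo^-1 * (CE * eps ^+ 2 * Q) by ring.
  by rewrite ler_wpM2l ?energy_final// mulr_ge0.
rewrite ler_wpM2l//; apply: mulr_ge0; last exact: sqr_ge0.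
by apply: mulr_ge0; last exact: sqr_ge0.
Qed.

Lemma pathwise_p t N : `|t| <= T0 / eps ->
  wsum N (fun j => (p j t - zi * waves eps c (fun x => - A x) B j t) ^+ 2) <=
  error_const_p T0 c zi klo K am bm * eps ^+ 2 * Q.
Proof.
move=> tT; rewrite /error_const_r /error_const_p -[energy_const _ _ _ _ _ _ _]/CE.
rewrite (mulrDl (2 * _ * _)) (mulrDl (2 * _ * _ * _)).
have ki : 0 <= am^-1 by rewrite invr_ge0 ltW.
apply: (@le_trans _ _ (wsum N (fun j => 2 * am^-1 * energy m k rho pi_ j t +
  2 * (2 * c) ^+ 2 * eps ^+ 2 * walk_weight j))).
  apply: ler_wsum => j.
  have := pi_corr2 j tT.
  have [_ +] := energy_lower klo_gt0 k_ge am_gt0 m_ge rho pi_ j t.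
  rewrite -ler_pdivlMl// => h1.
  have -> : p j t - zi * waves eps c (fun x => - A x) B j t = pi_ j t + eps * c * chi j * D1 j t.
    by rewrite -[waves _ _ _ _ _ _]/(D0 j t) /pi_ /pt; ring.
  move: (eps * c * _ * _) h1 => x h1 h2.
  have := sqr_ge0 (pi_ j t - x).
  rewrite -!mulrA; rewrite -!mulrA in h2; move: h1 h2; nra.
rewrite wsumD !wsumZ; apply: lerD.
  have -> : 2 * am^-1 * CE * eps ^+ 2 * Q = 2 * am^-1 * (CE * eps ^+ 2 * Q) by ring.
  by rewrite ler_wpM2l ?energy_final// mulr_ge0.
rewrite ler_wpM2l//; apply: mulr_ge0; last exact: sqr_ge0.
by apply: mulr_ge0; last exact: sqr_ge0.
Qed.

End pathwise.

(** * Regularity of the profiles *)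

Section Ck.
Context {R : realType}.
Implicit Types (f g : R -> R) (n : nat).

(** Everywhere differentiable [n] times; continuity of the last derivative is not part of it, and
    [Ck 0] holds of any function. *)
Fixpoint Ck n f : Prop := if n is n'.+1 then
  exists2 g, (forall x : R, is_derive x 1 f (g x)) & Ck n' g else True.

Lemma Ck_pred n f : Ck n.+1 f -> Ck n f.
Proof.
elim: n f => [//|n IH] f [g dg Cg]; exists g => //; exact: IH.
Qed.

Lemma CkD n f g : Ck n f -> Ck n g -> Ck n (fun x => f x + g x).
Proof.
elim: n f g => [//|n IH] f g [f1 df Cf] [g1 dg Cg].
by exists (fun x => f1 x + g1 x); [move=> x; exact: is_derive_addf|exact: IH].
Qed.

Lemma CkM n f g : Ck n f -> Ck n g -> Ck n (fun x => f x * g x).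
Proof.
elim: n f g => [//|n IH] f g Cf Cg.
case: (Cf) (Cg) => [f1 df Cf1] [g1 dg Cg1].
exists (fun x => f x * g1 x + g x * f1 x); first by move=> x; exact: is_derive_mulf.
by apply: CkD; apply: IH => //; exact: Ck_pred.
Qed.

Lemma Ck_cst n (c : R) : Ck n (fun=> c).
Proof.
elim: n c => [//|n IH] c; exists (fun=> 0) => // x; exact: is_derive_cstf.
Qed.

Lemma Ck_affine n f (a b : R) : Ck n f -> Ck n (fun x => f (a * x + b)).
Proof.
elim: n f => [//|n IH] f [f1 df Cf].
exists (fun x => a * f1 (a * x + b)); first by move=> x; exact: is_derive_comp_affine.
by apply: CkM; [exact: Ck_cst|exact: IH].
Qed.

Lemma is_derive_derive1 f g : (forall x : R, is_derive x 1 f (g x)) -> derive1 f = g.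
Proof. by move=> dfg; apply/funext => x; rewrite derive1E; have [] := dfg x. Qed.

Lemma Ck_derivable n f : (forall n, Ck n f) -> forall x : R, derivable (derive1n n f) x 1.
Proof.
elim: n f => [|n IH] f Cf x.
  by have [g dg _] := Cf 1; have [] := dg x.
rewrite /derive1n iterSr; apply: IH => k.
by have [g dg Cg] := Cf k.+1; rewrite (is_derive_derive1 dg).
Qed.

(** The classical flat function [exp (- 1 / x)], with a polynomial factor in [1 / x] so that the
    family is closed under differentiation. *)
Definition flat (p : {poly R}) (x : R) : R :=
  if 0 < x then p.[x^-1] * expR (- x^-1) else 0.

Lemma poly_le_power (p : {poly R}) : exists C n, 0 <= C /\
  forall y, 1 <= y -> `|p.[y]| <= C * y ^+ n.
Proof.
elim/poly_ind: p => [|p c [C [n [C0 H]]]].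
  by exists 0, 0%N; split => // y _; rewrite horner0 normr0 mul0r.
exists (C + `|c|), n.+1; split; first by rewrite addr_ge0.
move=> y y1; rewrite hornerMXaddC.
have y0 : 0 < y by apply: lt_le_trans y1.
apply: le_trans (ler_normD _ _) _; rewrite mulrDl; apply: lerD.
  by rewrite normrM (gtr0_norm y0) exprSr mulrA ler_wpM2r ?(ltW y0)// H.
by rewrite ler_peMr// exprn_ege1.
Qed.

Lemma expR_ge_power n (y : R) : 0 <= y -> (y / n.+1%:R) ^+ n.+1 <= expR y.
Proof.
move=> y0; have -> : expR y = expR (y / n.+1%:R) ^+ n.+1.
  rewrite -expRM_natl; congr expR; field.
  by rewrite nat1r pnatr_eq0.
rewrite lerXn2r ?nnegrE ?divr_ge0// ?expR_ge0//.
by apply: le_trans (expR_ge1Dx _); rewrite lerDr.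
Qed.

Lemma flat_le (p : {poly R}) : exists2 C, 0 <= C &
  forall x, `|x| <= 1 -> `|flat p x| <= C * x ^+ 2.
Proof.
have [C [n [C0 H]]] := poly_le_power p.
(* Write [x^-1 ^+ n] as [x ^+ 2 * x^-1 ^+ n.+2]; the last power is at most
   [n.+2 ^+ n.+2 * expR x^-1]. *)
exists (C * n.+2%:R ^+ n.+2); first by rewrite mulr_ge0 ?exprn_ge0.
move=> x x1; rewrite /flat; case: ifPn => x0; last first.
  by rewrite normr0 mulr_ge0 ?sqr_ge0// mulr_ge0 ?exprn_ge0.
have y0 : 0 < x^-1 by rewrite invr_gt0.
have y1 : 1 <= x^-1 by rewrite invf_ge1// (le_trans _ x1)// ler_norm.
have := expR_ge_power n.+1 (ltW y0).
have Ey := expR_gt0 x^-1.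
rewrite normrM (gtr0_norm (expR_gt0 _)) expRN => E.
rewrite ler_pdivrMr//; apply: le_trans (H _ y1) _.
apply: (@le_trans _ _ (C * n.+2%:R ^+ n.+2 * x ^+ 2 * (x^-1 / n.+2%:R) ^+ n.+2)); last first.
  by rewrite ler_wpM2l// mulr_ge0 ?sqr_ge0// mulr_ge0 ?exprn_ge0.
rewrite expr_div_n.
have N0 : (n.+2%:R : R) ^+ n.+2 != 0 by rewrite expf_neq0// pnatr_eq0.
have -> : C * n.+2%:R ^+ n.+2 * x ^+ 2 * (x^-1 ^+ n.+2 / n.+2%:R ^+ n.+2) =
  C * (x ^+ 2 * x^-1 ^+ n.+2) by field.
rewrite ler_wpM2l// !exprS !mulrA mulr1 mulfK ?gt_eqF// divff ?gt_eqF// mul1r//.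
Qed.

(** The chain rule brings out [x ^- 2], that is ['X^2], with [p] from the exponential and
    [- deriv p] from the polynomial. At 0 the quadratic bound [flat_le] forces the derivative to
    vanish. *)
Lemma is_derive_flat (p : {poly R}) (x : R) :
  is_derive x 1 (flat p) (flat ('X^2 * (p - deriv p)) x).
Proof.
case: (ltgtP x 0) => [x0|x0|->].
- have -> : flat ('X^2 * (p - deriv p)) x = 0.
    by rewrite /flat ifF//; apply/negbTE; rewrite -leNgt ltW.
  apply: (@near_eq_is_derive _ _ _ (fun=> 0)).
  near=> y; rewrite /flat ifF//; apply/negbTE; rewrite -leNgt ltW//.
  by near: y; exact: lt_nbhsl.
- have -> : flat ('X^2 * (p - deriv p)) x = ('X^2 * (p - deriv p)).[x^-1] * expR (- x^-1).
    by rewrite /flat x0.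
  have dV : is_derive x 1 (fun y : R => y^-1) (- x ^- 2).
    have := @is_deriveV R id x 1 1 (lt0r_neq0 x0) (is_derive_id x 1).
    by rewrite [_ *: _]mulr1.
  have dP := is_derive1_comp (is_derive_poly p x^-1) dV.
  have dN : is_derive x 1 (fun y : R => - y^-1) (- - x ^- 2) by exact: is_deriveN.
  have dE := @is_derive1_comp R expR (fun y => - y^-1) x _ _ (is_derive_expR (- x^-1)) dN.
  have := is_derive_mulf dP dE.
  rewrite !hornerE /=.
  set d := (X in is_derive _ _ _ X -> _); set d' := (X in _ -> is_derive _ _ _ X).
  have -> : d = d' by rewrite /d /d' !exprVn; ring.
  apply: near_eq_is_derive; near=> y; rewrite /flat ifT//.
  by near: y; exact: lt_nbhsr.
- have -> : flat ('X^2 * (p - deriv p)) 0 = 0 by rewrite /flat ltxx.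
  apply/is_derive1_caratheodory.
  have [C C0 HC] := flat_le p.
  have f0 : flat p 0 = 0 by rewrite /flat ltxx.
  exists (fun z => flat p z / z); split; last by rewrite f0 mul0r.
    move=> z; rewrite f0 !subr0; have [->|z0] := eqVneq z 0; first by rewrite f0 mulr0.
    by rewrite divfK.
  rewrite /prop_for /continuous_at f0 mul0r.
  have near0 (d : R) : 0 < d -> \forall z \near (0 : R), `|z| <= d.
    by move=> d0; apply/nbhs_ballP; exists d => // z; rewrite /ball/= sub0r normrN => /ltW.
  apply/cvgrPdist_le => e e0; near=> z; rewrite sub0r normrN.
  have [->|z0] := eqVneq z 0; first by rewrite invr0 mulr0 normr0 ltW.
  have nz : 0 < `|z| by rewrite normr_gt0.
  rewrite normrM normfV ler_pdivrMr//.
  apply: le_trans (HC z _) _; first by near: z; exact: near0.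
  rewrite -(sqr_normE z) expr2 mulrA ler_wpM2r//.
  apply: (@le_trans _ _ ((C + 1) * (e / (C + 1)))); last by rewrite mulrC divfK ?lt0r_neq0 ?ltr_wpDl.
  apply: ler_pM => //; first by rewrite lerDl.
  by near: z; apply: near0; rewrite divr_gt0 ?ltr_wpDl.
Unshelve. all: by end_near. Qed.

Lemma Ck_flat n (p : {poly R}) : Ck n (flat p).
Proof.
elim: n p => [//|n IH] p; exists (flat ('X^2 * (p - deriv p))) => //.
exact: is_derive_flat.
Qed.

Definition bump (x : R) : R := flat 1 x * flat 1 ((-1) * x + 1).

Lemma Ck_bump n : Ck n bump.
Proof. by apply: CkM; [exact: Ck_flat|apply: Ck_affine; exact: Ck_flat]. Qed.

Lemma bump_out x : x <= 0 \/ 1 <= x -> bump x = 0.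
Proof.
rewrite /bump /flat => -[x0|x1].
  by rewrite (ltNge 0 x) x0 mul0r.
by rewrite (ltNge 0 (-1 * x + 1)) mulN1r addrC subr_le0 x1 mulr0.
Qed.

Lemma bump_ge0 x : 0 <= bump x.
Proof.
by rewrite /bump /flat !hornerC !mul1r mulr_ge0//; case: ifP => // _; exact: expR_ge0.
Qed.

Lemma bump_gt0 x : 0 < x < 1 -> 0 < bump x.
Proof.
move=> /andP[x0 x1]; rewrite /bump /flat !hornerC !mul1r x0.
by rewrite mulN1r addrC subr_gt0 x1 mulr_gt0// expR_gt0.
Qed.

Lemma bump_le1 x : bump x <= 1.
Proof.
have flat1 y : 0 <= flat 1 y <= 1.
  rewrite /flat hornerC mul1r; case: ifPn => y0; last by rewrite lexx ler01.
  by rewrite expR_ge0 -expR0 ler_expR oppr_le0 invr_ge0 ltW.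
rewrite /bump; have /andP[a0 a1] := flat1 x; have /andP[b0 b1] := flat1 (-1 * x + 1).
by rewrite -[leRHS]mulr1 ler_pM.
Qed.

End Ck.

(** * Primitives of locally integrable functions *)

Section primitive.
Context {R : realType}.
Notation mu := (@lebesgue_measure R).
Implicit Types (f g H : R -> R).

Lemma locally_integrable_itv H a b : locally_integrable setT H ->
  mu.-integrable `[a, b] (EFin \o H).
Proof.
move=> [mH _ iH]; apply/integrableP; split.
  by apply/measurable_EFinP; exact: measurable_funS mH.
by have := iH [set` `[a, b]] (@subsetT _ _) (@segment_compact _ a b).
Qed.

Lemma continuous_locally_integrable f : continuous f -> locally_integrable setT f.
Proof.
move=> cf; split; [exact: continuous_measurable_fun|exact: openT|].
move=> K _ cK.
have : mu.-integrable K (EFin \o f).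
  by apply: continuous_compact_integrable => //; exact: continuous_subspaceT.
by move=> /integrableP[].
Qed.

Lemma chasles H (a b c : R) : locally_integrable setT H -> a <= b -> b <= c ->
  \int[mu]_(x in `[a, c]) H x = \int[mu]_(x in `[a, b]) H x + \int[mu]_(x in `[b, c]) H x.
Proof.
move=> iH ab bc; apply/eqP; rewrite addrC -subr_eq; apply/eqP.
rewrite Rintegral_itvB ?bnd_simp//; last exact: locally_integrable_itv.
rewrite Rintegral_itv_obnd_cbnd//.
apply: integrableS (locally_integrable_itv b c iH) => //.
exact: subset_itv_oc_cc.
Qed.

(* One of the two integrals is over a set of measure 0. *)
Definition primitive H x : R :=
  \int[mu]_(t in `[0, x]) H t - \int[mu]_(t in `[x, 0]) H t.

Lemma Rintegral_itv_gt H (a b : R) : b <= a -> \int[mu]_(x in `[a, b]) H x = 0.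
Proof.
rewrite le_eqVlt => /predU1P[->|ba]; first by rewrite set_itv1 Rintegral_set1.
by rewrite set_itv_ge ?Rintegral_set0// bnd_simp -ltNge.
Qed.

Lemma primitiveB H (a b : R) : locally_integrable setT H -> a <= b ->
  primitive H b - primitive H a = \int[mu]_(x in `[a, b]) H x.
Proof.
move=> iH ab; rewrite /primitive.
case: (leP 0 a) => a0.
  rewrite (@Rintegral_itv_gt _ a 0)// (@Rintegral_itv_gt _ b 0) ?(le_trans a0)//.
  by rewrite (chasles iH a0 ab); ring.
rewrite (@Rintegral_itv_gt _ 0 a) ?(ltW a0)//.
case: (leP 0 b) => b0.
  by rewrite (@Rintegral_itv_gt _ b 0)// (chasles iH (ltW a0) b0); ring.
by rewrite (@Rintegral_itv_gt _ 0 b) ?(ltW b0)// (chasles iH ab (ltW b0)); ring.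
Qed.

(** Moving the base point to [x - 1] puts [x] strictly inside the interval of integration whatever
    its sign, as the theorems on parameterized integrals require. *)
Lemma primitive_near H (x : R) : locally_integrable setT H ->
  \forall y \near x, primitive H (x - 1) + \int[mu]_(t in `[x - 1, y]) H t = primitive H y.
Proof.
move=> iH; near=> y; rewrite -primitiveB//; first by rewrite addrC subrK.
by apply/ltW; near: y; apply: lt_nbhsr; lra.
Unshelve. all: by end_near. Qed.

Lemma primitive_continuous H : locally_integrable setT H -> continuous (primitive H).
Proof.
move=> iH x.
have xx : x - 1 <= x + 1 by lra.
have xx' : x - 1 < x + 1 by lra.
have := parameterized_integral_continuous xx (locally_integrable_itv (x - 1) (x + 1) iH).
move=> /(continuous_within_itvP _ xx')[ci _ _].
have cx := ci x; have {}cx := cx _.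
have {}cx : {for x, continuous (fun y => \int[mu]_(t in `[x - 1, y]) H t)}.
  by apply: cx; rewrite in_itv /=; lra.
rewrite /continuous_at -(nbhs_singleton (primitive_near x iH)).
apply: cvg_trans (near_eq_cvg (primitive_near x iH)) _.
apply: cvgD; [exact: cvg_cst|exact: cx].
Qed.

Lemma is_derive_primitive f (x : R) : continuous f -> is_derive x 1 (primitive f) (f x).
Proof.
move=> cf; have iH := continuous_locally_integrable cf.
have [||d1 d2] := @continuous_FTC1_closed R f (x - 1) x (x + 1) _ (locally_integrable_itv _ _ iH) _ (cf x); [lra..|].
have D : is_derive x 1 (fun y => \int[mu]_(t in `[x - 1, y]) f t) (f x).
  by apply: DeriveDef; [exact: d1|rewrite -derive1E; exact: d2].
have := is_derive_addf (is_derive_cstf (primitive f (x - 1)) x) D.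
rewrite add0r => {}D; exact: near_eq_is_derive (primitive_near x iH) D.
Qed.

Lemma Rintegral_support f (D : set R) : (forall x, ~ D x -> f x = 0) ->
  \int[mu]_x f x = \int[mu]_(x in D) f x.
Proof.
move=> f0; rewrite [RHS]Rintegral_mkcond; congr (Rintegral _ _ _).
by apply/funext => x; rewrite patchE; case: ifPn => // xD; apply: f0; rewrite -notin_setE.
Qed.

End primitive.

(** * The du Bois-Reymond lemma *)

Section du_bois_reymond.
Context {R : realType}.
Notation mu := (@lebesgue_measure R).
Implicit Types (f g G H F : R -> R).

Lemma antiderivative_unique f g (k : R -> R) (a b : R) :
  (forall x : R, is_derive x 1 f (k x)) -> (forall x : R, is_derive x 1 g (k x)) ->
  f b - f a = g b - g a.
Proof.
move=> df dg; wlog ab : a b / a <= b => [W|].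
  case: (leP a b) => ab; first exact: W.
  by rewrite -opprB (W b a (ltW ab)) opprB.
by apply/le_anti/andP; split; apply: derive_le => // x.
Qed.

Lemma Rintegral_antiderivative F (k : R -> R) (a b : R) : continuous k ->
  (forall x : R, is_derive x 1 F (k x)) -> a <= b ->
  \int[mu]_(x in `[a, b]) k x = F b - F a.
Proof.
move=> ck dF ab; rewrite -primitiveB//; last exact: continuous_locally_integrable.
by apply: (@antiderivative_unique _ _ k) => // x; exact: is_derive_primitive.
Qed.

Lemma Ck_continuous f : Ck 1 f -> continuous f.
Proof. by move=> [g dg _]; exact: is_derive_continuous dg. Qed.

Definition bump_continuous : continuous (@bump R) := Ck_continuous (Ck_bump 1).

(** A smooth transition from 0 to [step 1] over the unit interval. It is left unnormalized; the
    positive factor [step 1] cancels at the end. *)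
Definition step : R -> R := primitive bump.

Lemma is_derive_step (x : R) : is_derive x 1 step (bump x).
Proof. exact: is_derive_primitive bump_continuous. Qed.

Lemma step_homo (x y : R) : x <= y -> step x <= step y.
Proof.
by move=> xy; apply: (derive_ge0_le xy is_derive_step) => z _; exact: bump_ge0.
Qed.

Lemma step0 : step 0 = 0.
Proof. by rewrite /step /primitive subrr. Qed.

Lemma step_le0 (x : R) : x <= 0 -> step x = 0.
Proof.
move=> x0; apply/le_anti/andP; split; first by rewrite -step0; exact: step_homo.
have := derive_le x0 is_derive_step (is_derive_cstf 0).
rewrite step0 subrr sub0r oppr_le0; apply => z /andP[_ z0].
by rewrite bump_out//; left.
Qed.

Lemma step_ge1 (x : R) : 1 <= x -> step x = step 1.
Proof.
move=> x1; apply/le_anti/andP; split; last exact: step_homo.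
have := derive_le x1 is_derive_step (is_derive_cstf 0).
rewrite subrr subr_le0; apply => z /andP[z1 _].
by rewrite bump_out//; right.
Qed.

Lemma step_itv (x : R) : 0 <= step x <= step 1.
Proof.
apply/andP; split.
  by case: (leP x 0) => x0; [rewrite step_le0|rewrite -step0 step_homo// ltW].
by case: (leP x 1) => x1; [exact: step_homo|rewrite step_ge1// ltW].
Qed.

Lemma step1_gt0 : 0 < step 1.
Proof.
have [|c /= c01] := @MVT R step bump 0 1 ltr01 (fun x _ => is_derive_step x).
  exact/continuous_subspaceT/(is_derive_continuous is_derive_step).
rewrite step0 !subr0 mulr1 => ->; apply: bump_gt0.
by rewrite in_itv in c01.
Qed.

Lemma Ck_step n : Ck n step.
Proof. by case: n => [//|n]; exists bump; [exact: is_derive_step|exact: Ck_bump]. Qed.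

(** A one-sided approximate Dirac mass of total mass [step 1], supported in [[a, a + h]]. *)
Definition kernel (h a x : R) : R := h^-1 * bump (h^-1 * x + - (h^-1 * a)).

Lemma kernel_out (h a x : R) : 0 < h -> ~ a <= x <= a + h -> kernel h a x = 0.
Proof.
move=> h0 /negP; rewrite negb_and -!ltNge /kernel -mulrBr => xh.
rewrite bump_out ?mulr0//; move: xh => /orP[xa|xa]; [left|right].
  by rewrite mulr_ge0_le0 ?invr_ge0 ?(ltW h0)// subr_le0 ltW.
by rewrite ler_pdivlMl// mulr1 lerBrDl ltW.
Qed.

Lemma is_derive_step_affine (h a x : R) :
  is_derive x 1 (fun y => step (h^-1 * y + - (h^-1 * a))) (kernel h a x).
Proof. exact/is_derive_comp_affine/is_derive_step. Qed.

Lemma kernel_continuous (h a : R) : continuous (kernel h a).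
Proof.
apply: Ck_continuous; apply: (@CkM _ 1 (fun=> h^-1)); first exact: Ck_cst.
by apply: Ck_affine; exact: Ck_bump.
Qed.

Lemma Rintegral_kernel (h a : R) : 0 < h ->
  \int[mu]_(x in `[a, a + h]) kernel h a x = step 1.
Proof.
move=> h0; have ah : a <= a + h by rewrite lerDl ltW.
rewrite (Rintegral_antiderivative (@kernel_continuous h a) (is_derive_step_affine h a) ah).
by rewrite subrr step0 subr0 mulrDr mulVf ?gt_eqF// addrC addrA addNr add0r.
Qed.

Lemma integrable_mul_continuous G f (a b : R) : locally_integrable setT G ->
  continuous f -> mu.-integrable `[a, b] (EFin \o (fun x => G x * f x)).
Proof.
move=> iG cf; have iGab := locally_integrable_itv a b iG.
have -> : EFin \o (fun x => G x * f x) = ((EFin \o G) \* (EFin \o f))%E by apply/funext.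
apply: integrableMl => //.
  by apply: measurable_funTS; exact: continuous_measurable_fun.
have /compact_bounded[M [_ HM]] : compact (f @` `[a, b]).
  by apply: continuous_compact; [exact: continuous_subspaceT|exact: segment_compact].
exists (`|M| + 1); split; first exact: num_real.
move=> y yM x xab; apply: HM; last by exists x.
by rewrite (le_lt_trans (ler_norm _))// (lt_trans _ yM)// ltrDl.
Qed.

(** The kernel is at most [1 / h], and its support lies in the open ball of radius [2 * h], of
    measure [4 * h]; hence the constant 4. *)
Lemma kernel_average G (a h : R) : locally_integrable setT G -> 0 < h ->
  (`|\int[mu]_(x in `[a, a + h]) (G x * kernel h a x) - step 1 * G a|%:E <=
   4%:E * davg G a (2 * h))%E.
Proof.
move=> iG h0.
have iGc : locally_integrable setT (fun x => G x - G a).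
  apply: (locally_integrableB iG); apply: continuous_locally_integrable.
  exact: cst_continuous.
have ik := integrable_mul_continuous a (a + h) iG (@kernel_continuous h a).
have ikc := integrable_mul_continuous a (a + h) iGc (@kernel_continuous h a).
have i1 := locally_integrable_itv a (a + h) (continuous_locally_integrable (@kernel_continuous h a)).
have i2 : mu.-integrable `[a, a + h] (EFin \o (fun x => G a * kernel h a x)).
  apply: (integrable_mul_continuous a (a + h) _ (@kernel_continuous h a)).
  by apply: continuous_locally_integrable; exact: cst_continuous.
have -> : \int[mu]_(x in `[a, a + h]) (G x * kernel h a x) - step 1 * G a =
   \int[mu]_(x in `[a, a + h]) ((G x - G a) * kernel h a x).
  rewrite mulrC -(Rintegral_kernel a h0) -RintegralZl// -RintegralB//.
  by apply: eq_Rintegral => x _; ring.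
rewrite EFin_normr_Rintegral//.
have hV : 0 < h^-1 by rewrite invr_gt0.
have mGc : measurable_fun setT (fun x => `|(G x - G a)%:E|%E).
  by apply: measurableT_comp => //; apply/measurable_EFinP; case: iGc.
have m1 (D : set R) : measurable_fun D (fun x => (h^-1)%:E * `|(G x - G a)%:E|)%E.
  by apply: measurable_funeM; exact: measurable_funTS.
apply: le_trans (le_abse_integral _ _ _) _ => //; first by case/integrableP: ikc.
apply: (@le_trans _ _ (\int[mu]_(x in `[a, (a + h)%R]) ((h^-1)%:E * `|(G x - G a)%:E|))%E).
  apply: ge0_le_integral => //.
  - by apply: measurableT_comp => //; case/integrableP: ikc.
  - exact: m1.
  - move=> x _; rewrite /= lee_fin normrM mulrC ler_wpM2r//.
    rewrite /kernel normrM gtr0_norm// (ger0_norm (bump_ge0 _)).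
    by rewrite ler_piMr ?(ltW hV)// bump_le1.
apply: (@le_trans _ _ (\int[mu]_(x in ball a (2 * h)%R) ((h^-1)%:E * `|(G x - G a)%:E|))%E).
  apply: ge0_subset_integral => //; [exact: measurable_ball|exact: m1| |].
    by move=> x _; rewrite mule_ge0// lee_fin ltW.
  move=> x /=; rewrite in_itv /= /ball /= => /andP[ax xh].
  by rewrite distrC ger0_norm ?subr_ge0//; lra.
rewrite ge0_integralZl_EFin ?(ltW hV)//; [|exact: measurable_ball|exact: measurable_funTS].
rewrite /davg /iavg.
rewrite lebesgue_measure_ball ?mulr_ge0 ?(ltW h0)//.
have h4 : 2 * h *+ 2 = 4 * h by ring.
rewrite h4 inver mulf_eq0 (gt_eqF h0) orbF pnatr_eq0 /= muleA -EFinM.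
have -> : 4 * (4 * h)^-1 = h^-1 by field; rewrite gt_eqF.
by [].
Qed.

Lemma kernel_cvg G (a : R) : locally_integrable setT G -> lebesgue_pt G a ->
  \int[mu]_(x in `[a, a + n.+1%:R^-1]) (G x * kernel n.+1%:R^-1 a x) @[n --> \oo]
    --> step 1 * G a.
Proof.
move=> iG /cvge_at_rightP/(_ (fun n => 2 * n.+1%:R^-1)) L.
have {L} : davg G a (2 * n.+1%:R^-1) @[n --> \oo] --> 0%E.
  apply: L; split => [n|]; first by rewrite mulr_gt0.
  rewrite -[X in _ --> X](mulr0 2); apply: cvgM; [exact: cvg_cst|exact: cvg_harmonic].
move=> /fine_cvgP[fin /cvgrPdist_lt cv].
apply/cvgrPdist_lt => e e0.
have e4 : 0 < e / 4 by rewrite divr_gt0.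
near=> n.
have := @kernel_average G a n.+1%:R^-1 iG; rewrite invr_gt0 ltr0n => /(_ isT).
have F : davg G a (2 * n.+1%:R^-1) \is a fin_num by near: n; exact: fin.
rewrite -(fineK F) -EFinM lee_fin distrC => /le_lt_trans; apply.
have : `|0 - (fine \o (fun n => davg G a (2 * n.+1%:R^-1))) n| < e / 4 by near: n; exact: cv.
rewrite /= sub0r normrN => /(le_lt_trans (ler_norm _)).
by rewrite ltr_pdivlMr// mulrC.
Unshelve. all: by end_near. Qed.

Lemma Rintegral_dominated (D : set R) (f_ : nat -> R -> R) f g : measurable D ->
  (forall n, measurable_fun D (f_ n)) -> measurable_fun D f ->
  (forall x, D x -> f_ n x @[n --> \oo] --> f x) ->
  mu.-integrable D (EFin \o g) -> (forall n x, D x -> `|f_ n x| <= g x) ->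
  \int[mu]_(x in D) f_ n x @[n --> \oo] --> \int[mu]_(x in D) f x.
Proof.
move=> mD mf_ mf cf ig fg.
have [||||i1 _ c] := @dominated_convergence _ _ _ mu D mD (fun n => EFin \o f_ n) (EFin \o f)
  (EFin \o g) _ _ _ ig _.
- by move=> n; apply/measurable_EFinP; exact: mf_.
- exact/measurable_EFinP.
- by apply: aeW => x Dx; apply: cvg_EFin; [exact: nearW|exact: cf].
- by apply: aeW => x n Dx; rewrite /= lee_fin fg.
by apply: fine_cvg; rewrite fineK//; exact: integrable_fin_num.
Qed.

Definition weak_primitive G H := [/\ locally_integrable setT G,
  locally_integrable setT H & forall phi, test_function phi ->
  \int[mu]_x (G x * derive1 phi x) = - \int[mu]_x (H x * phi x)].

Section difference.
Variables (G H : R -> R) (a b : R).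
Hypothesis GH : weak_primitive G H.
Hypothesis ab : a < b.

Let h (n : nat) : R := n.+1%:R^-1.

(* A smooth approximation of the indicator of [[a, b]] (up to the factor
   [step 1]); its derivative is a difference of approximate Dirac masses at the
   Lebesgue points [a] and [b]. *)
Definition ramp (n : nat) (x : R) : R :=
  step ((h n)^-1 * x + - ((h n)^-1 * a)) - step ((h n)^-1 * x + - ((h n)^-1 * b)).

Let h_gt0 n : 0 < h n. Proof. by rewrite invr_gt0. Qed.
Let h_le1 n : h n <= 1. Proof. by rewrite invf_le1// ler1n. Qed.

Let stepE n c x : step ((h n)^-1 * x + - ((h n)^-1 * c)) = step (n.+1%:R * (x - c)).
Proof. by rewrite /h invrK mulrBr. Qed.

Lemma ramp_out n x : ~ a <= x <= b + 1 -> ramp n x = 0.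
Proof.
move=> /negP; rewrite negb_and -!ltNge /ramp !stepE => /orP[xa|xb].
  by rewrite !step_le0 ?subrr// mulr_ge0_le0// subr_le0 ltW// (lt_trans xa).
have big c : c <= b -> 1 <= n.+1%:R * (x - c).
  move=> cb; have : 1 <= x - c by lra.
  by move=> /le_trans; apply; rewrite ler_peMl ?ler1n//; lra.
by rewrite !step_ge1 ?subrr// big// ltW.
Qed.

Lemma is_derive_ramp n (x : R) : is_derive x 1 (ramp n) (kernel (h n) a x - kernel (h n) b x).
Proof. by apply: is_derive_subf; exact: is_derive_step_affine. Qed.

Lemma test_function_ramp n : test_function (ramp n).
Proof.
split; last first.
  exists (`|a| + `|b| + 1) => x xM; apply: ramp_out => /andP[ax xb].
  move: xM; rewrite ltNge => /negP; apply; rewrite ler_norml.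
  have := ler_norm b; have := ler_normr (- a) a; have := ler_norm (- a).
  rewrite normrN; have := normr_ge0 b; have := normr_ge0 a; lra.
move=> i x; apply: Ck_derivable => k.
have -> : ramp n = fun x => step ((h n)^-1 * x + - ((h n)^-1 * a)) +
    (-1) * step ((h n)^-1 * x + - ((h n)^-1 * b)).
  by apply/funext => y; rewrite mulN1r.
apply: CkD; first by apply: Ck_affine; exact: Ck_step.
apply: (@CkM _ k (fun=> -1)); first exact: Ck_cst.
by apply: Ck_affine; exact: Ck_step.
Qed.

Lemma ramp_derive_integral n : \int[mu]_x (G x * derive1 (ramp n) x) =
  \int[mu]_(x in `[a, a + h n]) (G x * kernel (h n) a x) -
  \int[mu]_(x in `[b, b + h n]) (G x * kernel (h n) b x).
Proof.
have [iG _ _] := GH.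
rewrite (is_derive_derive1 (is_derive_ramp n)).
have out c x : ~ [set` `[c, c + h n]] x -> G x * kernel (h n) c x = 0.
  by rewrite /= in_itv => cx; rewrite kernel_out ?mulr0.
rewrite -(Rintegral_support (out a)) -(Rintegral_support (out b)).
have outD c x : a <= c <= b -> ~ [set` `[a, b + 1]] x -> G x * kernel (h n) c x = 0.
  move=> /andP[ac cb]; rewrite /= in_itv /= => cx; apply: out.
  rewrite /= in_itv /= => /andP[cx1 cx2]; apply: cx.
  by have := h_le1 n; lra.
have aab : a <= a <= b by rewrite lexx ltW.
have bab : a <= b <= b by rewrite lexx ltW.
rewrite (Rintegral_support (outD a ^~ aab)) (Rintegral_support (outD b ^~ bab)).
rewrite -RintegralB//; last 2 first.
  by apply: integrable_mul_continuous iG _; exact: kernel_continuous.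
  by apply: integrable_mul_continuous iG _; exact: kernel_continuous.
rewrite (@Rintegral_support _ _ [set` `[a, b + 1]]).
  by apply: eq_Rintegral => x _; rewrite mulrBr.
by move=> x xD; rewrite mulrBr (outD a) ?(outD b) ?subrr.
Qed.

Lemma step_cvg (y : R) : step (n.+1%:R * y) @[n --> \oo] --> step 1 * (0 < y)%R%:R.
Proof.
case: (ltP 0 y) => y0; last first.
  rewrite mulr0; apply: cvg_near_cst; apply: nearW => n.
  by rewrite step_le0// mulr_ge0_le0.
rewrite mulr1; apply: cvg_near_cst; near=> n; rewrite step_ge1//.
rewrite -ler_pdivrMr// mul1r; apply: (@le_trans _ _ n%:R); last by rewrite ler_nat.
by near: n; exact: nbhs_infty_ger.
Unshelve. all: by end_near. Qed.

Lemma ramp_integral_cvg : \int[mu]_x (H x * ramp n x) @[n --> \oo] -->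
  step 1 * \int[mu]_(x in `[a, b]) H x.
Proof.
have [_ iH _] := GH.
(* The pointwise limit is [step 1] times the indicator of []a, b]]; domination is by [step 1 * |H|]
   on [[a, b + 1]], which supports all the ramps. *)
pose f x := H x * (step 1 * (0 < x - a)%R%:R - step 1 * (0 < x - b)%R%:R).
have out n x : ~ [set` `[a, b + 1]] x -> H x * ramp n x = 0.
  by rewrite /= in_itv => cx; rewrite ramp_out ?mulr0.
have -> : step 1 * \int[mu]_(x in `[a, b]) H x = \int[mu]_(x in `[a, b + 1]) f x.
  have fout x : ~ [set` `]a, b]] x -> f x = 0.
    move/negP; rewrite /= in_itv negb_and -leNgt -ltNge /f !subr_gt0 => /orP[xa|xb].
      by rewrite !ltNge xa (le_trans xa (ltW ab)) mulr0 subrr mulr0.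
    by rewrite xb (lt_trans ab xb) subrr mulr0.
  have fout' x : ~ [set` `[a, b + 1]] x -> f x = 0.
    move=> xD; apply: fout => /=; rewrite in_itv /= => /andP[ax xb]; apply: xD.
    by rewrite /= in_itv /=; lra.
  rewrite -(Rintegral_support fout') (Rintegral_support fout).
  have iab : mu.-integrable `]a, b] (EFin \o H).
    by apply: integrableS (locally_integrable_itv a b iH) => //; exact: subset_itv_oc_cc.
  rewrite -Rintegral_itv_obnd_cbnd// -RintegralZl//.
  apply: eq_Rintegral => x /set_mem; rewrite /= in_itv /= => /andP[ax xb].
  by rewrite /f !subr_gt0 ax ltNge xb /=; ring.
have -> : (fun n => \int[mu]_x (H x * ramp n x)) =
   (fun n => \int[mu]_(x in `[a, b + 1]) (H x * ramp n x)).
  by apply/funext => n; rewrite (Rintegral_support (out n)).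
have mH : measurable_fun setT H by case: iH.
have mf_ n : measurable_fun [set` `[a, b + 1]] (fun x => H x * ramp n x).
  apply: measurable_funTS; apply: measurable_funM => //.
  by apply: continuous_measurable_fun; exact: is_derive_continuous (is_derive_ramp n).
have cf x : H x * ramp n x @[n --> \oo] --> f x.
  apply: cvgM; first exact: cvg_cst.
  have -> : ramp ^~ x = fun n => step (n.+1%:R * (x - a)) - step (n.+1%:R * (x - b)).
    by apply/funext => n; rewrite /ramp !stepE.
  by apply: cvgB; exact: step_cvg.
apply: (@Rintegral_dominated _ _ _ (fun x => step 1 * `|H x|)) => //.
- by apply: (@measurable_fun_cvg _ _ _ _ (fun n x => H x * ramp n x)).
- apply: (@eq_integrable _ _ _ mu _ _ (fun x => (step 1)%:E * `|(H x)%:E|)%E) => //.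
  by apply: integrableZl => //; apply: integrable_abse; exact: locally_integrable_itv.
- move=> n x _; rewrite normrM mulrC ler_wpM2r// /ramp ler_norml.
  have /andP[s1 s2] := step_itv ((h n)^-1 * x + - ((h n)^-1 * a)).
  have /andP[s3 s4] := step_itv ((h n)^-1 * x + - ((h n)^-1 * b)).
  lra.
Qed.

(** Tested against the ramps, the derivative side concentrates at the two Lebesgue points while the
    other side tends to the integral over [[a, b]]. *)
Lemma lebesgue_pt_difference : lebesgue_pt G a -> lebesgue_pt G b ->
  G b - G a = \int[mu]_(x in `[a, b]) H x.
Proof.
move=> Ga Gb; have [iG iH GHE] := GH.
have c1 : \int[mu]_x (G x * derive1 (ramp n) x) @[n --> \oo] --> step 1 * G a - step 1 * G b.
  have -> : (fun n => \int[mu]_x (G x * derive1 (ramp n) x)) = (fun n =>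
    \int[mu]_(x in `[a, a + h n]) (G x * kernel (h n) a x) -
    \int[mu]_(x in `[b, b + h n]) (G x * kernel (h n) b x)).
    by apply/funext => n; exact: ramp_derive_integral.
  by apply: cvgB; exact: kernel_cvg.
have c2 : \int[mu]_x (G x * derive1 (ramp n) x) @[n --> \oo] -->
    - (step 1 * \int[mu]_(x in `[a, b]) H x).
  have -> : (fun n => \int[mu]_x (G x * derive1 (ramp n) x)) =
    (fun n => - \int[mu]_x (H x * ramp n x)).
    by apply/funext => n; apply: GHE; exact: test_function_ramp.
  by apply: cvgN; exact: ramp_integral_cvg.
have := cvg_unique (@Rhausdorff R) c1 c2.
rewrite -mulrBr -mulrN => E; have {}E := mulfI (lt0r_neq0 step1_gt0) (E _).
by rewrite -opprB E opprK.
Qed.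

End difference.

Lemma du_bois_reymond G H : weak_primitive G H ->
  exists C, {ae mu, forall x, G x = C + primitive H x}.
Proof.
move=> GH; have [iG iH _] := GH.
have L := lebesgue_differentiation iG.
(* A base point exists, since otherwise [[0, 1]] would be negligible. *)
have [a0 La0] : exists a0, lebesgue_pt G a0.
  apply: contrapT => /forallNP noL.
  have n01 : mu.-negligible [set` `[(0 : R), 1]].
    by apply: negligibleS L => x _ /=; exact: noL.
  have := @measure_negligible _ _ _ mu [set` `[(0 : R), 1]] (measurable_itv _) n01.
  by rewrite /= lebesgue_measure_itv /= lte_fin ltr01 -EFinB subr0 => /eqP; rewrite eqe oner_eq0.
exists (G a0 - primitive H a0); apply: (@filterS _ _ (ae_filter_ringOfSetsType mu) _ _ _ L) => x Lx.
case: (ltgtP a0 x) => [ax|xa|<-]; last by rewrite subrK.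
  have := lebesgue_pt_difference GH ax La0 Lx; rewrite -(primitiveB iH (ltW ax)); lra.
have := lebesgue_pt_difference GH xa Lx La0; rewrite -(primitiveB iH (ltW xa)); lra.
Qed.

Lemma weak_primitive_continuous G H : weak_primitive G H -> continuous G ->
  forall x, G x = G 0 + primitive H x.
Proof.
move=> GH cG x; have [iG iH _] := GH.
have L y : lebesgue_pt G y.
  apply: (@continuous_lebesgue_pt _ _ _ setT) => //; last exact: cG.
    by split; [exact: openT|].
  by case: iG.
have p0 : primitive H 0 = 0 by rewrite /primitive subrr.
case: (ltgtP 0 x) => [ax|xa|<-]; last by rewrite p0 addr0.
  have := lebesgue_pt_difference GH ax (L _) (L _); rewrite -(primitiveB iH (ltW ax)); lra.
have := lebesgue_pt_difference GH xa (L _) (L _); rewrite -(primitiveB iH (ltW xa)); lra.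
Qed.

End du_bois_reymond.

(** * Classical derivatives from weak ones *)

Section weak_derivatives.
Context {R : realType}.
Notation mu := (@lebesgue_measure R).
Implicit Types (f g G H F phi : R -> R).

Lemma test_function_derive1 phi : test_function phi -> test_function (derive1 phi).
Proof.
move=> [dphi [M phiM]]; split.
  by move=> n x; have := dphi n.+1 x; rewrite /derive1n iterSr.
exists M => x Mx; rewrite derive1E.
suff : is_derive x 1 phi 0 by case.
apply: (@near_eq_is_derive _ _ _ (fun=> 0)).
near=> y; rewrite phiM//; near: y.
have : {for x, continuous (fun y : R => `|y|)} by exact: norm_continuous.
by move=> /(_ _ (lt_nbhsr Mx)).
Unshelve. all: by end_near. Qed.

Lemma test_function_derive1n n phi : test_function phi -> test_function (derive1n n phi).
Proof.
elim: n phi => [//|n IH] phi tphi.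
by rewrite /derive1n iterSr; apply: IH; exact: test_function_derive1.
Qed.

Lemma test_function_continuous phi : test_function phi -> continuous phi.
Proof.
move=> [dphi _]; apply: (@is_derive_continuous _ _ (derive1 phi)) => x.
by apply: DeriveDef; [exact: dphi 0%N x|rewrite derive1E].
Qed.

Lemma integrable_test G phi : locally_integrable setT G -> test_function phi ->
  mu.-integrable setT (EFin \o (fun x => G x * phi x)).
Proof.
move=> iG tphi; have [_ [M phiM]] := tphi.
have -> : EFin \o (fun x => G x * phi x) = (EFin \o (fun x => G x * phi x)) \_ `[- M, M].
  apply/funext => x; rewrite patchE; case: ifPn => //.
  rewrite notin_setE /= in_itv /= -ler_norml => /negP; rewrite -ltNge => Mx.
  by rewrite /= phiM// mulr0.
have mI : measurable ([set` `[- M, M]] : set (measurableTypeR R)) by [].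
apply: (@integrable_mkcond _ _ _ mu [set` `[- M, M]] (EFin \o (fun x => G x * phi x)) mI).1.
apply: integrable_mul_continuous => //.
exact: test_function_continuous.
Qed.

(** Weak derivatives are given for [Phi] and [Psi], norms for [A] and [B]; this transfers existence
    to the profiles. *)
Lemma is_weak_derivative_lin i F F' G G' (a b : R) : continuous F -> continuous F' ->
  is_weak_derivative i F G -> is_weak_derivative i F' G' ->
  is_weak_derivative i (fun x => a * F x + b * F' x) (fun x => a * G x + b * G' x).
Proof.
move=> cF cF' [iG HG] [iG' HG'].
have lz (c : R) (K : R -> R) : locally_integrable setT K -> locally_integrable setT (fun x => c * K x).
  move=> [mK oT iK]; split => //; first exact: measurable_funM.
  move=> J _ cJ; have := iK J (@subsetT _ _) cJ => iKJ.
  have mJ : measurable J by exact: compact_measurable.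
  under eq_integral do rewrite normrM EFinM.
  rewrite ge0_integralZl_EFin//; last first.
    by apply/measurable_EFinP; apply: measurableT_comp => //; exact: measurable_funTS.
  by rewrite lte_mul_pinfty.
split; first by apply: locally_integrableD; exact: lz.
move=> phi tphi.
have ip K psi : locally_integrable setT K -> test_function psi ->
    mu.-integrable setT (EFin \o (fun x => K x * psi x)) by exact: integrable_test.
have lin K K' psi : locally_integrable setT K -> locally_integrable setT K' -> test_function psi ->
    \int[mu]_x ((a * K x + b * K' x) * psi x) =
    a * \int[mu]_x (K x * psi x) + b * \int[mu]_x (K' x * psi x).
  move=> iK iK' tp; rewrite -!RintegralZl ?ip//.
  rewrite -RintegralD//; first by apply: eq_Rintegral => x _; ring.
  - by have := ip _ _ (lz a _ iK) tp; congr (integrable _ _ _); apply/funext => x /=; rewrite mulrA.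
  - by have := ip _ _ (lz b _ iK') tp; congr (integrable _ _ _); apply/funext => x /=; rewrite mulrA.
have tpi := test_function_derive1n i tphi.
rewrite !lin//; try exact: continuous_locally_integrable.
by rewrite HG// HG'//; ring.
Qed.

Lemma weak_derivative_primitive i F G H : is_weak_derivative i F G ->
  is_weak_derivative i.+1 F H -> weak_primitive G H.
Proof.
move=> [iG HG] [iH HH]; split => // phi tphi.
have := HG _ (test_function_derive1 tphi).
have -> : derive1n i (derive1 phi) = derive1n i.+1 phi by rewrite /derive1n iterSr.
rewrite HH// exprS => E.
have si : ((-1 : R) ^+ i) * (-1) ^+ i = 1 by rewrite -exprMn mulrNN mulr1 expr1n.
have := congr1 ( *%R ((-1) ^+ i)) E; rewrite [in RHS]mulrA si mul1r => <-.
by rewrite !mulrA mulrN1 mulNr si mulN1r.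
Qed.

Lemma weak_derivative1_primitive F H : continuous F ->
  is_weak_derivative 1 F H -> weak_primitive F H.
Proof.
move=> cF [iH HH]; split => //; first exact: continuous_locally_integrable.
by move=> phi tphi; rewrite -[derive1 phi]/(derive1n 1 phi) HH// expr1 mulN1r.
Qed.

Lemma ae_eq_Rintegral f g (D : set R) : measurable D -> measurable_fun setT f ->
  measurable_fun setT g -> {ae mu, forall x, f x = g x} ->
  \int[mu]_(x in D) f x = \int[mu]_(x in D) g x.
Proof.
move=> mD mf mg fg; congr fine; apply: ae_eq_integral => //.
- by apply/measurable_EFinP; exact: measurable_funTS.
- by apply/measurable_EFinP; exact: measurable_funTS.
apply: (@filterS _ _ (ae_filter_ringOfSetsType mu) _ _ _ fg) => x fgx _.
by rewrite /= fgx.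
Qed.

Lemma ae_eq_primitive f g : locally_integrable setT f -> locally_integrable setT g ->
  {ae mu, forall x, f x = g x} -> primitive f = primitive g.
Proof.
move=> [mf _ _] [mg _ _] fg; apply/funext => x; rewrite /primitive.
by congr (_ - _); apply: ae_eq_Rintegral.
Qed.

Lemma is_derive_cst_primitive (C : R) f (x : R) : continuous f ->
  is_derive x 1 (fun y => C + primitive f y) (f x).
Proof.
move=> cf; have := is_derive_addf (is_derive_cstf C x) (is_derive_primitive x cf).
by rewrite add0r.
Qed.

Lemma continuous_cst_primitive (C : R) f : locally_integrable setT f ->
  continuous (fun y => C + primitive f y).
Proof.
by move=> iF x; apply: cvgD; [exact: cvg_cst|exact: primitive_continuous].
Qed.

(** Descent from the top order: each weak derivative is almost everywhere a constant plus a
    primitive of the next one, which may be replaced by its continuous version inside the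
    integral. *)
Lemma weak_derivatives_smooth F (W : nat -> R -> R) : continuous F ->
  (forall i, (i <= 4)%N -> is_weak_derivative i F (W i)) ->
  exists a : nat -> R -> R, [/\ a 0%N = F,
    forall i, (i < 3)%N -> forall x : R, is_derive x 1 (a i) (a i.+1 x),
    continuous (a 3%N) &
    forall i, (0 < i <= 3)%N -> {ae mu, forall x, W i x = a i x}].
Proof.
move=> cF HW.
have P i : (i < 4)%N -> weak_primitive (W i) (W i.+1).
  by move=> i4; apply: (@weak_derivative_primitive i F); apply: HW; lia.
have L i : (i <= 4)%N -> locally_integrable setT (W i) by move=> /HW[].
have [C3 E3] := du_bois_reymond (P 3 isT).
pose a3 x := C3 + primitive (W 4) x.
have c3 : continuous a3 by apply: continuous_cst_primitive; exact: L.
have [C2 E2] := du_bois_reymond (P 2 isT).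
rewrite (ae_eq_primitive (L 3 isT) (continuous_locally_integrable c3) E3) in E2.
pose a2 x := C2 + primitive a3 x.
have c2 : continuous a2.
  by apply: continuous_cst_primitive; exact: continuous_locally_integrable.
have [C1 E1] := du_bois_reymond (P 1 isT).
rewrite (ae_eq_primitive (L 2 isT) (continuous_locally_integrable c2) E2) in E1.
pose a1 x := C1 + primitive a2 x.
have c1 : continuous a1.
  by apply: continuous_cst_primitive; exact: continuous_locally_integrable.
(* At order 0 continuity gives the identity everywhere, so that [F] itself, and not a modification
   of it, is differentiable. *)
have E0 := weak_primitive_continuous (weak_derivative1_primitive cF (HW 1 isT)) cF.
rewrite (ae_eq_primitive (L 1 isT) (continuous_locally_integrable c1) E1) in E0.
exists (fun i => match i with 0 => F | 1 => a1 | 2 => a2 | _ => a3 end).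
split => //.
- move=> [|[|[|i]]] i3 x; last by [].
  + by apply: is_derive_ext (is_derive_cst_primitive (F 0) x c1) => y; rewrite -E0.
  + exact: is_derive_cst_primitive.
  + exact: is_derive_cst_primitive.
- by move=> [|[|[|[|i]]]] i3; [|exact: E1|exact: E2|exact: E3|].
Qed.

End weak_derivatives.

Section weighted_norms.
Context {R : realType}.
Notation mu := (@lebesgue_measure R).

Lemma Hsr_norm_weighted (s i : nat) (F : R -> R) (n : R) :
  Hsr_norm s F = n%:E -> (i <= s)%N ->
  (\int[mu]_x ((1 + `|x|) * weak_derivative i F x ^+ 2)%:E <= (n ^+ 2)%:E)%E.
Proof.
move=> nE is_.
set I := (\int[mu]_x _)%E.
have I0 : (0 <= I)%E.
  by apply: integral_ge0 => x _; rewrite lee_fin mulr_ge0 ?sqr_ge0// addr_ge0.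
have NE : ('N[mu]_2%:E[(fun x => (Num.sqrt (1 + `|x|) * weak_derivative i F x)%R%:E)] = sqrte I)%E.
  rewrite unlock poweR12_sqrt; last first.
    by apply: integral_ge0 => x _; exact: poweR_ge0.
  congr sqrte; apply: eq_integral => x _.
  rewrite abse_EFin poweR_EFin powR_mulrn// real_normK ?num_real// exprMn sqr_sqrtr//.
have : (sqrte I <= n%:E)%E.
  rewrite -nE -NE /Hsr_norm big_mkord.
  rewrite (bigD1 (Ordinal (is_ : (i < s.+1)%N)))//= leeDl//.
  by apply: sume_ge0 => j _; exact: Lnorm_ge0.
move=> sI; rewrite -(sqr_sqrte I0) EFin_expe.
have n0 : (0 <= n%:E)%E by apply: le_trans sI; exact: sqrte_ge0.
by rewrite !expe2; apply: lee_pmul => //; exact: sqrte_ge0.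
Qed.

Lemma weak_derivativeP (i : nat) (F : R -> R) :
  (exists G, is_weak_derivative i F G) -> is_weak_derivative i F (weak_derivative i F).
Proof.
by move=> [G HG]; apply: (@xgetPex _ _ [set G | is_weak_derivative i F G]); exists G.
Qed.

Lemma weighted_itv (a W : R -> R) (n u v : R) : continuous a -> measurable_fun setT W ->
  {ae mu, forall x, W x = a x} ->
  (\int[mu]_x ((1 + `|x|) * W x ^+ 2)%:E <= (n ^+ 2)%:E)%E ->
  \int[mu]_(x in `[u, v]) ((1 + `|x|) * a x ^+ 2) <= n ^+ 2.
Proof.
move=> ca mW Wa WI.
have mw : measurable_fun setT (fun x : R => 1 + `|x|).
  by apply: measurable_funD => //; exact: measurableT_comp.
have ma : measurable_fun setT a by exact: continuous_measurable_fun.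
have mWw : measurable_fun setT (fun x : R => (1 + `|x|) * W x ^+ 2).
  by apply: measurable_funM => //; exact: measurable_funX.
rewrite -(@ae_eq_Rintegral _ (fun x : R => (1 + `|x|) * W x ^+ 2))//; last 2 first.
  by apply: measurable_funM => //; exact: measurable_funX.
  by apply: (@filterS _ _ (ae_filter_ringOfSetsType mu) _ _ _ Wa) => x ->.
have J0 : (0 <= \int[mu]_(x in `[u, v]) ((1 + `|x|) * W x ^+ 2)%:E)%E.
  by apply: integral_ge0 => x _; rewrite lee_fin mulr_ge0 ?sqr_ge0// addr_ge0.
have JI : (\int[mu]_(x in `[u, v]) ((1 + `|x|) * W x ^+ 2)%:E <= (n ^+ 2)%:E)%E.
  apply: le_trans WI; apply: ge0_subset_integral => //.
    exact/measurable_EFinP.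
  by move=> x _; rewrite lee_fin mulr_ge0 ?sqr_ge0// addr_ge0.
rewrite -lee_fin /Rintegral fineK// ge0_fin_numE//.
by apply: le_lt_trans JI _; rewrite ltry.
Qed.

End weighted_norms.

(** * Weighted envelopes *)

Section envelope.
Context {R : realType}.

(* On [[y, y + 1]] some [c] has [(1 + `|c|) * h c ^+ 2 <= Gam (y + 1) - Gam y], and
   [`|(h ^+ 2)^`()| <= h ^+ 2 + h' ^+ 2] controls [h y ^+ 2 - h c ^+ 2]. *)
Lemma sobolev_point (h h' Gam g : R -> R) (y : R) :
  (forall x : R, is_derive x 1 h (h' x)) -> (forall x : R, is_derive x 1 Gam (g x)) ->
  (forall x, (1 + `|x|) * (h x ^+ 2 + h' x ^+ 2) <= g x) ->
  (1 + `|y|) * h y ^+ 2 <= 4 * (Gam (y + 1) - Gam y).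
Proof.
move=> dh dG hg.
have yy : y <= y + 1 by rewrite lerDl.
have w0 (x : R) : 0 < 1 + `|x| by rewrite ltr_pwDl.
have [|c cab E] := @MVT_segment R Gam g y (y + 1) yy (fun x _ => dG x).
  exact/continuous_subspaceT/(is_derive_continuous dG).
move: cab; rewrite in_itv /= => /andP[yc c1].
rewrite addrAC subrr add0r mulr1 in E.
have wle x : y <= x -> x <= y + 1 -> 1 + `|y| <= 2 * (1 + `|x|).
  move=> yx xy; have : `|y| <= `|x| + 1; last by have := normr_ge0 x; lra.
  have -> : y = x - (x - y) by ring.
  by apply: le_trans (ler_normB _ _) _; rewrite lerD2l ger0_norm; lra.
have hw x : y <= x -> x <= y + 1 -> (1 + `|y|) * (h x ^+ 2 + h' x ^+ 2) <= 2 * g x.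
  move=> yx xy; apply: (@le_trans _ _ (2 * (1 + `|x|) * (h x ^+ 2 + h' x ^+ 2))).
    by rewrite ler_wpM2r ?wle// addr_ge0 ?sqr_ge0.
  by rewrite -mulrA ler_pM2l.
have g0 x : 0 <= g x.
  by apply: le_trans (hg x); rewrite mulr_ge0 ?(ltW (w0 _))// addr_ge0 ?sqr_ge0.
have S1 : (1 + `|y|) * h y ^+ 2 - (1 + `|y|) * h c ^+ 2 <= 2 * Gam c - 2 * Gam y.
  suff : - (1 + `|y|) * h c ^+ 2 - - (1 + `|y|) * h y ^+ 2 <= 2 * Gam c - 2 * Gam y by lra.
  apply: (derive_le yc (fun x => is_derive_scalef (- (1 + `|y|)) (is_derive_sqrf (dh x)))
    (fun x => is_derive_scalef 2 (dG x))) => x /andP[yx xc].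
  have := hw x yx (le_trans xc c1).
  have := sqr_ge0 (h x + h' x) => i1 i2.
  have : - ((1 + `|y|) * (2 * h x * h' x)) <= (1 + `|y|) * (h x ^+ 2 + h' x ^+ 2).
    by rewrite -mulrN ler_pM2l//; lra.
  by rewrite mulNr; lra.
have S2 : (1 + `|y|) * h c ^+ 2 <= 2 * (Gam (y + 1) - Gam y).
  rewrite E; apply: le_trans (hw c yc c1).
  by rewrite ler_pM2l// lerDl sqr_ge0.
have S3 : Gam c <= Gam (y + 1) by apply: derive_ge0_le dG _.
lra.
Qed.

(** Raising [q] by one adds two telescoping sums, each bounded by an oscillation at either end of
    the window. *)
Lemma wsum_window (u : int -> R) (D : R) (q N : nat) :
  (forall i j : int, u i - u j <= D) ->
  wsum N (fun j => u (j + q%:Z) - u (j - q%:Z)) <= (2 * q)%:R * D.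
Proof.
move=> uD; elim: q => [|q IH].
  rewrite muln0 mul0r.
  rewrite (@eq_wsum _ _ _ (fun=> 0 * 0)) ?wsumZ ?mul0r// => j.
  have -> : (j + 0%:Z = j)%R by lia.
  by rewrite subrr ?mul0r.
have -> : wsum N (fun j => u (j + q.+1%:Z) - u (j - q.+1%:Z)) =
    wsum N (fun j => u (j + q%:Z) - u (j - q%:Z)) +
    (wsum N (fun j => u (j + 1 + q%:Z) - u (j + q%:Z)) +
     wsum N (fun j => u (j + 1 - q.+1%:Z) - u (j - q.+1%:Z))).
  rewrite -!wsumD; apply: eq_wsum => j.
  have -> : (j + q.+1%:Z = j + 1 + q%:Z)%R by lia.
  have -> : (j + 1 - q.+1%:Z = j - q%:Z)%R by lia.
  ring.
rewrite (wsum_telescope N (fun j => u (j + q%:Z))) (wsum_telescope N (fun j => u (j - q.+1%:Z))).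
have -> : (2 * q.+1)%:R * D = (2 * q)%:R * D + (D + D) :> R.
  by rewrite mulnS natrD; ring.
by rewrite !lerD.
Qed.

Variables (Gam g : R -> R) (D0 eps S : R).
Hypothesis dGam : forall x : R, is_derive x 1 Gam (g x).
Hypothesis g_ge0 : forall x, 0 <= g x.
Hypothesis Gam_osc : forall x y, Gam x - Gam y <= D0.
Hypothesis eps_gt0 : 0 < eps.
Hypothesis eps_le1 : eps <= 1.
Hypothesis S_ge0 : 0 <= S.

Lemma Gam_homo (x y : R) : x <= y -> Gam x <= Gam y.
Proof. by move=> xy; apply: derive_ge0_le xy dGam _. Qed.

(** The factor 4 is that of [sobolev_point], and [1 + S] compares the weights at [x] and at
    [eps * j]. The radius [S + 1] contains [[x, x + 1]] for every [x] within [S] of the site. *)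
Definition envelope (j : int) : R := 4 * (1 + S) *
  (Gam (eps * j%:~R + (S + 1)) - Gam (eps * j%:~R - (S + 1))) / (1 + `|eps * j%:~R|).

Lemma envelope_ge0 j : 0 <= envelope j.
Proof.
rewrite /envelope divr_ge0 ?addr_ge0//; apply: mulr_ge0.
  by rewrite mulr_ge0// addr_ge0.
have aux (y : R) : y - (S + 1) <= y + (S + 1) by move: S_ge0; lra.
by rewrite subr_ge0 Gam_homo.
Qed.

Lemma envelope_le (h h' : R -> R) (j : int) (x : R) :
  (forall x : R, is_derive x 1 h (h' x)) ->
  (forall x, (1 + `|x|) * (h x ^+ 2 + h' x ^+ 2) <= g x) ->
  `|x - eps * j%:~R| <= S -> `|h x| <= Num.sqrt (envelope j).
Proof.
move=> dh hg xj; rewrite -sqrtr_sqr ler_wsqrtr//.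
have w0 (z : R) : 0 < 1 + `|z| by rewrite ltr_pwDl.
rewrite /envelope ler_pdivlMr//; move: (eps * j%:~R) xj => y xj.
have := sobolev_point x dh dGam hg => H.
move: (xj); rewrite ler_norml => /andP[xj1 xj2].
have G1 : Gam (x + 1) - Gam x <= Gam (y + (S + 1)) - Gam (y - (S + 1)).
  by apply: lerB; apply: Gam_homo; lra.
have w1 : 1 + `|y| <= (1 + S) * (1 + `|x|).
  have : `|y| <= `|x| + S.
    have -> : y = x - (x - y) by ring.
    by apply: le_trans (ler_normB _ _) _; rewrite lerD2l.
  by have := mulr_ge0 S_ge0 (normr_ge0 x); nra.
apply: (@le_trans _ _ ((1 + S) * ((1 + `|x|) * h x ^+ 2))).
  by rewrite mulrA mulrC ler_wpM2r ?sqr_ge0.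
have S1 : 0 <= 1 + S by rewrite addr_ge0.
apply: le_trans (ler_wpM2l S1 H) _.
by rewrite mulrCA mulrA ler_wpM2l// mulr_ge0.
Qed.

Lemma envelope_wsum N : wsum N (fun j => (1 + `|eps * j%:~R|) * envelope j) <=
  8 * (1 + S) * (S + 2) * D0 / eps.
Proof.
have D00 : 0 <= D0 by have := Gam_osc 0 0; rewrite subrr.
(* Measured in sites, the radius [S + 1] is at most [q], and [q <= (S + 2) / eps] because
   [eps <= 1]; summing increments over [2 * q] sites costs [2 * q] oscillations. *)
pose q := `|Num.ceil ((S + 1) / eps)|%N.
have qle : (S + 1) / eps <= q%:R.
  rewrite /q -[leRHS]/((`|Num.ceil ((S + 1) / eps)|%N%:Z)%:~R) abszE.
  apply: le_trans (ceil_ge _) _; rewrite ler_int; exact: ler_norm.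
have qge : q%:R <= (S + 2) / eps.
  have c0 : (0 <= Num.ceil ((S + 1) / eps)).
    by rewrite ceil_ge0 (lt_le_trans _ (divr_ge0 _ _))// ?ltrN10 ?addr_ge0 ?(ltW eps_gt0).
  rewrite /q -[leLHS]/((`|Num.ceil ((S + 1) / eps)|%N%:Z)%:~R) abszE ger0_norm//.
  have := @ceilB1_lt R ((S + 1) / eps).
  rewrite rmorphB /= ltrBlDr => /ltW/le_trans; apply.
  have -> : (S + 2) / eps = (S + 1) / eps + eps^-1 by field; rewrite gt_eqF.
  by rewrite lerD2l invf_ge1.
apply: (@le_trans _ _ (wsum N (fun j => 4 * (1 + S) *
    (Gam (eps * (j + q%:Z)%:~R) - Gam (eps * (j - q%:Z)%:~R))))).
  apply: ler_wsum => j; rewrite /envelope mulrC divfK; last by rewrite gt_eqF// ltr_pwDl.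
  apply: ler_wpM2l; first by rewrite mulr_ge0// addr_ge0.
  have Sq : S + 1 <= eps * q%:R by rewrite mulrC -ler_pdivrMr.
  by apply: lerB; apply: Gam_homo; rewrite rmorphD ?rmorphB /= ?rmorphN /= mulrDr ?mulrN; move: Sq; move: (eps * j%:~R) (eps * _) => y z; lra.
rewrite wsumZ.
have := @wsum_window (fun j => Gam (eps * j%:~R)) D0 q N (fun i j => Gam_osc _ _).
have c4 : 0 <= 4 * (1 + S) by rewrite mulr_ge0// addr_ge0.
move=> /(ler_wpM2l c4)/le_trans; apply.
have -> : 8 * (1 + S) * (S + 2) * D0 / eps = 4 * (1 + S) * (2 * ((S + 2) / eps) * D0) by ring.
rewrite ler_wpM2l// natrM ler_wpM2r// ler_pM2l//.
Qed.

End envelope.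

(** * Random walks *)

Section independence.
Context {R : realType} (d : measure_display) (T : measurableType d) (P : probability T R).

Lemma independent_integral_mul (X Y : T -> R) :
  measurable_fun setT X -> measurable_fun setT Y ->
  (forall w, 0 <= X w) -> (forall w, 0 <= Y w) ->
  (forall A B, measurable A -> measurable B ->
    P (X @^-1` A `&` Y @^-1` B) = (P (X @^-1` A) * P (Y @^-1` B))%E) ->
  (\int[P]_w (X w * Y w)%:E = \int[P]_w (X w)%:E * \int[P]_w (Y w)%:E)%E.
Proof.
move=> mX mY X0 Y0 XY.
have mXY : measurable_fun setT (fun w => (X w, Y w)) by exact: measurable_fun_pair.
pose X' : {mfun T >-> R} := HB.pack X (isMeasurableFun.Build _ _ _ _ _ mX).
pose Y' : {mfun T >-> R} := HB.pack Y (isMeasurableFun.Build _ _ _ _ _ mY).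
pose Z' : {mfun T >-> (R * R)%type} :=
  HB.pack (fun w => (X w, Y w)) (isMeasurableFun.Build _ _ _ _ _ mXY).
(* The positive part makes the integrand nonnegative on the whole plane, as Tonelli requires,
   without changing it on the values of [X] and [Y]. *)
pose pos (x : R) := Num.max x 0.
have pos0 x : 0 <= pos x by rewrite le_max lexx orbT.
have mpos : measurable_fun setT pos by exact: measurable_maxr.
have EX : (\int[distribution P X']_x (pos x)%:E = \int[P]_w (X w)%:E)%E.
  rewrite ge0_integral_distribution//; last exact/measurable_EFinP.
  by apply: eq_integral => w _; rewrite /= /pos max_l.
have EY : (\int[distribution P Y']_x (pos x)%:E = \int[P]_w (Y w)%:E)%E.
  rewrite ge0_integral_distribution//; last exact/measurable_EFinP.
  by apply: eq_integral => w _; rewrite /= /pos max_l.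
pose f (z : R * R) : \bar R := (pos z.1 * pos z.2)%:E.
have mf : measurable_fun setT f.
  by apply/measurable_EFinP; apply: measurable_funM; apply: measurableT_comp.
have f0 z : (0 <= f z)%E by rewrite lee_fin mulr_ge0.
transitivity (\int[distribution P Z']_z f z)%E.
  rewrite ge0_integral_distribution//.
  by apply: eq_integral => w _; rewrite /= /f /= /pos !max_l.
(* Independence identifies the joint law with the product law on rectangles, which determine it. *)
have -> : (\int[distribution P Z']_z f z = \int[distribution P X' \x distribution P Y']_z f z)%E.
  apply: eq_measure_integral => A mA _; apply/esym.
  apply: product_measure_unique => // B C mB mC.
rewrite fubini_tonelli1//.
have inner x : (fubini_F (distribution P Y') f x = (pos x)%:E * \int[P]_w (Y w)%:E)%E.
  rewrite /fubini_F -EY -ge0_integralZl_EFin//; last exact/measurable_EFinP.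
  by move=> y _; rewrite lee_fin.
under eq_integral do rewrite inner.
rewrite ge0_integralZr//; first by rewrite EX.
- exact/measurable_EFinP.
- by move=> y _; rewrite lee_fin.
- by apply: integral_ge0 => w _; rewrite lee_fin.
Qed.

Definition bounded_rv (X : T -> R) :=
  measurable_fun setT X /\ exists M, forall w, `|X w| <= M.

Lemma bounded_rvD X Y : bounded_rv X -> bounded_rv Y -> bounded_rv (fun w => X w + Y w).
Proof.
move=> [mX [M HM]] [mY [N HN]]; split; first exact: measurable_funD.
by exists (M + N) => w; apply: le_trans (ler_normD _ _) _; exact: lerD.
Qed.

Lemma bounded_rvM X Y : bounded_rv X -> bounded_rv Y -> bounded_rv (fun w => X w * Y w).
Proof.
move=> [mX [M HM]] [mY [N HN]]; split; first exact: measurable_funM.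
by exists (M * N) => w; rewrite normrM ler_pM.
Qed.

Lemma bounded_rv_cst (c : R) : bounded_rv (fun=> c).
Proof. by split; [exact: measurable_cst|exists `|c|]. Qed.

Lemma bounded_rv_sum (s : seq int) (Y : int -> T -> R) : (forall j, bounded_rv (Y j)) ->
  bounded_rv (fun w => \sum_(j <- s) Y j w).
Proof.
move=> bY; elim: s => [|j s IH].
  by under eq_fun do rewrite big_nil; exact: bounded_rv_cst.
by under eq_fun do rewrite big_cons; exact: bounded_rvD.
Qed.

Lemma bounded_rv_integrable X : bounded_rv X -> P.-integrable setT (EFin \o X).
Proof.
move=> [mX [M HM]]; apply: measurable_bounded_integrable => //.
  by apply: le_lt_trans (probability_le1 P measurableT) _; rewrite ltry.
exists M; split; first exact: num_real.
by move=> y My w _; exact: le_trans (HM w) (ltW My).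
Qed.

Lemma Rintegral_probability_cst (c : R) : \int[P]_w c = c.
Proof.
rewrite Rintegral_cst// -[RHS]mulr1; congr (_ * _).
by rewrite -[RHS]/(fine 1%E); congr fine; exact: probability_setT.
Qed.

Lemma identically_distributed_integral (X : int -> T -> R) (f : R -> R) (i j : int) :
  (forall j, measurable_fun setT (X j)) -> identically_distributed P X ->
  measurable_fun setT f -> (forall x, 0 <= f x) ->
  (\int[P]_w (f (X i w))%:E = \int[P]_w (f (X j w))%:E)%E.
Proof.
move=> mX idX mf f0.
pose X' l : {mfun T >-> R} := HB.pack (X l) (isMeasurableFun.Build _ _ _ _ _ (mX l)).
have E l : (\int[P]_w (f (X l w))%:E = \int[distribution P (X' l)]_x (f x)%:E)%E.
  by rewrite ge0_integral_distribution//; exact/measurable_EFinP.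
rewrite !E; apply: eq_measure_integral => A mA _; exact: idX.
Qed.

Lemma mutually_independent_pair (X : int -> T -> R) (i j : int) : i != j ->
  mutually_independent P X -> forall A B, measurable A -> measurable B ->
  P (X i @^-1` A `&` X j @^-1` B) = (P (X i @^-1` A) * P (X j @^-1` B))%E.
Proof.
move=> ij indX A B mA mB.
have := indX [fset i; j]%fset (fun l => if l == i then A else B).
rewrite big_fsetU1 ?inE//= big_seq_fset1 eqxx eq_sym (negbTE ij) => <-; last first.
  by move=> l; case: ifP.
congr (P _); apply/seteqP; split => w /=.
  move=> [wA wB] l /=; rewrite !inE => /orP[|] /eqP ->; first by rewrite eqxx.
  by rewrite eq_sym (negbTE ij).
move=> H; have := H i; have := H j; rewrite /= !inE !eqxx orbT eq_sym (negbTE ij).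
by move=> /(_ isT) ? /(_ isT) ?; split.
Qed.

Section walk.
Variables (X : int -> T -> R) (b mean sig : R).
Hypothesis X_iid : iid P X.
Hypothesis X_ge0 : forall j w, 0 <= X j w.
Hypothesis X_le : forall j w, X j w <= b.
Hypothesis X_mean : \int[P]_w X 0 w = mean.
Hypothesis X_var : \int[P]_w (X 0 w - mean) ^+ 2 = sig ^+ 2.

Let Y j w := X j w - mean.

Let mX j : measurable_fun setT (X j). Proof. by have [mX _ _] := X_iid. Qed.

Let bX j : bounded_rv (X j).
Proof. by split => //; exists b => w; rewrite ger0_norm. Qed.

Let bY j : bounded_rv (Y j).
Proof. by apply: (bounded_rvD (bX j)); exact: bounded_rv_cst. Qed.

Let X_mean' j : \int[P]_w X j w = mean.
Proof.
have [_ _ idX] := X_iid.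
rewrite -X_mean; congr fine.
pose pos (x : R) := Num.max x 0.
have mpos : measurable_fun setT pos by exact: measurable_maxr.
have pos0 x : 0 <= pos x by rewrite le_max lexx orbT.
have E l : (\int[P]_w (X l w)%:E = \int[P]_w (pos (X l w))%:E)%E.
  by apply: eq_integral => w _; rewrite /pos max_l.
by rewrite !E; exact: identically_distributed_integral.
Qed.

Let Y_var j : \int[P]_w (Y j w) ^+ 2 = sig ^+ 2.
Proof.
have [_ _ idX] := X_iid.
rewrite -X_var; congr fine.
apply: (@identically_distributed_integral X (fun x => (x - mean) ^+ 2)) => //.
- by apply: measurable_funX; apply: measurable_funB.
- by move=> x; exact: sqr_ge0.
Qed.

(** The product formula is available for nonnegative variables, so it is applied to [X i] and [X j],
    and the centred product is expanded. *)
Let Y_cov i j : i != j -> \int[P]_w (Y i w * Y j w) = 0.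
Proof.
move=> ij; have [_ indX _] := X_iid.
have XX : \int[P]_w (X i w * X j w) = mean * mean.
  rewrite /Rintegral independent_integral_mul//; last exact: mutually_independent_pair.
  rewrite fineM; first by rewrite -{1}(X_mean' i) -(X_mean' j).
  - exact: integrable_fin_num (bounded_rv_integrable (bX i)).
  - exact: integrable_fin_num (bounded_rv_integrable (bX j)).
have bXX := bounded_rv_integrable (bounded_rvM (bX i) (bX j)).
have bc l := bounded_rv_integrable (bounded_rvM (bounded_rv_cst (- mean)) (bX l)).
have bcc := bounded_rv_integrable (bounded_rv_cst (mean * mean)).
have -> : \int[P]_w (Y i w * Y j w) =
  \int[P]_w ((X i w * X j w + - mean * X i w) + (- mean * X j w + mean * mean)).
  by apply: eq_Rintegral => w _; rewrite /Y; ring.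
rewrite RintegralD//; last 2 first.
- exact: bounded_rv_integrable (bounded_rvD (bounded_rvM (bX i) (bX j)) (bounded_rvM (bounded_rv_cst (- mean)) (bX i))).
- exact: bounded_rv_integrable (bounded_rvD (bounded_rvM (bounded_rv_cst (- mean)) (bX j)) (bounded_rv_cst (mean * mean))).
rewrite !RintegralD// XX !RintegralZl ?X_mean' ?Rintegral_probability_cst//.
- by ring.
- exact: bounded_rv_integrable.
- exact: bounded_rv_integrable.
- exact: bounded_rv_integrable (bounded_rv_cst mean).
Qed.

Lemma sum_second_moment (s : seq int) : uniq s ->
  \int[P]_w (\sum_(j <- s) Y j w) ^+ 2 = (size s)%:R * sig ^+ 2.
Proof.
elim: s => [_|j s IH /= /andP[js us]].
  rewrite mul0r -[RHS]Rintegral_probability_cst; apply: eq_Rintegral => w _.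
  by rewrite big_nil expr0n.
have bS := bounded_rv_sum s bY.
have cross (s' : seq int) : j \notin s' -> \int[P]_w (Y j w * \sum_(i <- s') Y i w) = 0.
  elim: s' => [_|i s' IH' /=].
    rewrite -[RHS]Rintegral_probability_cst; apply: eq_Rintegral => w _.
    by rewrite big_nil mulr0.
  rewrite inE negb_or => /andP[ji js'].
  have -> : \int[P]_w (Y j w * \sum_(l <- i :: s') Y l w) =
    \int[P]_w (Y j w * Y i w + Y j w * \sum_(l <- s') Y l w).
    by apply: eq_Rintegral => w _; rewrite big_cons mulrDr.
  rewrite RintegralD//.
  - by rewrite IH'// Y_cov// addr0.
  - exact: bounded_rv_integrable (bounded_rvM (bY j) (bY i)).
  - exact: bounded_rv_integrable (bounded_rvM (bY j) (bounded_rv_sum s' bY)).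
have b1 := bounded_rvM (bY j) (bY j).
have b2 := bounded_rvM (bounded_rv_cst 2) (bounded_rvM (bY j) bS).
have b3 := bounded_rvM bS bS.
have -> : \int[P]_w (\sum_(l <- j :: s) Y l w) ^+ 2 =
  \int[P]_w (Y j w * Y j w + (2 * (Y j w * \sum_(l <- s) Y l w) +
     (\sum_(l <- s) Y l w) * (\sum_(l <- s) Y l w))).
  by apply: eq_Rintegral => w _; rewrite big_cons; ring.
rewrite RintegralD//; last 2 first.
- exact: bounded_rv_integrable b1.
- exact: bounded_rv_integrable (bounded_rvD b2 b3).
rewrite RintegralD//; last 2 first.
- exact: bounded_rv_integrable b2.
- exact: bounded_rv_integrable b3.
rewrite RintegralZl//; last exact: bounded_rv_integrable (bounded_rvM (bY j) bS).
rewrite cross// mulr0 add0r.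
have -> : \int[P]_w (Y j w * Y j w) = sig ^+ 2.
  by rewrite -(Y_var j); apply: eq_Rintegral => w _; rewrite expr2.
have -> : \int[P]_w ((\sum_(l <- s) Y l w) * (\sum_(l <- s) Y l w)) = (size s)%:R * sig ^+ 2.
  by rewrite -(IH us); apply: eq_Rintegral => w _; rewrite expr2.
by rewrite mulrSr; ring.
Qed.

End walk.

End independence.

Section random_walk.
Context {R : realType}.

(** The two-sided walk vanishing at 0; the sign on the negative side makes the increment from [j] to
    [j + 1] equal to [Y j] everywhere. *)
Definition walk (Y : int -> R) (j : int) : R :=
  match j with
  | Posz n => \sum_(i < n) Y i%:Z
  | Negz n => - \sum_(i < n.+1) Y (- i.+1%:Z)
  end.

Lemma walkS (Y : int -> R) (j : int) : walk Y (j + 1) = walk Y j + Y j.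
Proof.
case: j => [n|[|n]].
- have -> : (n%:Z + 1 = n.+1%:Z)%R by lia.
  by rewrite /= big_ord_recr.
- have -> : (Negz 0 + 1 = 0%:Z)%R by lia.
  have -> : Negz 0 = (- 1%:Z)%R by lia.
  rewrite -[LHS]/(\sum_(i < 0) Y i%:Z).
  by rewrite -[RHS]/(- \sum_(i < 1) Y (- i.+1%:Z) + Y (- 1%:Z)) big_ord1 big_ord0 addNr.
- have -> : (Negz n.+1 + 1 = Negz n)%R by lia.
  rewrite /= [in RHS]big_ord_recr /= opprD -addrA.
  have -> : Y (Negz n.+1) = Y (- n.+2%:Z) by congr Y; lia.
  by rewrite addNr addr0.
Qed.

Definition walk_support (j : int) : seq int :=
  match j with
  | Posz n => [seq i%:Z | i <- iota 0 n]
  | Negz n => [seq - i.+1%:Z | i <- iota 0 n.+1]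
  end.

Lemma walk_support_uniq j : uniq (walk_support j).
Proof. by case: j => n; rewrite map_inj_uniq ?iota_uniq// => x y; lia. Qed.

Lemma size_walk_support j : size (walk_support j) = `|j|%N.
Proof. by case: j => n; rewrite size_map size_iota. Qed.

Lemma walk_sqr (Y : int -> R) j : walk Y j ^+ 2 = (\sum_(i <- walk_support j) Y i) ^+ 2.
Proof.
by case: j => n; rewrite /walk /walk_support big_map -[X in iota 0 X]subn0
  -/(index_iota _ _) big_mkord ?sqrrN.
Qed.

Context (d : measure_display) (T : measurableType d) (P : probability T R).

Lemma ae_forall_int (Q : int -> T -> Prop) : (forall j, {ae P, forall w, Q j w}) ->
  {ae P, forall w, forall j, Q j w}.
Proof.
move=> H.
have : P.-negligible (\bigcup_(n in [set: nat]) ~` [set w | Q n%:Z w] `|`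
    \bigcup_(n in [set: nat]) ~` [set w | Q (- n.+1%:Z) w]).
  by apply: negligibleU; apply: negligible_bigcup => n; exact: H.
apply: negligibleS => w /= nQ; apply: contrapT => /not_orP[n1 n2]; apply: nQ => j.
apply: contrapT => nQj; case: j nQj => n nQj; first by apply: n1; exists n.
by apply: n2; exists n => //=; rewrite -NegzE.
Qed.

(* The coefficients are truncated so as to be bounded everywhere, not just
   almost surely. *)
Lemma iid_walk (M : int -> T -> R) (a b mean : R) : 0 < a -> iid P M ->
  (forall j, {ae P, forall w, a <= M j w <= b}) -> ('E_P[M 0%R] = mean%:E)%E ->
  a <= mean /\ exists S : int -> T -> R,
  [/\ forall j, measurable_fun setT (S j),
      {ae P, forall w, forall j, S (j + 1) w = S j w + (M j w - mean)} &
      forall j, (\int[P]_w (S j w ^+ 2)%:E = (`|j|%N%:R * std_dev P (M 0%R) ^+ 2)%:E)%E].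
Proof.
move=> a0 [mM indM idM] Mab EM.
(* Clamping to [[a, Num.max a b]], an interval that is nonempty whatever [b] is. A measurable
   function applied at each site preserves independence and equality of laws. *)
pose tr (x : R) := Num.max a (Num.min x (Num.max a b)).
have mtr : measurable_fun setT tr.
  by apply: measurable_maxr => //; exact: measurable_minr.
pose X j w := tr (M j w).
have X_lo j w : a <= X j w by rewrite /X /tr le_max lexx.
have X_hi j w : X j w <= Num.max a b.
  by rewrite /X /tr ge_max le_max lexx /= ge_min lexx orbT.
have X_ge0 j w : 0 <= X j w by exact: le_trans (ltW a0) (X_lo j w).
have mX j : measurable_fun setT (X j) by exact: measurableT_comp.
have trM (B : set R) : measurable B -> measurable (tr @^-1` B).
  by move=> mB; rewrite -[X in measurable X]setTI; exact: mtr.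
have iidX : iid P X.
  split => //.
  - by move=> J B mB; apply: (indM J (fun j => tr @^-1` B j)) => j; exact: trM.
  - by move=> i j B mB; apply: (idM i j (tr @^-1` B)); exact: trM.
have XM : {ae P, forall w, forall j, X j w = M j w}.
  apply: (@filterS _ _ (ae_filter_ringOfSetsType P) _ _ _ (ae_forall_int Mab)) => w Hw j.
  have /andP[aM Mb] := Hw j.
  rewrite /X /tr min_l; first by rewrite max_r.
  by rewrite le_max Mb orbT.
have XM0 (f : R -> R) : measurable_fun setT f ->
    (\int[P]_w (f (X 0%R w))%:E = \int[P]_w (f (M 0%R w))%:E)%E.
  move=> mf; apply: ae_eq_integral => //.
  - by apply/measurable_EFinP; exact: measurableT_comp.
  - by apply/measurable_EFinP; apply: measurableT_comp.
  apply: (@filterS _ _ (ae_filter_ringOfSetsType P) _ _ _ XM) => w Hw _.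
  by rewrite Hw.
have X_mean : \int[P]_w X 0%R w = mean.
  rewrite /Rintegral; have /= -> := XM0 (fun x => x) (@measurable_id _ _ _).
  by move: EM; rewrite unlock => ->.
have X_var : \int[P]_w (X 0%R w - mean) ^+ 2 = std_dev P (M 0%R) ^+ 2.
  rewrite /Rintegral (XM0 (fun x => (x - mean) ^+ 2)); last first.
    by apply: measurable_funX; apply: measurable_funB.
  have V0 : 0 <= fine ('V_P[M 0%R])%E.
    rewrite fine_ge0// /variance unlock; apply: expectation_ge0 => w.
    by rewrite -expr2 sqr_ge0.
  rewrite /std_dev sqr_sqrtr// /variance unlock EM /=; congr fine.
  by rewrite unlock; apply: eq_integral => w _; rewrite expr2.
have bX j : bounded_rv (X j).
  by split => //; exists (Num.max a b) => w; rewrite ger0_norm.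
split.
  rewrite -X_mean -[leLHS](@Rintegral_probability_cst _ _ _ P); apply: le_Rintegral => //.
  - exact: bounded_rv_integrable (bounded_rv_cst _ a).
  - exact: bounded_rv_integrable.
pose Y j w := X j w - mean.
have bY j : bounded_rv (Y j) by apply: (bounded_rvD (bX j)); exact: (bounded_rv_cst T).
exists (fun j w => walk (Y ^~ w) j); split.
- case=> n; rewrite /walk.
    by apply: measurable_sum => i; have [] := bY i%:Z.
  by apply: measurableT_comp => //; apply: measurable_sum => i; have [] := bY (- i.+1%:Z).
- apply: (@filterS _ _ (ae_filter_ringOfSetsType P) _ _ _ XM) => w Hw j.
  by rewrite walkS /Y Hw.
- move=> j; have bS := bounded_rv_sum (walk_support j) bY.
  have bS2 := bounded_rv_integrable P (bounded_rvM bS bS).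
  have E := sum_second_moment iidX X_ge0 X_hi X_mean X_var (walk_support_uniq j).
  rewrite size_walk_support in E; rewrite -E /Rintegral fineK.
    by apply: eq_integral => w _; rewrite walk_sqr.
  have F := integrable_fin_num measurableT bS2.
  rewrite (eq_integral (EFin \o (fun w => (\sum_(i <- walk_support j) Y i w) *
    (\sum_(i <- walk_support j) Y i w))))//.
Qed.

Import HBNNSimple.

(* For a nonmeasurable [f >= 0] the integral is the supremum over the simple
   functions below [f]. *)
Lemma ge0_integral_le_ae (f g : T -> \bar R) : (forall w, (0 <= f w)%E) ->
  (forall w, (0 <= g w)%E) -> measurable_fun setT g ->
  {ae P, forall w, (f w <= g w)%E} -> (\int[P]_w f w <= \int[P]_w g w)%E.
Proof.
move=> f0 g0 mg fg; rewrite ge0_integralTE//.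
apply: ge_ereal_sup => _ [h /= hf <-]; rewrite -integralT_nnsfun.
apply: ae_ge0_le_integral => //.
- by move=> x _; rewrite lee_fin; exact: fun_ge0.
- exact/measurable_EFinP.
apply: (@filterS _ _ (ae_filter_ringOfSetsType P) _ _ _ fg) => w fgw _.
exact: le_trans (hf w) fgw.
Qed.

End random_walk.

(** * Expected error *)

Section profiles.
Context {R : realType}.
Notation mu := (@lebesgue_measure R).

Definition weighted_primitive (h : R -> R) : R -> R :=
  primitive (fun x => (1 + `|x|) * h x ^+ 2).

Lemma continuous_weighted (h : R -> R) : continuous h ->
  continuous (fun x : R => (1 + `|x|) * h x ^+ 2).
Proof.
move=> ch x; apply: cvgM.
  by apply: cvgD; [exact: cvg_cst|exact: norm_continuous].
by rewrite expr2; under eq_fun do rewrite expr2; apply: cvgM; exact: ch.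
Qed.

Lemma weighted_primitive_osc (h : R -> R) (n : R) : continuous h ->
  (forall u v, \int[mu]_(x in `[u, v]) ((1 + `|x|) * h x ^+ 2) <= n ^+ 2) ->
  forall x y, weighted_primitive h x - weighted_primitive h y <= n ^+ 2.
Proof.
move=> ch hn x y; have cw := continuous_weighted ch.
case: (leP y x) => yx.
  by rewrite /weighted_primitive primitiveB//; exact: continuous_locally_integrable.
apply: (@le_trans _ _ 0); last exact: sqr_ge0.
rewrite subr_le0; apply: (derive_ge0_le (ltW yx) (fun z => is_derive_primitive z cw)) => z _.
by rewrite mulr_ge0 ?sqr_ge0// addr_ge0.
Qed.

Lemma smooth_profile (F : R -> R) (n : R) : continuous F ->
  (forall i, (i <= 4)%N -> exists G, is_weak_derivative i F G) ->
  Hsr_norm 4 F = n%:E -> exists F1 F2 F3 : R -> R,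
  [/\ forall x : R, is_derive x 1 F (F1 x), forall x : R, is_derive x 1 F1 (F2 x),
      forall x : R, is_derive x 1 F2 (F3 x), [/\ continuous F1, continuous F2 & continuous F3] &
   [/\ forall x y, weighted_primitive F1 x - weighted_primitive F1 y <= n ^+ 2,
      forall x y, weighted_primitive F2 x - weighted_primitive F2 y <= n ^+ 2 &
      forall x y, weighted_primitive F3 x - weighted_primitive F3 y <= n ^+ 2]].
Proof.
move=> cF HF nE.
have HW i : (i <= 4)%N -> is_weak_derivative i F (weak_derivative i F).
  by move=> /HF; exact: weak_derivativeP.
have [a [a0 da c3 ae]] := weak_derivatives_smooth cF HW.
have c1 := is_derive_continuous (da 1%N isT).
have c2 := is_derive_continuous (da 2%N isT).
have osc i : (0 < i <= 3)%N -> continuous (a i) ->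
    forall x y, weighted_primitive (a i) x - weighted_primitive (a i) y <= n ^+ 2.
  move=> i3 ci; apply: weighted_primitive_osc => // u v.
  have i4 : (i <= 4)%N by lia.
  apply: weighted_itv (ae i i3) _ => //; first by have [[]] := HW i i4.
  exact: Hsr_norm_weighted nE i4.
exists (a 1%N), (a 2%N), (a 3%N); split => //.
- by have := da 0%N isT; rewrite a0.
- exact: (da 1%N isT).
- exact: (da 2%N isT).
- by split; exact: osc.
Qed.

End profiles.

Section expected_bound.
Context {R : realType} (d : measure_display) (T : measurableType d) (P : probability T R).

(* [K * eps ^+ 2 * Q / s + s] dominates [Num.sqrt (K * eps ^+ 2 * Q)] up to a
   constant; taking [s := Num.sqrt eps + sig] avoids the square root of a random
   sum. *)
Lemma expected_bound (K L eps sig : R) (X : int -> T -> R) (v : int -> R) (f : T -> \bar R) :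
  0 < K -> 0 < eps -> 0 <= sig -> (forall j, 0 <= v j) ->
  (forall j, measurable_fun setT (X j)) -> (forall j w, 0 <= X j w) ->
  (forall j, (\int[P]_w (X j w)%:E <= (v j * (1 + 4 * sig ^+ 2 / eps))%:E)%E) ->
  (forall N, wsum N v <= L / eps) -> (forall w, (0 <= f w)%E) ->
  {ae P, forall w, forall Q s, (forall N, wsum N (X ^~ w) <= Q) -> 0 < s ->
     (f w <= (K * eps ^+ 2 * Q / s + s)%:E)%E} ->
  (\int[P]_w f w <= ((1 + 4 * K * L) * (Num.sqrt eps + sig))%:E)%E.
Proof.
move=> K0 e0 s0 v0 mX X0 EX vL f0 fX.
pose s := Num.sqrt eps + sig.
have sgt0 : 0 < s by rewrite ltr_pwDl// sqrtr_gt0.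
pose x n w : \bar R := (X n%:Z w + X (- n.+1%:Z) w)%:E.
have x0 n w : (0 <= x n w)%E by rewrite lee_fin addr_ge0.
have mx n : measurable_fun setT (x n).
  by apply/measurable_EFinP; exact: measurable_funD.
pose Q w := (\sum_(0 <= n <oo) x n w)%E.
have Q0 w : (0 <= Q w)%E by apply: nneseries_ge0.
have mQ : measurable_fun setT Q by apply: ge0_emeasurable_sum.
have wsumE w N : (wsum N (X ^~ w))%:E = (\sum_(0 <= n < N) x n w)%E.
  by rewrite /wsum big_mkord -sumEFin.
have EQ : (\int[P]_w Q w <= (L / eps * (1 + 4 * sig ^+ 2 / eps))%:E)%E.
  rewrite integral_nneseries//; apply: lime_le.
    by apply: is_cvg_nneseries => n _ _; apply: integral_ge0.
  apply: nearW => N.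
  apply: (@le_trans _ _ (wsum N v * (1 + 4 * sig ^+ 2 / eps))%:E); last first.
    by rewrite lee_fin ler_wpM2r// addr_ge0// mulr_ge0 ?invr_ge0 ?(ltW e0)// mulr_ge0 ?sqr_ge0.
  rewrite mulrC -wsumZ /wsum big_mkord -sumEFin; apply: lee_sum => n _.
  rewrite /x; under eq_integral do rewrite EFinD.
  rewrite ge0_integralD//; last 4 first.
  - by move=> w _; rewrite lee_fin.
  - exact/measurable_EFinP.
  - by move=> w _; rewrite lee_fin.
  - exact/measurable_EFinP.
  by rewrite EFinD; apply: leeD; rewrite mulrC; exact: EX.
pose g w : \bar R := ((K * eps ^+ 2 / s)%:E * Q w + s%:E)%E.
have kp : 0 < K * eps ^+ 2 / s by rewrite divr_gt0// mulr_gt0// exprn_gt0.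
have k0 := ltW kp.
have kQ0 w : (0 <= (K * eps ^+ 2 / s)%:E * Q w)%E by rewrite mule_ge0.
have mkQ : measurable_fun setT (fun w => (K * eps ^+ 2 / s)%:E * Q w)%E.
  exact: measurable_funeM.
apply: (@le_trans _ _ (\int[P]_w g w)%E).
  apply: ge0_integral_le_ae => //.
  - by move=> w; rewrite adde_ge0// lee_fin ltW.
  - by apply: emeasurable_funD => //; exact: measurable_cst.
  apply: (@filterS _ _ (ae_filter_ringOfSetsType P) _ _ _ fX) => w Hw.
  have part N : ((wsum N (X ^~ w))%:E <= Q w)%E.
    by rewrite wsumE; apply: nneseries_lim_ge.
  have [Qfin|] := boolP (Q w \is a fin_num).
    have := Hw (fine (Q w)) s _ sgt0; rewrite EFinD => H.
    apply: le_trans (H _) _; first by move=> N; rewrite -lee_fin fineK.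
    by rewrite /g mulrAC EFinM fineK.
  (* Where the series diverges the bound is infinite and nothing has to be shown. *)
  rewrite ge0_fin_numE// -leNgt leye_eq => /eqP Qoo.
  by rewrite /g Qoo gt0_muley ?lte_fin// addye// leey.
rewrite /g ge0_integralD//; last first.
  by move=> w _; rewrite lee_fin ltW.
have -> : (\int[P]_w s%:E = s%:E)%E.
  rewrite integral_cst// -[RHS]mule1; congr (_ * _)%E; exact: probability_setT.
rewrite ge0_integralZl_EFin//.
apply: (@le_trans _ _ ((K * eps ^+ 2 / s)%:E * (L / eps * (1 + 4 * sig ^+ 2 / eps))%:E + s%:E)%E).
  by rewrite leeD2r// lee_wpmul2l.
rewrite -EFinM -EFinD lee_fin -/s [leRHS]mulrDl mul1r [leRHS]addrC lerD2r.
have L0 : 0 <= L.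
  by have := vL 0%N; rewrite wsum0 pmulr_lge0// invr_gt0.
(* It remains to see that [eps + 4 * sig ^+ 2 <= 4 * s ^+ 2], by expanding the square of
   [Num.sqrt eps + sig]. *)
have -> : K * eps ^+ 2 / s * (L / eps * (1 + 4 * sig ^+ 2 / eps)) =
  K * L * ((eps + 4 * sig ^+ 2) / s).
  by field; rewrite !gt_eqF.
have -> : 4 * K * L * s = K * L * (4 * s) by ring.
apply: ler_wpM2l; first by rewrite mulr_ge0// ltW.
rewrite ler_pdivrMr// -mulrA -expr2 /s sqrrD sqr_sqrtr ?(ltW e0)//.
have := mulr_ge0 (sqrtr_ge0 eps) s0; have := sqr_ge0 sig; move: e0.
rewrite -mulr_natr; lra.
Qed.

End expected_bound.

Section assembly.
Context {R : realType}.

Lemma wave_speedE (kt mb : R) : 0 < kt -> 0 < mb ->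
  [/\ 0 < wave_speed kt mb, 0 < (Num.sqrt (kt * mb))^-1,
      wave_speed kt mb * kt^-1 = (Num.sqrt (kt * mb))^-1 &
      wave_speed kt mb * (Num.sqrt (kt * mb))^-1 * mb = 1].
Proof.
move=> kt0 mb0; set z := Num.sqrt (kt * mb).
have z0 : 0 < z by rewrite sqrtr_gt0 mulr_gt0.
have zz : z * z = kt * mb by rewrite -expr2 sqr_sqrtr// mulr_ge0 ?ltW.
have cE : wave_speed kt mb = z / mb.
  rewrite /wave_speed; have -> : kt / mb = (z / mb) ^+ 2.
    by rewrite expr2 mulrACA zz; field; rewrite gt_eqF.
  by rewrite sqrtr_sqr ger0_norm// divr_ge0 ?ltW.
rewrite cE; split; rewrite ?divr_gt0 ?invr_gt0//.
- apply: (mulIf (lt0r_neq0 z0)); rewrite mulVf ?gt_eqF//.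
  have -> : z / mb / kt * z = z * z / (mb * kt) by field; rewrite !gt_eqF.
  by rewrite zz [mb * _]mulrC divff// gt_eqF// mulr_gt0.
- by field; rewrite !gt_eqF.
Qed.

Context (d : measure_display) (T : measurableType d) (P : probability T R).

(** By linearity only the second moments of the single walks enter: four of them, each at most
    [(1 + |j|) * sig ^+ 2]. *)
Lemma integral_walk_weight (s : int -> R) (chi psi : int -> T -> R) (sk sm sig : R) (j : int) :
  (forall j, measurable_fun setT (chi j)) -> (forall j, measurable_fun setT (psi j)) ->
  (forall j, (\int[P]_w (chi j w ^+ 2)%:E = (`|j|%N%:R * sk ^+ 2)%:E)%E) ->
  (forall j, (\int[P]_w (psi j w ^+ 2)%:E = (`|j|%N%:R * sm ^+ 2)%:E)%E) ->
  sk ^+ 2 <= sig ^+ 2 -> sm ^+ 2 <= sig ^+ 2 ->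
  (\int[P]_w (walk_weight s (chi ^~ w) (psi ^~ w) j)%:E <=
   (s j ^+ 2 * (1 + 4 * (1 + `|j|%N%:R) * sig ^+ 2))%:E)%E.
Proof.
move=> mchi mpsi Echi Epsi sks sms.
have m2 (Z : T -> R) : measurable_fun setT Z -> measurable_fun setT (fun w => (Z w ^+ 2)%:E).
  by move=> mZ; apply/measurable_EFinP; exact: measurable_funX.
have sq0 (Z : T -> R) w : (0 <= (Z w ^+ 2)%:E)%E by rewrite lee_fin sqr_ge0.
have -> : (\int[P]_w (walk_weight s (chi ^~ w) (psi ^~ w) j)%:E =
   (s j ^+ 2)%:E * \int[P]_w (1%:E + ((chi j w ^+ 2)%:E + ((chi (j + 1)%R w ^+ 2)%:E +
     ((psi j w ^+ 2)%:E + (psi (j + 1)%R w ^+ 2)%:E)))))%E.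
  rewrite -ge0_integralZl_EFin ?sqr_ge0//.
  - by apply: eq_integral => w _; rewrite /walk_weight EFinM -!EFinD !addrA.
  - by move=> w _; rewrite !adde_ge0// lee_fin.
  - by apply: emeasurable_funD => //; do 3! (apply: emeasurable_funD; first exact: m2); exact: m2.
rewrite ge0_integralD//; last 2 first.
- by move=> w _; rewrite !adde_ge0.
- by do 3! (apply: emeasurable_funD; first exact: m2); exact: m2.
rewrite ge0_integralD//; last 3 first.
- exact: m2.
- by move=> w _; rewrite !adde_ge0.
- by do 2! (apply: emeasurable_funD; first exact: m2); exact: m2.
rewrite ge0_integralD//; last 3 first.
- exact: m2.
- by move=> w _; rewrite !adde_ge0.
- by apply: emeasurable_funD; exact: m2.
rewrite ge0_integralD//; [|exact: m2|exact: m2].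
rewrite !Echi !Epsi.
have -> : (\int[P]_w 1%:E = 1%:E)%E.
  rewrite integral_cst// -[RHS]mule1; congr (_ * _)%E; exact: probability_setT.
rewrite -!EFinD -EFinM lee_fin ler_wpM2l ?sqr_ge0// lerD2l.
have j0 : 0 <= `|j|%N%:R :> R by [].
have j1 : `|(j + 1)%R|%N%:R <= `|j|%N%:R + 1 :> R.
  by rewrite natr1 ler_nat; lia.
have j10 : 0 <= `|(j + 1)%R|%N%:R :> R by [].
have h1 := ler_wpM2l j0 sks; have h2 := ler_wpM2l j10 sks.
have h3 := ler_wpM2l j0 sms; have h4 := ler_wpM2l j10 sms.
have h5 := ler_wpM2r (sqr_ge0 sig) j1.
have := sqr_ge0 sig; lra.
Qed.

End assembly.

Section error_integrands.
Context {R : realType}.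

Lemma ereal_sup_ell2_ge0 (tau : R) (h : int -> R -> R) : 0 <= tau ->
  (0 <= ereal_sup [set ell2_norm (h ^~ t) | t in [set t : R | (`|t| <= tau)%R]])%E.
Proof.
move=> tau0; apply: (@le_trans _ _ (ell2_norm (h ^~ 0))); first exact: poweR_ge0.
by apply: ereal_sup_ubound; exists 0 => //=; rewrite normr0.
Qed.

(** For [y >= 0], the square of [y / s + s] is at least [y]; this replaces the square root of [y] by
    an expression affine in [Q]. *)
Lemma ereal_sup_ell2_le (tau K0 K e Q s : R) (h : int -> R -> R) : K0 <= K -> 0 <= K ->
  0 <= Q -> 0 < s ->
  (forall t N, `|t| <= tau -> wsum N (fun j => h j t ^+ 2) <= K0 * e ^+ 2 * Q) ->
  (ereal_sup [set ell2_norm (h ^~ t) | t in [set t : R | (`|t| <= tau)%R]] <=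
   (K * e ^+ 2 * Q / s + s)%:E)%E.
Proof.
move=> K0K Kge0 Q0 s0 H; apply: ge_ereal_sup => _ [t /= tt <-].
have y0 : 0 <= K * e ^+ 2 * Q by rewrite mulr_ge0// mulr_ge0 ?sqr_ge0.
have ys0 : 0 <= K * e ^+ 2 * Q / s by rewrite divr_ge0 ?(ltW s0).
apply: ell2_norm_le; first by rewrite addr_ge0 ?(ltW s0).
move=> N; apply: le_trans (H t N tt) _.
apply: (@le_trans _ _ (K * e ^+ 2 * Q)).
  by rewrite ler_wpM2r// ler_wpM2r ?sqr_ge0.
have yE : K * e ^+ 2 * Q / s * s = K * e ^+ 2 * Q by rewrite divfK ?gt_eqF.
rewrite sqrrD yE; have := sqr_ge0 (K * e ^+ 2 * Q / s); have := sqr_ge0 s.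
rewrite -mulr_natr; lra.
Qed.

End error_integrands.

Theorem theorem4p3 (R : realType) (kt mb ak bk am bm T0 nA nB : R)
    (hak : 0 < ak) (ham : 0 < am) (hT0 : 0 < T0) :
  exists2 C : R, 0 < C &
  forall (d : measure_display) (T : measurableType d) (P : probability T R)
    (m k : int -> T -> R)
    (Phi Psi : R -> R) (eps : R) (r p : T -> int -> R -> R),
  let sm := std_dev P (m 0) in
  let sk := std_dev P (fun w => (k 0 w)^-1) in
  let A := profileA kt mb Phi Psi in
  let B := profileB kt mb Phi Psi in
  iid P m ->
  iid P (fun j w => (k j w)^-1) ->
  (forall j, {ae P, forall w, am <= m j w <= bm}) ->
  (forall j, {ae P, forall w, ak <= (k j w)^-1 <= bk}) ->
  ('E_P[(m 0)%R] = mb%:E)%E ->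
  ('E_P[(fun w => (k 0 w)^-1)%R] = (kt^-1)%:E)%E ->
  continuous Phi -> continuous Psi ->
  Hsr 4 Phi -> Hsr 4 Psi ->
  Hsr_norm 4 A = nA%:E -> Hsr_norm 4 B = nB%:E ->
  0 < eps < 2^-1 ->
  {ae P, forall w,
    lattice_solution (m ^~ w) (k ^~ w)
      (fun j => Phi (eps * j%:~R) / k j w) (fun j => Psi (eps * j%:~R))
      (r w) (p w)} ->
  (expected_sup_error P (T0 / eps) r
     (fun w => approx_r kt mb eps A B (k ^~ w))
   <= (C * (Num.sqrt eps + Num.max sm sk))%:E)%E
  /\
  (expected_sup_error P (T0 / eps) p
     (fun _ => approx_p kt mb eps A B)
   <= (C * (Num.sqrt eps + Num.max sm sk))%:E)%E.
Proof.
pose c := wave_speed kt mb; pose zi := (Num.sqrt (kt * mb))^-1.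
pose S := c * T0 + 1.
(* The last factor bounds the oscillation of [G] below, in which each profile contributes
   [1 + 2 + 1] weighted primitives. *)
pose L := 8 * (1 + S) * (S + 2) * (4 * (nA ^+ 2 + nB ^+ 2)).
(* The interval [[ak, bk]] contains [1 / k], so [k] ranges over [[bk^-1, ak^-1]]. *)
pose Kr := error_const_r T0 c zi bk^-1 ak^-1 am bm.
pose Kp := error_const_p T0 c zi bk^-1 ak^-1 am bm.
(* The constant is fixed before the signs of [kt], [mb] and [bk] are known; absolute values, here
   and on [L], keep it positive in any case. *)
pose K := 1 + `|Kr| + `|Kp|.
have K0 : 0 < K by rewrite /K -addrA ltr_pwDl// addr_ge0.
exists (1 + 4 * K * `|L|).
  by rewrite ltr_pwDl// mulr_ge0// mulr_ge0// ltW.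
move=> d T P m k Phi Psi eps r p sm sk A B iid_m iid_k m_ae k_ae Em Ek cPhi cPsi.
move=> [_ wPhi _] [_ wPsi _] nAE nBE /andP[eps0 eps2] sol.
have eps1 : eps <= 1 by apply: ltW; apply: lt_trans eps2 _; rewrite invf_lt1 ?ltr1n.
have [amb [psi [mpsi psiS Epsi]]] := iid_walk ham iid_m m_ae Em.
have [akt [chi [mchi chiS Echi]]] := iid_walk hak iid_k k_ae Ek.
have mb0 : 0 < mb by exact: lt_le_trans amb.
have kt0 : 0 < kt by rewrite -invr_gt0; exact: lt_le_trans akt.
have [c0 zi0 c_kt c_mb] := wave_speedE kt0 mb0; rewrite -/c -/zi in c0 zi0 c_kt c_mb.
have S0 : 0 <= S by rewrite addr_ge0// mulr_ge0 ?ltW.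
pose h := Num.sqrt (kt * mb) / 2.
have AE : A = fun x => 2^-1 * Phi x + - h * Psi x.
  by apply/funext => x; rewrite /A /profileA -/h mulNr.
have cont (a b : R) : continuous (fun x => a * Phi x + b * Psi x).
  by move=> x; apply: cvgD; apply: cvgM; [exact: cvg_cst|exact: cPhi|exact: cvg_cst|exact: cPsi].
have weak (a b : R) i : (i <= 4)%N ->
    exists G, is_weak_derivative i (fun x => a * Phi x + b * Psi x) G.
  move=> i4; have [G HG] := wPhi i i4; have [G' HG'] := wPsi i i4.
  by exists (fun x => a * G x + b * G' x); exact: is_weak_derivative_lin.
have [|i i4|A1 [A2 [A3 [dA dA1 dA2 [cA1 cA2 cA3] [oA1 oA2 oA3]]]]] := @smooth_profile R A nA _ _ nAE.
- by rewrite AE; exact: cont.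
- by rewrite AE; exact: weak.
have [|i i4|B1 [B2 [B3 [dB dB1 dB2 [cB1 cB2 cB3] [oB1 oB2 oB3]]]]] := @smooth_profile R B nB _ _ nBE.
- exact: cont.
- exact: weak.
pose wt (f : R -> R) (x : R) := (1 + `|x|) * f x ^+ 2.
have wt0 f x : 0 <= wt f x by rewrite mulr_ge0 ?sqr_ge0// addr_ge0.
pose wp := @weighted_primitive R.
have dwp f : continuous f -> forall x : R, is_derive x 1 (wp f) (wt f x).
  by move=> cf x; apply: is_derive_primitive; exact: continuous_weighted.
(* One function serves all four envelopes: it adds up the pairs of consecutive derivatives, and the
   second derivative belongs to two pairs. *)
pose G x := (wp A1 x + (2 * wp A2 x + wp A3 x)) + (wp B1 x + (2 * wp B2 x + wp B3 x)).
pose g x := (wt A1 x + (2 * wt A2 x + wt A3 x)) + (wt B1 x + (2 * wt B2 x + wt B3 x)).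
have dG (x : R) : is_derive x 1 G (g x).
  by apply: is_derive_addf; apply: is_derive_addf; try exact: dwp;
    apply: is_derive_addf; try exact: dwp; apply: is_derive_scalef; exact: dwp.
have g0 x : 0 <= g x by rewrite !addr_ge0// mulr_ge0.
have oscG x y : G x - G y <= 4 * (nA ^+ 2 + nB ^+ 2).
  have := oA1 x y; have := oA2 x y; have := oA3 x y.
  have := oB1 x y; have := oB2 x y; have := oB3 x y.
  rewrite /G /wp; lra.
have domg x : [/\ (1 + `|x|) * (A1 x ^+ 2 + A2 x ^+ 2) <= g x,
    (1 + `|x|) * (A2 x ^+ 2 + A3 x ^+ 2) <= g x,
    (1 + `|x|) * (B1 x ^+ 2 + B2 x ^+ 2) <= g x &
    (1 + `|x|) * (B2 x ^+ 2 + B3 x ^+ 2) <= g x].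
  rewrite !mulrDr -!/(wt _ _).
  have := wt0 A1 x; have := wt0 A2 x; have := wt0 A3 x.
  have := wt0 B1 x; have := wt0 B2 x; have := wt0 B3 x.
  by rewrite /g; split; lra.
pose env := envelope G eps S.
pose s j := Num.sqrt (env j).
have env0 j : 0 <= env j by exact: envelope_ge0 dG g0 S0 j.
have s2 j : s j ^+ 2 = env j by rewrite sqr_sqrtr.
have A1s j x : near_site eps c T0 j x -> `|A1 x| <= s j.
  by apply: (envelope_le dG g0 S0 dA1) => y; have [] := domg y.
have A2s j x : near_site eps c T0 j x -> `|A2 x| <= s j.
  by apply: (envelope_le dG g0 S0 dA2) => y; have [] := domg y.
have B1s j x : near_site eps c T0 j x -> `|B1 x| <= s j.
  by apply: (envelope_le dG g0 S0 dB1) => y; have [] := domg y.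
have B2s j x : near_site eps c T0 j x -> `|B2 x| <= s j.
  by apply: (envelope_le dG g0 S0 dB2) => y; have [] := domg y.
pose v j := (1 + `|eps * j%:~R|) * env j.
have vL N : wsum N v <= L / eps by exact: envelope_wsum dG g0 oscG eps0 eps1 S0 N.
have v0 j : 0 <= v j by rewrite mulr_ge0// addr_ge0.
pose sig := Num.max sm sk.
have sm0 : 0 <= sm by exact: sqrtr_ge0.
have sk0 : 0 <= sk by exact: sqrtr_ge0.
have sig0 : 0 <= sig by rewrite le_max sm0.
have sks : sk ^+ 2 <= sig ^+ 2 by rewrite lerXn2r ?nnegrE// le_max lexx orbT.
have sms : sm ^+ 2 <= sig ^+ 2 by rewrite lerXn2r ?nnegrE// le_max lexx.
pose X j w := walk_weight s (chi ^~ w) (psi ^~ w) j.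
have mX j : measurable_fun setT (X j).
  apply: measurable_funM => //; do 4! (apply: measurable_funD; last exact: measurable_funX).
  exact: measurable_cst.
have X0 j w : 0 <= X j w by rewrite /X /walk_weight mulr_ge0 ?sqr_ge0// !addr_ge0 ?sqr_ge0.
have EX j : (\int[P]_w (X j w)%:E <= (v j * (1 + 4 * sig ^+ 2 / eps))%:E)%E.
  apply: le_trans (integral_walk_weight s j mchi mpsi Echi Epsi sks sms) _.
  rewrite lee_fin s2 /v [_ * env j]mulrC -[leRHS]mulrA; apply: ler_wpM2l => //.
  have jE : `|eps * j%:~R| = eps * `|j|%N%:R.
    by rewrite normrM gtr0_norm// -intr_norm -abszE.
  rewrite jE; have J0 : 0 <= `|j|%N%:R :> R by [].
  move: (`|j|%N%:R) J0 => J J0.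
  (* The growth [1 + J] of the walk variance is at most [(1 + eps * J) / eps], which is the weight
     against which the envelope is summable. *)
  have e1 : 1 <= eps^-1 by rewrite invf_ge1.
  have -> : (1 + eps * J) * (1 + 4 * sig ^+ 2 / eps) =
    1 + eps * J + 4 * sig ^+ 2 * eps^-1 + 4 * sig ^+ 2 * J by field; rewrite gt_eqF.
  have := mulr_ge0 (ltW eps0) J0.
  have := ler_wpM2l (sqr_ge0 sig) e1; lra.
have CE : forall f : T -> \bar R, (\int[P]_w f w <= ((1 + 4 * K * L) * (Num.sqrt eps + sig))%:E)%E ->
   (\int[P]_w f w <= ((1 + 4 * K * `|L|) * (Num.sqrt eps + sig))%:E)%E.
  move=> f /le_trans; apply; rewrite lee_fin ler_wpM2r//; first by rewrite addr_ge0 ?sqrtr_ge0.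
  by rewrite lerD2l ler_wpM2l ?ler_norm// mulr_ge0// ltW.
have tau0 : 0 <= T0 / eps by rewrite divr_ge0 ?ltW.
have good : {ae P, forall w, [/\ forall j, am <= m j w <= bm,
    forall j, ak <= (k j w)^-1 <= bk,
    forall j, psi (j + 1) w = psi j w + (m j w - mb),
    forall j, chi (j + 1) w = chi j w + ((k j w)^-1 - kt^-1) &
    lattice_solution (m ^~ w) (k ^~ w)
      (fun j => waves eps c A B j 0 / k j w)
      (fun j => zi * waves eps c (fun x => - A x) B j 0) (r w) (p w)]}.
  have F := ae_filter_ringOfSetsType P.
  (* At time 0 the profiles recombine: [A + B] is [Phi], and [B - A] divided by [Num.sqrt (kt * mb)]
     is [Psi]. *)
  have W0 j : waves eps c A B j 0 = Phi (eps * j%:~R).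
    by rewrite /waves mulr0 subr0 addr0 /A /B /profileA /profileB; field.
  have W1 j : zi * waves eps c (fun x => - A x) B j 0 = Psi (eps * j%:~R).
    rewrite /waves mulr0 subr0 addr0 /A /B /profileA /profileB.
    have zz : zi * Num.sqrt (kt * mb) = 1 by rewrite mulVf// -invr_eq0 gt_eqF.
    transitivity (zi * Num.sqrt (kt * mb) * Psi (eps * j%:~R)); first by field.
    by rewrite zz mul1r.
  have E0 w : (fun j => waves eps c A B j 0 / k j w) = (fun j => Phi (eps * j%:~R) / k j w).
    by apply/funext => j; rewrite W0.
  have E1 : (fun j => zi * waves eps c (fun x => - A x) B j 0) = (fun j => Psi (eps * j%:~R)).
    by apply/funext => j; rewrite W1.
  have := ae_forall_int m_ae; have := ae_forall_int k_ae; move: psiS chiS sol.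
  move=> h1 h2 h3 h4 h5.
  apply: (@filterS3 _ _ F _ _ _ _ _ h1 h2 (@filterS3 _ _ F _ _ _ _ (fun w a b c' => And3 a b c') h3 h4 h5)).
  by move=> w a1 a2 [a3 a4 a5]; split => //; rewrite E0 E1.
have path w : [/\ forall j, am <= m j w <= bm,
    forall j, ak <= (k j w)^-1 <= bk,
    forall j, psi (j + 1) w = psi j w + (m j w - mb),
    forall j, chi (j + 1) w = chi j w + ((k j w)^-1 - kt^-1) &
    lattice_solution (m ^~ w) (k ^~ w)
      (fun j => waves eps c A B j 0 / k j w)
      (fun j => zi * waves eps c (fun x => - A x) B j 0) (r w) (p w)] ->
  forall Q, (forall N, wsum N (X ^~ w) <= Q) -> forall t N, `|t| <= T0 / eps ->
    wsum N (fun j => (r w j t - approx_r kt mb eps A B (k ^~ w) j t) ^+ 2) <= Kr * eps ^+ 2 * Q /\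
    wsum N (fun j => (p w j t - approx_p kt mb eps A B j t) ^+ 2) <= Kp * eps ^+ 2 * Q.
  move=> [mw kw psw chw solw] Q XQ t N tT.
  have bk0 : 0 < bk by have /andP[h1 h2] := kw 0; exact: lt_le_trans (lt_le_trans hak h1) h2.
  have k0 j : 0 < k j w by rewrite -invr_gt0; have /andP[h1 _] := kw j; exact: lt_le_trans h1.
  have k_ge j : bk^-1 <= k j w.
    by have /andP[_ h2] := kw j; rewrite -[leRHS]invrK lef_pV2 ?posrE ?invr_gt0.
  have k_le j : k j w <= ak^-1.
    by have /andP[h1 _] := kw j; rewrite -[leLHS]invrK lef_pV2 ?posrE ?invr_gt0.
  have m_ge j : am <= m j w by have /andP[] := mw j.
  have m_le j : m j w <= bm by have /andP[] := mw j.
  have bki : 0 < bk^-1 by rewrite invr_gt0.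
  by split; [apply: (pathwise_r eps0 eps1 hT0 c0 zi0 c_kt c_mb bki k_ge k_le ham m_ge m_le
    dA dA1 dB dB1 A1s A2s B1s B2s chw psw XQ solw)
   |apply: (pathwise_p eps0 eps1 hT0 c0 zi0 c_kt c_mb bki k_ge k_le ham m_ge m_le
    dA dA1 dB dB1 A1s A2s B1s B2s chw psw XQ solw)].
have KrK : Kr <= K.
  by rewrite /K; have := ler_norm Kr; have := normr_ge0 Kp; lra.
have KpK : Kp <= K.
  by rewrite /K; have := ler_norm Kp; have := normr_ge0 Kr; lra.
have Qge0 w Q : (forall N, wsum N (X ^~ w) <= Q) -> 0 <= Q.
  by move=> /(_ 0%N); rewrite wsum0.
split; apply: CE.
- apply: (expected_bound K0 eps0 sig0 v0 mX X0 EX vL) => [w|]; first exact: ereal_sup_ell2_ge0.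
  apply: (@filterS _ _ (ae_filter_ringOfSetsType P) _ _ _ good) => w Hw Q s' XQ s'0.
  apply: ereal_sup_ell2_le KrK (ltW K0) (Qge0 _ _ XQ) s'0 _ => t N tT.
  by have [] := path w Hw Q XQ t N tT.
- apply: (expected_bound K0 eps0 sig0 v0 mX X0 EX vL) => [w|]; first exact: ereal_sup_ell2_ge0.
  apply: (@filterS _ _ (ae_filter_ringOfSetsType P) _ _ _ good) => w Hw Q s' XQ s'0.
  apply: ereal_sup_ell2_le KpK (ltW K0) (Qge0 _ _ XQ) s'0 _ => t N tT.
  by have [] := path w Hw Q XQ t N tT.
Qed.
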